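(* Let $X=\{X(t):t\in\mathbb{R}\}$ be a spectrally negative Lévy process (no positive jumps) with $X(0)=0$ and $\mathbb{E}X(1)=0$, let $Y(t)=X(t)-t$, let $\psi(x)=\log\mathbb{E}e^{xY(1)}$ for $x\ge 0$, and let $\Phi(q)=\sup\{\theta\ge 0:\psi(\theta)=q\}$ for $q\ge 0$. Assume $\Phi(0)>0$. Let $M(t)=\inf_{s\in[0,t]}Q(s)$, where $Q$ is the stationary reflected process $Q(t)=\sup_{s\le t}(Y(t)-Y(s))$, and for $q>0$ let $\boldsymbol{e}_q$ be an exponentially distributed random variable with parameter $q$, independent of $X$. Then for all $x,q>0$, \[ \mathbb{E}\,e^{-xM(\boldsymbol{e}_q)}=\frac{\Phi(0)}{x+\Phi(0)}\cdot\frac{\Phi(q)+x}{\Phi(q)} . \]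
   Context: A Lévy process indexed by $\mathbb{R}$ is a càdlàg process with stationary independent increments and $X(0)=0$. The supremum defining $Q(t)$ is over all real $s\le t$; $Q=\{Q(t):t\ge0\}$ is a stationary process (the reflection of $Y$ at $0$). The variable $\boldsymbol{e}_q$ has mean $1/q$. For a process without positive jumps, $\psi(x)$ is finite for every $x\ge 0$. *)

(* Defs.v *)
From HB Require Import structures.
From mathcomp Require Import all_boot all_order all_algebra.
From mathcomp Require Import all_classical all_reals all_analysis.

Set Implicit Arguments.
Unset Strict Implicit.
Unset Printing Implicit Defensive.

Import Order.TTheory GRing.Theory Num.Theory.
Import numFieldNormedType.Exports.

Local Open Scope classical_set_scope.
Local Open Scope ring_scope.

Definition cadlag {R : realType} (f : R -> R) : Prop :=
  forall t : R, f s @[s --> t^'+] --> f t /\ cvg (f s @[s --> t^'-]).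

Definition no_positive_jumps {R : realType} (f : R -> R) : Prop :=
  forall t : R, f t <= lim (f s @[s --> t^'-]).

(* The product rule for subfamilies is the case where the remaining [B i]
   are [setT]. *)
Definition mutually_independent (d : measure_display) (T : measurableType d)
    (R : realType) (P : probability T R) (n : nat) (Z : 'I_n -> T -> R) : Prop :=
  forall B : 'I_n -> set R, (forall i, measurable (B i)) ->
    P (\bigcap_(i in [set: 'I_n]) Z i @^-1` B i) =
    (\prod_(i < n) P (Z i @^-1` B i))%E.

Definition process_sigma_algebra (d : measure_display) (T : measurableType d)
    (R : realType) (X : R -> T -> R) : set (set T) :=
  <<s [set A | exists t (B : set R), measurable B /\ A = X t @^-1` B] >>.

Definition independent_of_process (d : measure_display) (T : measurableType d)
    (R : realType) (P : probability T R) (X : R -> T -> R) (e : T -> R) : Prop :=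
  forall (A : set T) (B : set R), process_sigma_algebra X A -> measurable B ->
    P (A `&` e @^-1` B) = (P A * P (e @^-1` B))%E.

Section levy.
Context (d : measure_display) (T : measurableType d) (R : realType)
        (P : probability T R).

Record levy_process (X : R -> {RV P >-> R}) : Prop := LevyProcess {
  levy_start : {ae P, forall w, X 0 w = 0} ;
  levy_cadlag : {ae P, forall w, cadlag (fun t => X t w)} ;
  levy_stationary : forall (s t h : R) (B : set R), s <= t -> measurable B ->
    P [set w | B (X (t + h) w - X (s + h) w)] = P [set w | B (X t w - X s w)] ;
  levy_independent : forall (n : nat) (t : nat -> R), nondecreasing_seq t ->
    mutually_independent P (fun (i : 'I_n) w => X (t i.+1) w - X (t i) w)
}.

Record spectrally_negative_levy (X : R -> {RV P >-> R}) : Prop :=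
  SpectrallyNegativeLevy {
    spneg_levy : levy_process X ;
    spneg_jumps : {ae P, forall w, no_positive_jumps (fun t => X t w)}
  }.

Definition minus_drift (X : R -> T -> R) : R -> T -> R :=
  fun t w => X t w - t.

Definition laplace_exponent (Y : R -> T -> R) (x : R) : \bar R :=
  lne 'E_P[fun w => expR (x * Y 1 w)].

(* The set below is nonempty and bounded for the Laplace exponent of a
   spectrally negative process that is not the negative of a subordinator, so
   the default value of [sup] is not used there. *)
Definition laplace_inverse (psi : R -> \bar R) (q : R) : R :=
  sup [set theta : R | 0 <= theta /\ psi theta = q%:E].

(* Extended-real suprema and infima are used because [sup] and [inf] on [R]
   return 0 on an unbounded set; [reflected Y t] is almost surely finite for
   the processes of interest. *)
Definition reflected (Y : R -> T -> R) (t : R) (w : T) : \bar R :=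
  ereal_sup [set (Y t w - Y s w)%:E | s in [set s : R | s <= t]].

Definition running_inf (Q : R -> T -> \bar R) (t : R) (w : T) : \bar R :=
  ereal_inf [set Q s w | s in [set s : R | 0 <= s <= t]].

End levy.

Arguments laplace_exponent {d T R} P Y x.

(* Main.v *)
(* Write [y] for [Y] started at [0], [lam = Phi 0], [phi = Phi q],
   [A = inf_(s <= 0) e^(lam y(s))] and [B(t) = inf_(0 <= s <= t) e^(lam y(s))].
   Along a path without positive jumps, [M(t) > u] if and only if
   [A < e^(- lam u) B(t)].  The variables [A] and [B(t)] are independent, and [A]
   is uniform on [[0, 1]]: the process [- y(- s)] has the law of [y(s)], which
   passes levels without overshoot, and [e^(lam y(s))] is a martingale.  Hence
   [P(M(t) > u) = e^(- lam u) E B(t)] and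
   [E e^(- x M(t)) = 1 - x / (x + lam) E B(t)], so that the claim reduces to
   [E B(e_q) = 1 - lam / phi].

   On a grid with walk [W] and running maximum [S], time reversal gives
   [E min_(j <= k) e^(lam W_j) = E e^(lam (W_k - S_k))], which is the integral of
   [E (e^(lam W_k); S_k <= a)] against the exponential law of parameter [lam] in
   [a].  The numbers [al_k = E (e^(t W_k); S_k <= a)] and
   [de_k = E (e^(t W_(k+1)); S_k <= a < W_(k+1))] satisfy
   [al_(k+1) + de_k = al_k * E e^(t W_1)].  For [t = phi] and the discount factor
   [r = 1 / E e^(phi W_1)] the discounted sum of the [de_k] is [1] up to a vanishing
   term; as the overshoot disappears on fine grids, changing [phi] into [lam]
   costs the factor [e^(- (phi - lam) a)], and summation by parts yields
   [1 - e^(- (phi - lam) a)] for the discounted sum of the [al_k] with [t = lam].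
   Integrating over [a] gives [1 - lam / phi]. *)

Require Import Defs.
From HB Require Import structures.
From mathcomp Require Import all_boot all_order all_algebra.
From mathcomp Require Import all_classical all_reals all_analysis.
From mathcomp Require Import measurable_realfun.
From mathcomp Require Import ring lra.
Import Order.TTheory GRing.Theory Num.Theory.
Import numFieldNormedType.Exports.
Local Open Scope classical_set_scope.
Local Open Scope ring_scope.

Set Implicit Arguments.
Unset Strict Implicit.

(** * Independence of blocks of coordinates *)

(** No exponential moment is assumed. Their finiteness is extracted from the absence of positive
    jumps: on fine grids all upward steps are small, and a walk with bounded steps that rarely
    passes a level early has controlled exponential moments. On a fixed grid a large upward step is
    only unlikely, so the lower bounds on crossings carry an error term; it is absorbed by the
    moment of order [2 * phi] and by the probability of a large step, which vanishes as the mesh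
    goes to 0. Past and future infima are taken over dyadic times, so that every probability reduces
    to finitely many independent increments. The path may jump down at a time that is not dyadic, so
    the pathwise equivalence is only used at dyadic end points. For the same reason the infimum at
    the exponential time is never handled directly: its transform is squeezed between the two
    neighbouring grid times, and memorylessness bounds the gap by [1 - expR (- (q * 2^-1 ^+ n))].
    The condition [E X(1) = 0] excludes [Y(1) = 0] almost surely, and thereby makes the exponential
    moment strictly convex enough for its roots to be isolated. *)

Definition coord (R : realType) (I : set nat) : set (set (nat -> R)) :=
  [set C | exists i (B : set R), [/\ I i, measurable B & C = [set z | B (z i)]]].

(** The same sequences carry one sigma-algebra for each [I]; measurability on [coordType R I]
    expresses that a function depends on the coordinates in [I] only. *)
Definition coordType (R : realType) (I : set nat) :
  measurableType (@coord R I).-sigma := g_sigma_algebraType (@coord R I).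

(** A pi-system generating the coordinate sigma-algebra when [I] lies below [n]. All [n] factors are
    listed, the ones outside [I] being trivial, so that the product rule applies without
    reindexing. *)
Definition boxes (R : realType) (I : set nat) (n : nat) : set (set (nat -> R)) :=
  [set C | exists B : nat -> set R, [/\ (forall i, measurable (B i)),
     (forall i, ~ I i -> B i = setT) & C = [set z | forall i, (i < n)%N -> B i (z i)]]].

Section coord_lemmas.
Context (R : realType).

Lemma measurable_coord (I : set nat) i : I i ->
  measurable_fun [set: coordType R I] (fun z : coordType R I => z i).
Proof.
move=> Ii _ B mB; rewrite setTI; apply: sub_sigma_algebra.
by exists i, B; split.
Qed.

Lemma boxes_setI I n : setI_closed (@boxes R I n).
Proof.
move=> _ _ [B [mB BI ->]] [C [mC CI ->]].
exists (fun i => B i `&` C i); split.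
- by move=> i; exact: measurableI.
- by move=> i Ii; rewrite BI// CI// setTI.
- apply/seteqP; split => z /=.
    by move=> [h1 h2] i ltin; split; [exact: h1|exact: h2].
  by move=> h; split => i ltin; have [] := h i ltin.
Qed.

Lemma boxes_setT I n : @boxes R I n setT.
Proof.
by exists (fun=> setT); split => //; apply/seteqP; split.
Qed.

Lemma coord_boxes I n : (forall i, I i -> (i < n)%N) ->
  <<s @coord R I >> = <<s @boxes R I n >>.
Proof.
move=> In; apply/seteqP; split.
  apply: smallest_sub; first exact: smallest_sigma_algebra.
  move=> _ [i [B [Ii mB ->]]]; apply: sub_sigma_algebra.
  exists (fun j => if j == i then B else setT); split.
  - by move=> j; case: ifP.
  - by move=> j Ij; case: eqP => // ji; rewrite ji in Ij.
  - apply/seteqP; split => z /=.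
      by move=> Bz j jn; case: eqP => // ->.
    by move=> /(_ i (In i Ii)); rewrite eqxx.
apply: smallest_sub; first exact: smallest_sigma_algebra.
move=> _ [B [mB BI ->]].
have -> : [set z | forall i, (i < n)%N -> B i (z i)] =
  \bigcap_(i in [set i | I i]) [set z | B i (z i)].
  apply/seteqP; split => z /=.
    by move=> h i Ii; apply: h; exact: In.
  move=> h i ltin; have [Ii|nIi] := pselect (I i); first exact: h.
  by rewrite BI.
apply: (@bigcap_measurableType _ (coordType R I)) => i Ii.
by apply: sub_sigma_algebra; exists i, (B i); split.
Qed.

End coord_lemmas.

Section path.
Context d (T : measurableType d) (R : realType).
Implicit Types (Z : nat -> T -> R).

Definition path_of Z (I : set nat) : T -> coordType R I := fun w i => Z i w.

Lemma measurable_path_of Z I : (forall i, measurable_fun setT (Z i)) ->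
  measurable_fun setT (path_of Z I).
Proof.
move=> mZ; apply: (@measurability _ _ T (coordType R I) _ _ (@coord R I)) => //.
move=> _ [_ [i [B [Ii mB ->]]] <-].
by rewrite setTI; have := mZ i measurableT _ mB; rewrite setTI.
Qed.

Variable P : probability T R.

Lemma mutually_independent_nat Z n :
  mutually_independent P (fun i : 'I_n => Z i) ->
  forall B : nat -> set R, (forall i, measurable (B i)) ->
  P [set w | forall i, (i < n)%N -> B i (Z i w)] =
  (\prod_(i < n) P (Z i @^-1` B i))%E.
Proof.
move=> iZ B mB; rewrite -(iZ (fun i : 'I_n => B i))//; congr (P _).
apply/seteqP; split => w /=.
  by move=> h i _; exact: h.
by move=> h i ltin; exact: (h (Ordinal ltin)).
Qed.

(** Uniqueness of finite measures on the pi-system of boxes, applied to the image measures under the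
    path. *)
Lemma boxes_law_unique Z n I (m1 m2 : {measure set T -> \bar R}) :
  (forall i, measurable_fun setT (Z i)) -> (forall i, I i -> (i < n)%N) ->
  (m1 setT < +oo)%E ->
  (forall B : nat -> set R, (forall i, measurable (B i)) ->
     (forall i, ~ I i -> B i = setT) ->
     m1 [set w | forall i, (i < n)%N -> B i (Z i w)] =
     m2 [set w | forall i, (i < n)%N -> B i (Z i w)]) ->
  forall C, measurable C -> m1 (path_of Z I @^-1` C) = m2 (path_of Z I @^-1` C).
Proof.
move=> mZ In m1T m12 C mC.
have mp := measurable_path_of (I := I) mZ.
pose p : {mfun T >-> coordType R I} := mfun_Sub (mem_set mp).
change (pushforward m1 p C = pushforward m2 p C).
apply: (@measure_unique _ R (coordType R I) (@boxes R I n) (fun=> setT)) => //.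
- exact: coord_boxes.
- exact: boxes_setI.
- by move=> _; exact: boxes_setT.
- by rewrite bigcup_const.
- by move=> _ [B [mB BI ->]]; exact: m12.
Qed.

(** The uniqueness lemma is used twice: with [D] fixed both sides are measures in [C], and with a
    box in place of [C] both are measures in [D]. For two boxes each factor of the product has at
    most one nontrivial constraint, as [I] and [J] are disjoint. *)
Lemma indep_blocks Z n I J :
  (forall i, measurable_fun setT (Z i)) ->
  mutually_independent P (fun i : 'I_n => Z i) ->
  (forall i, I i -> (i < n)%N) -> (forall i, J i -> (i < n)%N) ->
  (forall i, I i -> ~ J i) ->
  forall C D, measurable C -> measurable D ->
  P (path_of Z I @^-1` C `&` path_of Z J @^-1` D) =
  (P (path_of Z I @^-1` C) * P (path_of Z J @^-1` D))%E.
Proof.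
move=> mZ /mutually_independent_nat iZ In Jn IJ C D mC mD.
have mIP K E : measurable E -> measurable (path_of Z K @^-1` E).
  by move=> mE; rewrite -[X in measurable X]setTI; exact: measurable_path_of.
have mbox (B : nat -> set R) : (forall i, measurable (B i)) ->
    measurable [set w | forall i, (i < n)%N -> B i (Z i w)].
  move=> mB; rewrite [X in measurable X](_ : _ =
    \bigcap_(i in [set i | (i < n)%N]) (setT `&` Z i @^-1` B i)); last first.
    apply/seteqP; split => w h i ltin; first by split => //; exact: h.
    by have [] := h i ltin.
  by apply: bigcap_measurableType => i _; exact: mZ.
(* A real version of [P E], so that [P F * P E] becomes a scaled measure in [F]. *)
pose sc (E : set T) : {nonneg R} := NngNum (fine_ge0 (measure_ge0 P E)).
have scE E F : measurable E -> mscale (sc E) P F = (P F * P E)%E.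
  move=> mE; rewrite /mscale /= fineK 1?muleC//; exact: fin_num_measure.
pose PC := mIP _ _ mC; pose PD := mIP _ _ mD.
rewrite -(scE _ _ PD).
change (mrestr P PD (path_of Z I @^-1` C) =
  mscale (sc (path_of Z J @^-1` D)) P (path_of Z I @^-1` C)).
apply: (@boxes_law_unique Z n I) => //.
  by rewrite /= /mrestr setTI ltey_eq fin_num_measure.
move=> B mB BI.
rewrite [RHS](scE _ _ PD) /= /mrestr setIC muleC -(scE _ _ (mbox B mB)).
change (mrestr P (mbox B mB) (path_of Z J @^-1` D) =
  mscale (sc [set w | forall i, (i < n)%N -> B i (Z i w)]) P (path_of Z J @^-1` D)).
apply: (@boxes_law_unique Z n J) => //.
  by rewrite /= /mrestr setTI ltey_eq fin_num_measure//; exact: mbox.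
move=> B' mB' BJ.
rewrite [RHS](scE _ _ (mbox B mB)) /= /mrestr.
set b' := [set w | forall i, (i < n)%N -> B' i (Z i w)].
set b := [set w | forall i, (i < n)%N -> B i (Z i w)].
change (P (b' `&` b) = (P b' * P b)%E); rewrite /b' /b !iZ//.
transitivity (P [set w | forall i, (i < n)%N -> (B' i `&` B i) (Z i w)]).
  congr (P _); apply/seteqP; split => w /=.
    by move=> [h1 h2] i ltin; split; [exact: h1|exact: h2].
  by move=> h; split => i /h [].
rewrite (iZ (fun i => B' i `&` B i)); last by move=> i; exact: measurableI.
rewrite -big_split/=; apply: eq_bigr => i _.
have [Ii|nIi] := pselect (I i).
  by rewrite BJ; [rewrite setTI preimage_setT probability_setT mul1e|exact: IJ].
by rewrite BI// setIT preimage_setT probability_setT mule1.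
Qed.

Lemma law_unique Z Z' n I :
  (forall i, measurable_fun setT (Z i)) -> (forall i, measurable_fun setT (Z' i)) ->
  mutually_independent P (fun i : 'I_n => Z i) ->
  mutually_independent P (fun i : 'I_n => Z' i) ->
  (forall i B, (i < n)%N -> measurable B -> P (Z i @^-1` B) = P (Z' i @^-1` B)) ->
  (forall i, I i -> (i < n)%N) ->
  forall C, measurable C -> P (path_of Z I @^-1` C) = P (path_of Z' I @^-1` C).
Proof.
move=> mZ mZ' /mutually_independent_nat iZ /mutually_independent_nat iZ' ZZ' In C mC.
pose p : {mfun T >-> coordType R I} := mfun_Sub (mem_set (measurable_path_of (I := I) mZ)).
pose p' : {mfun T >-> coordType R I} := mfun_Sub (mem_set (measurable_path_of (I := I) mZ')).
change (pushforward P p C = pushforward P p' C).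
apply: (@measure_unique _ R (coordType R I) (@boxes R I n) (fun=> setT)) => //.
- exact: coord_boxes.
- exact: boxes_setI.
- by move=> _; exact: boxes_setT.
- by rewrite bigcup_const.
- move=> _ [B [mB BI ->]]; rewrite /= /pushforward.
  transitivity (P [set w | forall i, (i < n)%N -> B i (Z i w)]); first by [].
  transitivity (P [set w | forall i, (i < n)%N -> B i (Z' i w)]); last by [].
  by rewrite iZ// iZ'//; apply: eq_bigr => i _; exact: ZZ'.
- by move=> k; rewrite /= /pushforward preimage_setT (le_lt_trans (probability_le1 _ _))// ltry.
Qed.

Lemma law_unique_integral Z Z' n I (F : coordType R I -> \bar R) :
  (forall i, measurable_fun setT (Z i)) -> (forall i, measurable_fun setT (Z' i)) ->
  mutually_independent P (fun i : 'I_n => Z i) ->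
  mutually_independent P (fun i : 'I_n => Z' i) ->
  (forall i B, (i < n)%N -> measurable B -> P (Z i @^-1` B) = P (Z' i @^-1` B)) ->
  (forall i, I i -> (i < n)%N) ->
  measurable_fun [set: coordType R I] F -> (forall z, 0 <= F z)%E ->
  (\int[P]_w F (path_of Z I w) = \int[P]_w F (path_of Z' I w))%E.
Proof.
move=> mZ mZ' iZ iZ' ZZ' In mF F0.
pose p : {mfun T >-> coordType R I} := mfun_Sub (mem_set (measurable_path_of (I := I) mZ)).
pose p' : {mfun T >-> coordType R I} := mfun_Sub (mem_set (measurable_path_of (I := I) mZ')).
rewrite -[LHS](@ge0_integral_distribution _ _ _ _ _ P p F)//.
rewrite -[RHS](@ge0_integral_distribution _ _ _ _ _ P p' F)//.
apply: eq_measure_integral => C mC _.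
exact: (law_unique mZ mZ' iZ iZ' ZZ' In).
Qed.

End path.

(** * Integrals of functions of two independent variables *)

Section indep2.
Context d (T : measurableType d) (R : realType) (P : probability T R).

Definition indep2 d1 d2 (T1 : measurableType d1) (T2 : measurableType d2)
    (f : T -> T1) (g : T -> T2) :=
  forall A B, measurable A -> measurable B ->
    P (f @^-1` A `&` g @^-1` B) = (P (f @^-1` A) * P (g @^-1` B))%E.

(** Independence makes the joint law the product of the two laws; Tonelli gives the iterated
    integral. *)
Lemma indep2_integral d1 d2 (T1 : measurableType d1) (T2 : measurableType d2)
    (f : T -> T1) (g : T -> T2) (h : T1 * T2 -> \bar R) :
  measurable_fun setT f -> measurable_fun setT g -> indep2 f g ->
  measurable_fun setT h -> (forall z, 0 <= h z)%E ->
  (\int[P]_w h (f w, g w) = \int[P]_w \int[P]_w' h (f w, g w'))%E.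
Proof.
move=> mf mg fg mh h0.
pose f' : {mfun T >-> T1} := mfun_Sub (mem_set mf).
pose g' : {mfun T >-> T2} := mfun_Sub (mem_set mg).
pose fg' : {mfun T >-> (T1 * T2)%type} :=
  mfun_Sub (mem_set (measurable_fun_pair mf mg)).
transitivity (\int[distribution P fg']_z h z)%E.
  by rewrite ge0_integral_distribution.
transitivity (\int[(distribution P f' \x distribution P g')]_z h z)%E.
  apply: eq_measure_integral => C mC _; apply/esym.
  by apply: product_measure_unique => // A B mA mB; exact: fg.
rewrite fubini_tonelli1//.
rewrite ge0_integral_distribution//; last 2 first.
- exact: measurable_fun_fubini_tonelli_F.
- by move=> y; exact: integral_ge0.
apply: eq_integral => w _; rewrite /= /fubini_F.
rewrite ge0_integral_distribution//; exact: measurableT_comp.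
Qed.

Lemma indep2_prod (f g : T -> R) :
  measurable_fun setT f -> measurable_fun setT g -> indep2 f g ->
  (forall w, 0 <= f w) -> (forall w, 0 <= g w) ->
  (\int[P]_w (f w * g w)%:E = (\int[P]_w (f w)%:E) * (\int[P]_w (g w)%:E))%E.
Proof.
move=> mf mg fg f0 g0.
(* Absolute values make the integrand nonnegative on the whole plane, and change nothing along [f]
   and [g]. *)
have := @indep2_integral _ _ _ _ f g (fun z => (`|z.1| * `|z.2|)%:E) mf mg fg.
have -> : (\int[P]_w (f w * g w)%:E = \int[P]_w (`|f w| * `|g w|)%:E)%E.
  by apply: eq_integral => w _; rewrite !ger0_norm.
move=> ->; last 2 first.
- apply/measurable_EFinP; apply: measurable_funM; exact: measurableT_comp.
- by move=> z; rewrite lee_fin mulr_ge0.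
rewrite -ge0_integralZr//=; last 3 first.
- exact/measurable_EFinP.
- by move=> w _; rewrite lee_fin.
- by apply: integral_ge0 => w _; rewrite lee_fin.
apply: eq_integral => w _; rewrite -ge0_integralZl//; last 3 first.
- exact/measurable_EFinP.
- by move=> w' _; rewrite lee_fin.
- by rewrite lee_fin.
by apply: eq_integral => w' _; rewrite EFinM !ger0_norm.
Qed.

End indep2.

(** * Random walks *)

Section walk.
Context (R : realType).
Implicit Types (z : nat -> R).

Definition walk z k : R := \sum_(i < k) z i.

Fixpoint walk_max z k : R :=
  if k is k'.+1 then Num.max (walk_max z k') (walk z k'.+1) else 0.

Lemma walk0 z : walk z 0 = 0. Proof. by rewrite /walk big_ord0. Qed.

Lemma walkS z k : walk z k.+1 = walk z k + z k.
Proof. by rewrite /walk big_ord_recr. Qed.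

Lemma walk_max_leP z k a : 0 <= a ->
  (walk_max z k <= a) <-> (forall j, (j <= k)%N -> walk z j <= a).
Proof.
move=> a0; elim: k => [|k IH] /=.
  by split => // _ [|//] _; rewrite walk0.
rewrite ge_max; split.
  move=> /andP[/IH h1 h2] j; rewrite leq_eqVlt => /orP[/eqP->//|].
  by rewrite ltnS; exact: h1.
move=> h; apply/andP; split; last exact: h.
by apply/IH => j jk; apply: h; rewrite (leq_trans jk).
Qed.

Lemma walk_max_ge0 z k : 0 <= walk_max z k.
Proof. by elim: k => //= k IH; rewrite le_max IH. Qed.

Lemma walk_le_max z j k : (j <= k)%N -> walk z j <= walk_max z k.
Proof. by have [+ _] := walk_max_leP z k (walk_max_ge0 z k); apply. Qed.

Lemma walk_max_attained z k : exists2 j, (j <= k)%N & walk_max z k = walk z j.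
Proof.
elim: k => [|k [j jk e]] /=; first by exists 0; rewrite ?walk0.
case: leP => _; first by exists k.+1.
by exists j => //; rewrite (leq_trans jk).
Qed.

Lemma measurable_walk_fun d (S : measurableType d) (Z : nat -> S -> R) k :
  (forall i, (i < k)%N -> measurable_fun setT (Z i)) ->
  measurable_fun setT (fun s => walk (Z^~ s) k).
Proof.
elim: k => [|k IH] mZ.
  by under eq_fun do rewrite walk0; exact: measurable_cst.
under eq_fun do rewrite walkS.
apply: measurable_funD; last exact: mZ.
by apply: IH => i ik; apply: mZ; rewrite ltnS ltnW.
Qed.

Lemma measurable_walk_max_fun d (S : measurableType d) (Z : nat -> S -> R) k :
  (forall i, (i < k)%N -> measurable_fun setT (Z i)) ->
  measurable_fun setT (fun s => walk_max (Z^~ s) k).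
Proof.
elim: k => [|k IH] mZ //=.
apply: measurable_maxr; last exact: measurable_walk_fun.
by apply: IH => i ik; apply: mZ; rewrite ltnS ltnW.
Qed.

Lemma measurable_walk (I : set nat) k : (forall i, (i < k)%N -> I i) ->
  measurable_fun setT (fun z : coordType R I => walk z k).
Proof.
move=> Ik; apply: (@measurable_walk_fun _ (coordType R I) (fun i z => z i)) => i ik.
by apply: measurable_coord; exact: Ik.
Qed.

Lemma measurable_walk_max (I : set nat) k : (forall i, (i < k)%N -> I i) ->
  measurable_fun setT (fun z : coordType R I => walk_max z k).
Proof.
move=> Ik; apply: (@measurable_walk_max_fun _ (coordType R I) (fun i z => z i)) => i ik.
by apply: measurable_coord; exact: Ik.
Qed.

End walk.

Section iid.
Context d (T : measurableType d) (R : realType) (P : probability T R).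
Implicit Types (Z : nat -> T -> R).
Local Open Scope ereal_scope.

Record iid Z : Prop := Iid {
  iid_meas : forall i, measurable_fun setT (Z i) ;
  iid_indep : forall n, mutually_independent P (fun i : 'I_n => Z i) ;
  iid_law : forall i B, measurable B -> P (Z i @^-1` B) = P (Z 0%N @^-1` B) }.

Lemma iid_comp Z (g : R -> R) : measurable_fun setT g -> iid Z ->
  iid (fun i => g \o Z i).
Proof.
move=> mg [mZ iZ lZ]; have mp B : measurable B -> measurable (g @^-1` B).
  by move=> mB; rewrite -[X in measurable X]setTI; exact: mg.
split.
- by move=> i; exact: measurableT_comp.
- by move=> n B mB; apply: (iZ n (fun i => g @^-1` B i)) => i; exact: mp.
- by move=> i B mB; exact: (lZ i (g @^-1` B) (mp _ mB)).
Qed.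

Lemma eq_law_integral (f g : T -> R) (F : R -> \bar R) :
  measurable_fun setT f -> measurable_fun setT g ->
  (forall B, measurable B -> P (f @^-1` B) = P (g @^-1` B)) ->
  measurable_fun setT F -> (forall x, 0 <= F x) ->
  \int[P]_w F (f w) = \int[P]_w F (g w).
Proof.
move=> mf mg fg mF F0.
pose f' : {mfun T >-> R} := mfun_Sub (mem_set mf).
pose g' : {mfun T >-> R} := mfun_Sub (mem_set mg).
rewrite -[LHS](@ge0_integral_distribution _ _ _ _ _ P f' F)//.
rewrite -[RHS](@ge0_integral_distribution _ _ _ _ _ P g' F)//.
by apply: eq_measure_integral => B mB _; exact: fg.
Qed.

(** Measurability of [F] on the first [k] coordinates makes it independent of the step of index [k],
    whose law is that of [Z 0]. *)
Lemma iid_past_next Z k (F : coordType R [set i | (i < k)%N] -> R) (G : R -> R) :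
  iid Z -> measurable_fun setT F -> measurable_fun setT G ->
  (forall z, 0 <= F z)%R -> (forall x, 0 <= G x)%R ->
  \int[P]_w (F (fun i => Z i w) * G (Z k w))%:E =
  (\int[P]_w (F (fun i => Z i w))%:E) * (\int[P]_w (G (Z 0%N w))%:E).
Proof.
move=> [mZ iZ lZ] mF mG F0 G0.
rewrite (@indep2_prod _ _ _ P (fun w => F (fun i => Z i w)) (fun w => G (Z k w)))//.
- congr (_ * _); apply: (eq_law_integral (F := fun x => (G x)%:E)) => //.
  + by move=> B mB; exact: lZ.
  + exact/measurable_EFinP.
- exact: (measurableT_comp mF (measurable_path_of mZ)).
- exact: (measurableT_comp mG).
move=> A B mA mB.
have := @indep_blocks _ T R P Z k.+1 [set i | (i < k)%N] [set i | i == k] mZ (iZ k.+1)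
  _ _ _ (F @^-1` A) ((fun z => G (z k)) @^-1` B).
apply.
- by move=> i /= ik; rewrite ltnS ltnW.
- by move=> i /= /eqP->.
- by move=> i /= ik /eqP ik'; rewrite ik' ltnn in ik.
- by rewrite -[X in measurable X]setTI; exact: mF.
- rewrite -[X in measurable X]setTI.
  suff : measurable_fun setT (fun z : coordType R [set i | i == k] => G (z k)).
    exact.
  by apply: measurableT_comp => //; apply: measurable_coord => /=.
Qed.

Definition exp_below (t a : R) k (z : nat -> R) : R :=
  if (walk_max z k <= a)%R then expR (t * walk z k) else 0%R.

(** The first index at which the walk exceeds [a] is [k.+1]. The means of [exp_below] and
    [exp_cross] are the [al_k] and [de_k] of the overview. *)
Definition exp_cross (t a : R) k (z : nat -> R) : R :=
  if ((walk_max z k <= a) && (a < walk z k.+1))%R then expR (t * walk z k.+1) else 0%R.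

Definition Ebelow Z t a k := \int[P]_w (exp_below t a k (Z^~ w))%:E.
Definition Ecross Z t a k := \int[P]_w (exp_cross t a k (Z^~ w))%:E.

Lemma measurable_exp_below (I : set nat) t a k : (forall i, (i < k)%N -> I i) ->
  measurable_fun setT (exp_below t a k : coordType R I -> R).
Proof.
move=> Ik; apply: measurable_fun_ifT => //.
  by apply: measurable_fun_ler => //; exact: measurable_walk_max.
apply: measurableT_comp => //; apply: measurable_funM => //.
exact: measurable_walk.
Qed.

Lemma measurable_exp_cross (I : set nat) t a k : (forall i, (i <= k)%N -> I i) ->
  measurable_fun setT (exp_cross t a k : coordType R I -> R).
Proof.
move=> Ik; apply: measurable_fun_ifT => //.
  apply: measurable_and.
    apply: measurable_fun_ler => //; apply: measurable_walk_max => i ik.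
    by apply: Ik; exact: ltnW.
  by apply: measurable_fun_ltr => //; exact: measurable_walk.
apply: measurableT_comp => //; apply: measurable_funM => //.
exact: measurable_walk.
Qed.

Lemma exp_below_ge0 t a k z : (0 <= exp_below t a k z)%R.
Proof. by rewrite /exp_below; case: ifP => // _; exact: expR_ge0. Qed.

Lemma exp_cross_ge0 t a k z : (0 <= exp_cross t a k z)%R.
Proof. by rewrite /exp_cross; case: ifP => // _; exact: expR_ge0. Qed.

Lemma measurable_exp_below_of Z t a k : (forall i, measurable_fun setT (Z i)) ->
  measurable_fun setT (fun w => exp_below t a k (Z^~ w)).
Proof.
move=> mZ; exact: (measurableT_comp (@measurable_exp_below setT t a k (fun _ _ => Logic.I))
  (measurable_path_of mZ)).
Qed.

Lemma measurable_exp_cross_of Z t a k : (forall i, measurable_fun setT (Z i)) ->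
  measurable_fun setT (fun w => exp_cross t a k (Z^~ w)).
Proof.
move=> mZ; exact: (measurableT_comp (@measurable_exp_cross setT t a k (fun _ _ => Logic.I))
  (measurable_path_of mZ)).
Qed.

Lemma Ebelow0 Z t a : (0 <= a)%R -> Ebelow Z t a 0%N = 1.
Proof.
move=> a0; rewrite /Ebelow; under eq_integral do rewrite /exp_below /= a0 walk0 mulr0 expR0.
by rewrite integral_cst// [X in _ * X]probability_setT mule1.
Qed.

(** A walk that has stayed below [a] for [k] steps either stays below or crosses at the next one.
    The two terms therefore add up to [exp_below t a k] times the exponential of an independent
    step. *)
Lemma Ebelow_step Z t a k : iid Z ->
  Ebelow Z t a k.+1 + Ecross Z t a k = Ebelow Z t a k * \int[P]_w (expR (t * Z 0%N w))%:E.
Proof.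
move=> hZ; have mZ := iid_meas hZ.
rewrite /Ebelow -(@iid_past_next Z k (exp_below t a k) (fun x => expR (t * x)))//; last 3 first.
- exact: (@measurable_exp_below [set i | (i < k)%N]).
- by apply: measurableT_comp => //; exact: measurable_funM.
- by move=> z; exact: exp_below_ge0.
rewrite -ge0_integralD//=; last 4 first.
- by move=> w _; rewrite lee_fin exp_below_ge0.
- exact/measurable_EFinP/measurable_exp_below_of.
- by move=> w _; rewrite lee_fin exp_cross_ge0.
- exact/measurable_EFinP/measurable_exp_cross_of.
apply: eq_integral => w _; rewrite -EFinD; congr EFin.
rewrite /exp_below /exp_cross /= walkS mulrDr expRD ge_max.
case: leP => _; rewrite ?andbT ?andbF; case: ifP => _;
  by rewrite ?addr0 ?add0r ?mul0r.
Qed.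

Lemma exp_walk_integral Z t k : iid Z ->
  \int[P]_w (expR (t * walk (Z^~ w) k))%:E = (\int[P]_w (expR (t * Z 0%N w))%:E) ^+ k.
Proof.
move=> hZ; elim: k => [|k IH].
  under eq_integral do rewrite walk0 mulr0 expR0.
  by rewrite integral_cst// [X in _ * X]probability_setT mule1 expe0.
under eq_integral do rewrite walkS mulrDr expRD.
rewrite (@iid_past_next Z k (fun z => expR (t * walk z k)) (fun x => expR (t * x)))//.
- by rewrite IH expeS muleC.
- apply: measurableT_comp => //; apply: measurable_funM => //.
  exact: (@measurable_walk R [set i | (i < k)%N]).
- by apply: measurableT_comp => //; exact: measurable_funM.
Qed.

End iid.

(** * Overshoot and change of exponent *)

Section step_max.
Context (R : realType).
Implicit Types (z : nat -> R).

Fixpoint step_max z k : R := if k is k'.+1 then Num.max (step_max z k') (z k') else 0.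

Lemma step_max_gtP z k e : 0 <= e ->
  (e < step_max z k) <-> (exists2 i, (i < k)%N & e < z i).
Proof.
move=> e0; elim: k => [|k IH] /=.
  by rewrite ltNge e0; split => // -[].
rewrite lt_max; split.
  move=> /orP[/IH[i ik ei]|ei]; last by exists k.
  by exists i => //; rewrite ltnS ltnW.
move=> [i]; rewrite ltnS leq_eqVlt => /orP[/eqP->->|ik ei]; first by rewrite orbT.
by apply/orP; left; apply/IH; exists i.
Qed.

Lemma measurable_step_max k (I : set nat) : (forall i, (i < k)%N -> I i) ->
  measurable_fun setT (fun z : coordType R I => step_max z k).
Proof.
elim: k => [|k IH] Ik //=.
apply: measurable_maxr; last by apply: measurable_coord; exact: Ik.
by apply: IH => i ik; apply: Ik; rewrite ltnS ltnW.
Qed.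

(* The only way in which the overshoot above [a] can exceed [e]. *)
Definition cross_jump (e a : R) k z : R :=
  if [&& walk_max z k <= a, a < walk z k.+1 & e < z k] then 1 else 0.

(** A path passes the level for the first time only once, so at most one summand is nonzero, and
    then some step exceeds [e]. *)
Lemma sum_cross_jump e a k z : 0 <= e ->
  \sum_(i < k) cross_jump e a i z <= if (a < walk_max z k) && (e < step_max z k) then 1 else 0.
Proof.
move=> e0; elim: k => [|k IH]; first by rewrite big_ord0; case: ifP.
rewrite big_ord_recr /=; rewrite /cross_jump lt_max.
case: (leP (walk_max z k) a) => /= h1; last first.
  rewrite addr0 (le_trans IH)// h1 /= lt_max.
  by case: (e < step_max z k) => //=; case: ifP.
have -> : \sum_(i < k) cross_jump e a i z = 0.
  apply/eqP; rewrite eq_le; apply/andP; split; last first.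
    by apply: sumr_ge0 => i _; rewrite /cross_jump; case: ifP.
  by rewrite (le_trans IH)// ltNge h1.
rewrite add0r lt_max; case: ifP; last by move=> _; case: ifP.
by move=> /andP[-> ->]; rewrite orbT.
Qed.

End step_max.

Section tilt.
Context (R : realType).
Implicit Types (z : nat -> R).

(** At a crossing the walk is above [a], so replacing [phi] by [theta] gains at least this factor; a
    bounded overshoot gives the converse up to [e]. *)
Lemma exp_cross_le z theta phi a k : theta <= phi ->
  exp_cross theta a k z <= expR (- (phi - theta) * a) * exp_cross phi a k z.
Proof.
move=> tp; rewrite /exp_cross; case: ifP => [/andP[_ aw]|_]; last by rewrite mulr0.
rewrite -expRD ler_expR; nra.
Qed.

(* A crossing by a large jump is absorbed by [u <= eta u^2 + 1 / (4 eta)], where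
   [u = e^(phi W)]. *)
Lemma exp_cross_ge z theta phi a e eta k : theta <= phi -> 0 < eta ->
  expR (- (phi - theta) * (a + e)) * exp_cross phi a k z <=
  exp_cross theta a k z + expR (- (phi - theta) * (a + e)) *
    (eta * exp_cross (2 * phi) a k z + (4 * eta)^-1 * cross_jump e a k z).
Proof.
move=> tp eta0; rewrite /exp_cross /cross_jump.
case: (leP (walk_max z k) a) => [wa|_] /=; last by rewrite !mulr0 !addr0 mulr0.
case: (ltP a (walk z k.+1)) => [aw|_] /=; last by rewrite !mulr0 !addr0 mulr0.
case: ltP => ez.
  rewrite mulr1 -[leLHS]add0r lerD ?expR_ge0// ler_pM2l ?expR_gt0//.
  have -> : 2 * phi * walk z k.+1 = phi * walk z k.+1 + phi * walk z k.+1 by ring.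
  rewrite expRD; set u := expR _.
  have := sqr_ge0 (2 * eta * u - 1) => h.
  rewrite -(ler_pM2l (_ : 0 < 4 * eta)); last by rewrite mulr_gt0.
  have -> : 4 * eta * (eta * (u * u) + (4 * eta)^-1) = 4 * eta * eta * u * u + 1.
    by field; rewrite gt_eqF.
  nra.
rewrite mulr0 addr0 -[leLHS]addr0 lerD//; last first.
  by rewrite !mulr_ge0// ?expR_ge0// ltW.
have wae : walk z k.+1 <= a + e.
  rewrite walkS lerD// (le_trans _ wa)//; exact: walk_le_max.
rewrite -expRD ler_expR; nra.
Qed.

Lemma exp_below_le z beta phi a k : beta <= phi ->
  exp_below phi a k z <= expR ((phi - beta) * a) * expR (beta * walk z k).
Proof.
move=> bp; rewrite /exp_below; case: ifP => [wa|_]; last by rewrite mulr_ge0 ?expR_ge0.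
rewrite -expRD ler_expR.
have : walk z k <= a by rewrite (le_trans _ wa)//; exact: walk_le_max.
nra.
Qed.

(** A last step of size at most [e] limits the overshoot to [e]; with exponent 0 the crossing term
    is the indicator of the crossing. *)
Lemma exp_cross_le0 z theta a e k : 0 <= theta -> z k <= e ->
  exp_cross theta a k z <= expR (theta * (a + e)) * exp_cross 0 a k z.
Proof.
move=> t0 ze; rewrite /exp_cross; case: ifP => [/andP[wa aw]|_]; last by rewrite mulr0.
rewrite -expRD ler_expR mul0r addr0 ler_wpM2l// walkS lerD//.
by rewrite (le_trans _ wa)//; exact: walk_le_max.
Qed.

End tilt.

(** * Discounted sums for the recursion of crossings *)

Section real_recursion.
Context (R : realType) (al de : nat -> R) (v : R).
Hypothesis al0 : al 0%N = 1.
Hypothesis rec : forall k, al k.+1 + de k = al k * v.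

(** Since [r * v = 1], each summand is the difference of two consecutive [r ^+ k * al k]. *)
Lemma recursion_telescope r m : r * v = 1 ->
  \sum_(k < m) r ^+ k.+1 * de k = 1 - r ^+ m * al m.
Proof.
move=> rv; elim: m => [|m IH]; first by rewrite big_ord0 al0 expr0; ring.
rewrite big_ord_recr /= IH; have := rec m => h.
have -> : de m = al m * v - al m.+1 by rewrite -h; ring.
have -> : r ^+ m.+1 * (al m * v - al m.+1) = r ^+ m * al m * (r * v) - r ^+ m.+1 * al m.+1.
  by rewrite exprS; ring.
rewrite rv; ring.
Qed.

(** A crude undiscounted bound, needed for the exponent [2 * phi]: the left side grows at most by
    the factor [Num.max 1 v] at each step. *)
Lemma recursion_sum_le m : (forall k, 0 <= al k) -> (forall k, 0 <= de k) ->
  \sum_(k < m) de k + al m <= Num.max 1 v ^+ m.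
Proof.
move=> alp dep; elim: m => [|m IH]; first by rewrite big_ord0 add0r al0 expr0.
rewrite big_ord_recr /= -addrA [de m + _]addrC rec exprS.
set V := Num.max 1 v.
have V1 : 1 <= V by rewrite le_max lexx.
have Vv : v <= V by rewrite le_max lexx orbT.
have S0 : 0 <= \sum_(k < m) de k by apply: sumr_ge0.
apply: (@le_trans _ _ (V * (\sum_(k < m) de k + al m))); last first.
  by rewrite ler_wpM2l// (le_trans _ V1).
rewrite mulrDr lerD//; first by rewrite -[leLHS]mul1r ler_wpM2r.
by rewrite mulrC ler_wpM2r.
Qed.

(** For [v = 1] the [de k] are the decrements of [al], and this is summation by parts. *)
Lemma recursion_abel r m : v = 1 ->
  \sum_(k < m) (1 - r) * r ^+ k * al k =
  1 - \sum_(k < m) r ^+ k.+1 * de k - r ^+ m * al m.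
Proof.
move=> v1; elim: m => [|m IH]; first by rewrite !big_ord0 al0 expr0; ring.
rewrite !big_ord_recr /= IH; have := rec m; rewrite v1 mulr1 => h.
have -> : de m = al m - al m.+1 by rewrite -h; ring.
rewrite exprS; ring.
Qed.

End real_recursion.

Section expectation.
Context d (T : measurableType d) (R : realType) (P : probability T R).
Implicit Types (f g : T -> R).

Lemma integrable_le f g : measurable_fun setT f -> (forall w, 0 <= f w <= g w) ->
  P.-integrable setT (EFin \o g) -> P.-integrable setT (EFin \o f).
Proof.
move=> mf fg; apply: le_integrable => //; first exact/measurable_EFinP.
move=> w _ /=; have /andP[f0 fgw] := fg w.
by rewrite lee_fin !ger0_norm// (le_trans f0).
Qed.

Lemma integrable_bounded f c : measurable_fun setT f -> (forall w, 0 <= f w <= c) ->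
  P.-integrable setT (EFin \o f).
Proof.
by move=> mf fc; apply: integrable_le (finite_measure_integrable_cst P c measurableT).
Qed.

Lemma ge0_integrable_lty f : measurable_fun setT f -> (forall w, 0 <= f w) ->
  (\int[P]_w (f w)%:E < +oo)%E -> P.-integrable setT (EFin \o f).
Proof.
move=> mf f0 foo; apply/integrableP; split; first exact/measurable_EFinP.
by under eq_integral do rewrite /= ger0_norm//.
Qed.

Lemma EFin_Rintegral f : P.-integrable setT (EFin \o f) ->
  (\int[P]_w f w)%:E = (\int[P]_w (f w)%:E)%E.
Proof.
by move=> fi; rewrite /Rintegral fineK// integrable_fin_num.
Qed.

Lemma integral_prob (b : T -> bool) : measurable_fun setT b ->
  (\int[P]_w (if b w then 1 else 0)%R%:E)%E = P [set w | b w].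
Proof.
move=> mb; have mB : measurable [set w | b w].
  by rewrite -[X in measurable X]setTI; exact: (mb measurableT [set true]).
rewrite -[X in _ = P X]setIT -(integral_indic P measurableT mB).
apply: eq_integral => w _; rewrite indicE; congr EFin.
have -> : (w \in [set w | b w]) = b w by apply/idP/idP => [/set_mem|h]//; exact: mem_set.
by case: (b w).
Qed.

Lemma Rintegral_prob (b : T -> bool) : measurable_fun setT b ->
  \int[P]_w (if b w then 1 else 0) = fine (P [set w | b w]).
Proof. by move=> mb; rewrite /Rintegral integral_prob. Qed.

End expectation.

(** * First passage of a walk with exponential moments *)

Section first_passage.
Context d (T : measurableType d) (R : realType) (P : probability T R).
Variable Z : nat -> T -> R.
Hypothesis iidZ : iid P Z.
Hypothesis int_exp : forall t, 0 <= t -> P.-integrable setT (EFin \o (fun w => expR (t * Z 0 w))).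

Let mZ := iid_meas iidZ.

Definition mgf t := \int[P]_w expR (t * Z 0 w).
Definition below t a k := \int[P]_w exp_below t a k (Z^~ w).
Definition cross t a k := \int[P]_w exp_cross t a k (Z^~ w).

Lemma integrable_exp_walk t k : 0 <= t ->
  P.-integrable setT (EFin \o (fun w => expR (t * walk (Z^~ w) k))).
Proof.
move=> t0; apply: ge0_integrable_lty.
- apply: measurableT_comp => //; apply: measurable_funM => //.
  by apply: measurable_walk_fun => i _; exact: mZ.
- by move=> w; exact: expR_ge0.
- rewrite exp_walk_integral// -EFin_Rintegral//; last exact: int_exp.
  by rewrite -EFin_expe ltry.
Qed.

Lemma exp_walk_mgf t k : 0 <= t -> \int[P]_w expR (t * walk (Z^~ w) k) = mgf t ^+ k.
Proof.
move=> t0; apply: EFin_inj; rewrite EFin_Rintegral; last exact: integrable_exp_walk.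
by rewrite exp_walk_integral// -EFin_Rintegral ?EFin_expe//; exact: int_exp.
Qed.

Lemma integrable_exp_below t a k : 0 <= t ->
  P.-integrable setT (EFin \o (fun w => exp_below t a k (Z^~ w))).
Proof.
move=> t0; apply: integrable_le (integrable_exp_walk k t0).
  exact: measurable_exp_below_of.
move=> w; rewrite exp_below_ge0 /= /exp_below; case: ifP => // _; exact: expR_ge0.
Qed.

Lemma integrable_exp_cross t a k : 0 <= t ->
  P.-integrable setT (EFin \o (fun w => exp_cross t a k (Z^~ w))).
Proof.
move=> t0; apply: integrable_le (integrable_exp_walk k.+1 t0).
  exact: measurable_exp_cross_of.
move=> w; rewrite exp_cross_ge0 /= /exp_cross; case: ifP => // _; exact: expR_ge0.
Qed.

Lemma below_ge0 t a k : 0 <= below t a k.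
Proof. by apply: Rintegral_ge0 => w _; exact: exp_below_ge0. Qed.

Lemma cross_ge0 t a k : 0 <= cross t a k.
Proof. by apply: Rintegral_ge0 => w _; exact: exp_cross_ge0. Qed.

Lemma below0 t a : 0 <= a -> below t a 0 = 1.
Proof. by move=> a0; rewrite /below /Rintegral; have := @Ebelow0 _ _ _ P Z t a a0; rewrite /Ebelow => ->. Qed.

Lemma below_rec t a k : 0 <= t -> below t a k.+1 + cross t a k = below t a k * mgf t.
Proof.
move=> t0; apply: EFin_inj; rewrite EFinD EFinM !EFin_Rintegral.
- exact: Ebelow_step.
- exact: int_exp.
- exact: integrable_exp_below.
- exact: integrable_exp_cross.
- exact: integrable_exp_below.
Qed.

Lemma below_le beta phi a k : 0 <= beta <= phi ->
  below phi a k <= expR ((phi - beta) * a) * mgf beta ^+ k.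
Proof.
move=> /andP[b0 bp]; rewrite -exp_walk_mgf// -RintegralZl//; last exact: integrable_exp_walk.
apply: le_Rintegral => //.
- by apply: integrable_exp_below; exact: le_trans bp.
- exact: (integrableZl measurableT _ (integrable_exp_walk k b0)).
- by move=> w _; exact: exp_below_le.
Qed.

Lemma cross_le theta phi a k : 0 <= theta <= phi ->
  cross theta a k <= expR (- (phi - theta) * a) * cross phi a k.
Proof.
move=> /andP[t0 tp]; have p0 := le_trans t0 tp.
rewrite -RintegralZl//; last exact: integrable_exp_cross.
apply: le_Rintegral => //; first exact: integrable_exp_cross.
- exact: (integrableZl measurableT _ (integrable_exp_cross a k p0)).
- by move=> w _; exact: exp_cross_le.
Qed.

Lemma measurable_step_max_of k : measurable_fun setT (fun w => step_max (Z^~ w) k).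
Proof.
exact: (measurableT_comp (@measurable_step_max R k setT (fun _ _ => Logic.I)) (measurable_path_of mZ)).
Qed.

Lemma measurable_walk_max_of k : measurable_fun setT (fun w => walk_max (Z^~ w) k).
Proof.
by apply: measurable_walk_max_fun => i _; exact: mZ.
Qed.

Lemma measurable_walk_of k : measurable_fun setT (fun w => walk (Z^~ w) k).
Proof.
by apply: measurable_walk_fun => i _; exact: mZ.
Qed.

Lemma integrable_cross_jump e a k :
  P.-integrable setT (EFin \o (fun w => cross_jump e a k (Z^~ w))).
Proof.
apply: (@integrable_bounded _ _ _ _ _ 1); last first.
  by move=> w; rewrite /cross_jump; case: ifP => _; rewrite ?lexx ?ler01.
apply: measurable_fun_ifT => //; apply: measurable_and.
  by apply: measurable_fun_ler => //; exact: measurable_walk_max_of.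
apply: measurable_and.
  by apply: measurable_fun_ltr => //; exact: measurable_walk_of.
exact: measurable_fun_ltr.
Qed.

Lemma cross_ge theta phi a e eta k : 0 <= theta <= phi -> 0 < eta ->
  expR (- (phi - theta) * (a + e)) * (cross phi a k - eta * cross (2 * phi) a k -
    (4 * eta)^-1 * \int[P]_w cross_jump e a k (Z^~ w)) <= cross theta a k.
Proof.
move=> /andP[t0 tp] eta0; have p0 := le_trans t0 tp.
have pp0 : 0 <= 2 * phi by rewrite mulr_ge0.
have i1 := integrable_exp_cross a k p0.
have i2 := integrable_exp_cross a k pp0.
have i3 := integrable_cross_jump e a k.
have i4 := integrable_exp_cross a k t0.
set c := expR _; set J := Rintegral _ _ _.
suff : c * cross phi a k <= cross theta a k + c * (eta * cross (2 * phi) a k + (4 * eta)^-1 * J).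
  by rewrite -lerBlDr; apply: le_trans; rewrite le_eqVlt; apply/orP; left; apply/eqP; ring.
have i2' := integrableZl measurableT eta i2.
have i3' := integrableZl measurableT (4 * eta)^-1 i3.
have i23 := integrableD measurableT i2' i3'.
have i23c := integrableZl measurableT c i23.
rewrite /cross /J -!RintegralZl//.
rewrite -RintegralD//.
rewrite -RintegralZl//.
rewrite -RintegralD//.
apply: le_Rintegral => //.
- exact: (integrableZl measurableT c i1).
- exact: (integrableD measurableT i4 i23c).
- by move=> w _; exact: exp_cross_ge.
Qed.

Lemma sum_cross_jump_le e a m : 0 <= e ->
  \sum_(k < m) \int[P]_w cross_jump e a k (Z^~ w) <= fine (P [set w | e < step_max (Z^~ w) m]).
Proof.
move=> e0.
have mb : measurable_fun setT (fun w => e < step_max (Z^~ w) m).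
  by apply: measurable_fun_ltr => //; exact: measurable_step_max_of.
rewrite -(Rintegral_prob P mb).
pose S m w := \sum_(k < m) cross_jump e a k (Z^~ w).
have [IS ->] : P.-integrable setT (EFin \o S m) /\
    \sum_(k < m) \int[P]_w cross_jump e a k (Z^~ w) = \int[P]_w S m w.
  elim: m {mb} => [|m [IH1 IH2]].
    have -> : S 0%N = cst 0 by apply/funext => w; rewrite /S big_ord0.
    by split; [exact: integrable0|rewrite big_ord0 Rintegral_cst// mul0r].
  have i1 := integrable_cross_jump e a m.
  have -> : S m.+1 = (fun w => S m w + cross_jump e a m (Z^~ w)).
    by apply/funext => w; rewrite /S big_ord_recr.
  split; first exact: (integrableD measurableT IH1 i1).
  by rewrite big_ord_recr /= IH2 RintegralD.
apply: le_Rintegral => //.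
- apply: (@integrable_bounded _ _ _ _ _ 1); first exact: measurable_fun_ifT.
  by move=> w; case: ifP => _; rewrite ?lexx ?ler01.
- move=> w _; apply: (le_trans (sum_cross_jump a m (Z^~ w) e0)).
  by case: (e < step_max _ m); rewrite ?andbT ?andbF//; case: ifP.
Qed.

(** With exponent [phi] the discounted sum telescopes to at most 1, and the change of exponent costs
    the factor on the right. *)
Lemma discounted_cross_le theta phi a r m : 0 <= theta <= phi -> 0 <= a -> 0 <= r ->
  r * mgf phi = 1 ->
  \sum_(k < m) r ^+ k.+1 * cross theta a k <= expR (- (phi - theta) * a).
Proof.
move=> /andP[t0 tp] a0 r0 rphi; have p0 := le_trans t0 tp.
apply: (@le_trans _ _ (expR (- (phi - theta) * a) * \sum_(k < m) r ^+ k.+1 * cross phi a k)).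
  rewrite mulr_sumr; apply: ler_sum => k _; rewrite mulrCA ler_wpM2l ?exprn_ge0//.
  by apply: cross_le; rewrite t0.
rewrite (recursion_telescope (below0 phi a0) (fun k => below_rec a k p0))//.
rewrite -[leRHS]mulr1 ler_wpM2l ?expR_ge0// gerBl.
by rewrite mulr_ge0 ?exprn_ge0// below_ge0.
Qed.

(** The three losses are the discounted mass that has not crossed after [m] steps, estimated through
    a smaller exponent [beta], the second moment of the crossings by a large step, and the
    probability of such a step. *)
Lemma discounted_cross_ge theta phi beta a e eta r m :
  0 <= theta <= phi -> 0 <= beta <= phi -> 0 <= a -> 0 <= e -> 0 < eta ->
  0 <= r <= 1 -> r * mgf phi = 1 ->
  expR (- (phi - theta) * (a + e)) *
    (1 - expR ((phi - beta) * a) * (r * mgf beta) ^+ m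
       - eta * Num.max 1 (mgf (2 * phi)) ^+ m
       - (4 * eta)^-1 * fine (P [set w | e < step_max (Z^~ w) m]))
  <= \sum_(k < m) r ^+ k.+1 * cross theta a k.
Proof.
move=> /andP[t0 tp] bp a0 e0 eta0 /andP[r0 r1] rphi; have p0 := le_trans t0 tp.
have pp0 : 0 <= 2 * phi by rewrite mulr_ge0.
set c := expR _; have c0 : 0 <= c by exact: expR_ge0.
pose J k := \int[P]_w cross_jump e a k (Z^~ w).
have J0 k : 0 <= J k.
  by apply: Rintegral_ge0 => w _; rewrite /cross_jump; case: ifP.
apply: (@le_trans _ _ (c * \sum_(k < m) r ^+ k.+1 *
    (cross phi a k - eta * cross (2 * phi) a k - (4 * eta)^-1 * J k))); last first.
  rewrite mulr_sumr; apply: ler_sum => k _; rewrite mulrCA ler_wpM2l ?exprn_ge0//.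
  by apply: cross_ge => //; rewrite t0.
rewrite ler_wpM2l//.
have rk k : r ^+ k <= 1 by rewrite exprn_ile1.
(* The discount factors, at most 1, are dropped from the negative terms only; the main term must
   keep them in order to telescope. *)
apply: (@le_trans _ _ (\sum_(k < m) (r ^+ k.+1 * cross phi a k
    - eta * cross (2 * phi) a k - (4 * eta)^-1 * J k))); last first.
  apply: ler_sum => k _; rewrite -!addrA !mulrDr lerD2l lerD//.
    rewrite mulrN lerN2 -[leRHS]mul1r ler_wpM2r// mulr_ge0 ?cross_ge0//.
    exact: ltW.
  rewrite mulrN lerN2 -[leRHS]mul1r ler_wpM2r// mulr_ge0// invr_ge0 mulr_ge0//.
  exact: ltW.
rewrite !sumrB -!mulr_sumr.
rewrite (recursion_telescope (below0 phi a0) (fun k => below_rec a k p0))//.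
rewrite lerB//; last first.
  by rewrite ler_wpM2l ?invr_ge0 ?mulr_ge0 ?(ltW eta0)// sum_cross_jump_le.
rewrite lerB//; last first.
  rewrite ler_wpM2l ?(ltW eta0)//.
  apply: le_trans (recursion_sum_le (below0 (2 * phi) a0)
    (fun k => below_rec a k pp0) m (below_ge0 _ _) (cross_ge0 _ _)).
  by rewrite lerDl below_ge0.
rewrite lerB// exprMn mulrCA ler_wpM2l ?exprn_ge0//.
exact: below_le.
Qed.

Lemma mgf0 : mgf 0 = 1.
Proof.
rewrite /mgf; under eq_Rintegral do rewrite mul0r expR0.
by rewrite Rintegral_cst//= probability_setT mul1r.
Qed.

(** Exponent 0 turns the crossing terms into probabilities of first passage at step [k.+1], and the
    recursion, with [mgf 0 = 1], telescopes. *)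
Lemma prob_walk_max_gt a m : 0 <= a ->
  fine (P [set w | a < walk_max (Z^~ w) m]) = \sum_(k < m) cross 0 a k.
Proof.
move=> a0.
have -> : \sum_(k < m) cross 0 a k = 1 - below 0 a m.
  have := recursion_telescope (below0 0 a0) (fun k => below_rec a k (lexx 0)) m (r := 1).
  rewrite mgf0 mulr1 expr1n mul1r => <-//.
  by apply: eq_bigr => k _; rewrite expr1n mul1r.
have mb := measurable_fun_ler (measurable_walk_max_of m) (measurable_cst a).
have -> : below 0 a m = fine (P [set w | walk_max (Z^~ w) m <= a]).
  rewrite -(Rintegral_prob P mb); apply: eq_Rintegral => w _.
  by rewrite /exp_below mul0r expR0.
have mB : measurable [set w | walk_max (Z^~ w) m <= a].
  by rewrite -[X in measurable X]setTI; exact: (mb measurableT [set true]).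
have -> : [set w | a < walk_max (Z^~ w) m] = ~` [set w | walk_max (Z^~ w) m <= a].
  by apply/seteqP; split => w /=; rewrite ltNge => /negP.
by rewrite probability_setC// fineB// ?fin_num_measure.
Qed.

Lemma discounted_below lam a r m : 0 <= lam -> 0 <= a -> mgf lam = 1 ->
  \sum_(k < m) (1 - r) * r ^+ k * below lam a k =
  1 - \sum_(k < m) r ^+ k.+1 * cross lam a k - r ^+ m * below lam a m.
Proof.
move=> l0 a0; exact: (recursion_abel (below0 lam a0) (fun k => below_rec a k l0)).
Qed.

(** If [v = mgf t] exceeds 1, discount by [v^-1]. Steps bounded by [e] make the discounted crossings
    of [b] at most [1/2], so [v ^- m * below t b m] is at least [1/2], whereas [below t b m] is at
    most [expR (t * b)]. *)
Lemma mgf_bounded_steps t b e m : 0 <= t -> 0 <= b ->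
  (forall i w, Z i w <= e) ->
  expR (t * (b + e)) * fine (P [set w | b < walk_max (Z^~ w) m]) <= 2^-1 ->
  mgf t ^+ m <= Num.max 1 (2 * expR (t * b)).
Proof.
move=> t0 b0 Ze small; rewrite le_max.
have [v1|v1] := leP (mgf t) 1.
  by rewrite exprn_ile1// Rintegral_ge0// => w _; exact: expR_ge0.
apply/orP; right; set v := mgf t in v1 *.
have v0 : 0 < v by rewrite (lt_trans _ v1).
have := recursion_telescope (below0 t b0) (fun k => below_rec b k t0) m (r := v^-1).
rewrite mulVf ?gt_eqF// => /(_ erefl) h.
have le1 : \sum_(k < m) v^-1 ^+ k.+1 * cross t b k <= 2^-1.
  apply: le_trans small; rewrite prob_walk_max_gt// mulr_sumr; apply: ler_sum => k _.
  have vk : v^-1 ^+ k.+1 <= 1.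
    by rewrite exprn_ile1// ?invr_ge0 ?(ltW v0)// invf_le1// ltW.
  apply: (@le_trans _ _ (cross t b k)).
    by rewrite -[leRHS]mul1r ler_wpM2r ?cross_ge0.
  rewrite -RintegralZl//; last exact: integrable_exp_cross.
  apply: le_Rintegral => //; first exact: integrable_exp_cross.
    exact: (integrableZl measurableT _ (integrable_exp_cross b k (lexx 0))).
  by move=> w _; exact: exp_cross_le0.
have le2 : below t b m <= expR (t * b).
  apply: le_trans (below_le b m (_ : 0 <= 0 <= t)) _; first by rewrite lexx.
  by rewrite mgf0 expr1n mulr1 subr0.
have vm : v^-1 ^+ m * below t b m >= 2^-1.
  by move: h le1; lra.
have : 2^-1 <= v^-1 ^+ m * expR (t * b).
  by rewrite (le_trans vm)// ler_wpM2l// exprn_ge0// invr_ge0 ltW.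
rewrite exprVn -(ler_pM2l (exprn_gt0 m v0)) mulrA divff ?expf_neq0 ?gt_eqF//.
by rewrite mul1r ler_pdivrMr// mulrC.
Qed.

End first_passage.

(** * Paths without positive jumps *)

Section dyadic.
Context (R : realType).

Definition dyadic n j : R := j%:R * 2^-1 ^+ n.

Lemma half_exp_gt0 n : 0 < 2^-1 ^+ n :> R.
Proof. by rewrite exprn_gt0. Qed.

Lemma dyadic_ge0 n j : 0 <= dyadic n j.
Proof. by rewrite mulr_ge0// ltW// half_exp_gt0. Qed.

Lemma dyadicS n j : dyadic n.+1 (2 * j) = dyadic n j.
Proof. by rewrite /dyadic exprS natrM; field. Qed.

Lemma dyadic_scale n t : dyadic n (t * 2 ^ n) = t%:R.
Proof.
by rewrite /dyadic natrM natrX -mulrA -exprMn divff ?pnatr_eq0// expr1n mulr1.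
Qed.

Lemma half_exp_small (e : R) : 0 < e -> exists N, forall n, (N <= n)%N -> 2^-1 ^+ n < e.
Proof.
move=> e0.
have : (fun n => 2^-1 ^+ n : R) @ \oo --> (0 : R).
  by apply: cvg_expr; rewrite ger0_norm// invf_lt1// ltr1n.
move=> /cvgrPdist_lt /(_ e e0)[N _ h]; exists N => n Nn.
by have := h n Nn; rewrite sub0r normrN ger0_norm// ltW// half_exp_gt0.
Qed.

Lemma dyadic_between (u v : R) : 0 <= u -> u < v ->
  exists n j, u < dyadic n j < v.
Proof.
move=> u0 uv; have vu : 0 < v - u by rewrite subr_gt0.
have [n hn] := half_exp_small vu.
exists n, (Num.truncn (u * 2 ^+ n)).+1.
have h2 : 0 < 2^-1 ^+ n :> R := half_exp_gt0 n.
have h3 : 2 ^+ n * 2^-1 ^+ n = 1 :> R by rewrite -exprMn divff ?expr1n.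
have /truncn_itv/andP[l1 l2] : 0 <= u * 2 ^+ n by rewrite mulr_ge0 ?exprn_ge0.
rewrite -(ltr_pM2r h2) -mulrA h3 mulr1 in l2.
rewrite -(ler_pM2r h2) -[leRHS]mulrA h3 mulr1 in l1.
rewrite /dyadic l2 /= -natr1 mulrDl mul1r.
have := hn n (leqnn n); lra.
Qed.

End dyadic.

Section path.
Context (R : realType) (f : R -> R).
Hypothesis cf : cadlag f.

Lemma cadlag_right t e : 0 < e -> exists2 del, 0 < del &
  forall s, t <= s -> s < t + del -> `|f s - f t| < e.
Proof.
move=> e0; have [/cvgrPdist_lt/(_ e e0) h _] := cf t.
move: h; rewrite near_withinE => /nbhs_ballP[del /= del0 h].
exists del => // s; rewrite le_eqVlt => /orP[/eqP<- _|ts sd].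
  by rewrite subrr normr0.
by rewrite distrC; apply: h => //; rewrite /ball/= ltr_distlC; lra.
Qed.

Lemma cadlag_left t e : 0 < e -> exists2 del, 0 < del &
  forall s, s < t -> t - del < s -> `|f s - lim (f s @[s --> t^'-])| < e.
Proof.
move=> e0; have [_ /cvgrPdist_lt/(_ e e0) h] := cf t.
move: h; rewrite near_withinE => /nbhs_ballP[del /= del0 h].
exists del => // s st sd.
by rewrite distrC; apply: h => //; rewrite /ball/= ltr_distlC; lra.
Qed.

(** By compactness it is enough to bound [f] near each point [x], where it stays within 1 of [f x]
    on the right and of the left limit on the left. *)
Lemma cadlag_bounded_below a b : exists c, forall u, a <= u <= b -> c <= f u.
Proof.
have /compact_near_coveringP/(_ R (+oo%R) (fun c u => - c <= f u) _) nc := @segment_compact R a b.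
suff /nc [M [_ h]] : forall x, `[a, b]%classic x ->
    \forall x' \near x & c \near +oo%R, - c <= f x'.
  exists (- (M + 1)) => u uab; apply: (h (M + 1)) => //=; first lra.
move=> x _.
  have [d1 d10 h1] := cadlag_right x ltr01.
  have [d2 d20 h2] := cadlag_left x ltr01.
  set L := lim _ in h2.
  exists ([set u | x - Num.min d1 d2 < u < x + Num.min d1 d2], [set c | - (Num.min (f x) L - 1) <= c]) => /=.
    split.
      apply/nbhs_ballP; exists (Num.min d1 d2) => /=; first by rewrite lt_min d10.
      by move=> u; rewrite /ball/= ltr_distlC.
    by apply: nbhs_pinfty_ge; rewrite num_real.
  move=> [u c] /= [/andP[u1 u2] hc].
  have := ge_min (f x) (f x) L; have := ge_min L (f x) L; rewrite !lexx orbT /= => m1 m2.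
  have m3 : Num.min d1 d2 <= d1 by rewrite ge_min lexx.
  have m4 : Num.min d1 d2 <= d2 by rewrite ge_min lexx orbT.
  have [ux|xu] := ltP u x.
    have := h2 u ux; rewrite ltr_distl => /(_ _)/andP[]; lra.
  have := h1 u xu; rewrite ltr_distl => /(_ _)/andP[]; lra.
Qed.

Hypothesis njf : no_positive_jumps f.

(* Without positive jumps the modulus of continuity controls the increments of
   [f] from above, although not from below. *)
Lemma upper_modulus a b e : 0 < e -> exists2 eta, 0 < eta &
  forall u v, a <= u <= b -> u < v -> v - u < eta -> f v - f u <= e.
Proof.
move=> e0; have e2 : 0 < e / 2 by rewrite divr_gt0.
have /compact_near_coveringP/(_ R (0^'+)
  (fun eta u => forall v, u < v -> v - u < eta -> f v - f u <= e) _) nc := @segment_compact R a b.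
suff /nc : forall x, `[a, b]%classic x ->
    \forall x' \near x & eta \near 0^'+, forall v, x' < v -> v - x' < eta -> f v - f x' <= e.
  rewrite near_withinE => /nbhs_ballP[del /= del0 h].
  exists (del / 2); first by rewrite divr_gt0.
  move=> u v uab uv vu.
  have := h (del / 2); rewrite /ball/= sub0r normrN ger0_norm ?divr_ge0 ?(ltW del0)//.
  move=> /(_ ltac:(lra) ltac:(by rewrite divr_gt0)) /(_ u); apply => //.
move=> x _.
  have [d1 d10 h1] := cadlag_right x e2.
  have [d2 d20 h2] := cadlag_left x e2.
  have := njf x; set L := lim _ in h2 * => xL.
  pose m := Num.min d1 d2.
  have m0 : 0 < m by rewrite lt_min d10.
  have m3 : m <= d1 by rewrite ge_min lexx.
  have m4 : m <= d2 by rewrite ge_min lexx orbT.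
  exists ([set u | x - m / 2 < u < x + m / 2], [set c | c < m / 2]) => /=.
    split.
      apply/nbhs_ballP; exists (m / 2) => /=; first by rewrite divr_gt0.
      by move=> u; rewrite /ball/= ltr_distlC.
    by apply: nbhs_right_lt; rewrite divr_gt0.
  move=> [u c] /= [/andP[u1 u2] hc] v uv vu.
  have [ux|xu] := ltP u x; have [vx|xv] := ltP v x.
  + have := h2 u ux; have := h2 v vx; rewrite !ltr_distl => A B.
    have := A ltac:(lra); have := B ltac:(lra); lra.
  (* The pair straddles [x]: [f u] is close to the left limit, which is at least [f x], and [f v] is
     close to [f x]. Here the absence of positive jumps enters. *)
  + have := h2 u ux; have := h1 v xv; rewrite !ltr_distl => A B.
    have := A ltac:(lra); have := B ltac:(lra); lra.
  + lra.
  + have := h1 u xu; have := h1 v xv; rewrite !ltr_distl => A B.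
    have := A ltac:(lra); have := B ltac:(lra); lra.
Qed.

Lemma small_grid_steps e t : 0 < e -> exists N, forall n, (N <= n)%N ->
  forall i, (i < t * 2 ^ n)%N -> f (dyadic R n i.+1) - f (dyadic R n i) <= e.
Proof.
move=> e0; have [eta eta0 h] := upper_modulus 0 t%:R e0.
have [N hN] := half_exp_small eta0.
exists N => n Nn i it.
have ds : dyadic R n i.+1 = dyadic R n i + 2^-1 ^+ n by rewrite /dyadic -natr1 mulrDl mul1r.
have h2 := half_exp_gt0 R n.
apply: h; rewrite ?ds; last by rewrite addrC addKr hN.
- by rewrite dyadic_ge0 -(dyadic_scale R n t) ler_wpM2r ?ler_nat ?(ltnW it)// ltW.
- by rewrite ltrDl.
Qed.

Lemma small_sup_at0 e : 0 < e -> f 0 = 0 -> exists N, forall s, 0 <= s <= 2^-1 ^+ N -> f s <= e.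
Proof.
move=> e0 f0; have [del del0 h] := cadlag_right 0 e0.
have [N hN] := half_exp_small del0.
exists N => s /andP[s0 sN]; have := h s s0; rewrite add0r f0 subr0 => h'.
apply: le_trans (ler_norm _) (ltW (h' _)).
by apply: (le_lt_trans sN); exact: hN.
Qed.

Lemma cadlag_exp_right lam t e : 0 < e -> exists2 del, 0 < del &
  forall s, t <= s -> s < t + del -> `|expR (lam * f s) - expR (lam * f t)| < e.
Proof.
move=> e0; have [h1 _] := cf t.
have : expR (lam * f s) @[s --> t^'+] --> expR (lam * f t).
  by apply: continuous_cvg; [exact: continuous_expR|exact: cvgMr].
move=> /cvgrPdist_lt/(_ e e0).
rewrite near_withinE => /nbhs_ballP[del /= del0 h].
exists del => // s; rewrite le_eqVlt => /orP[/eqP<- _|ts sd].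
  by rewrite subrr normr0.
by rewrite distrC; apply: h => //; rewrite /ball/= ltr_distlC; lra.
Qed.

(** Right continuity carries a lower bound from the dyadic points, of either sign, just after [s] to
    [s] itself. *)
Lemma exp_ge_dense lam c s s' : s < s' ->
  (forall v, s < v < s' -> (exists n j, v = dyadic R n j \/ v = - dyadic R n j) ->
    c <= expR (lam * f v)) -> c <= expR (lam * f s).
Proof.
move=> ss' h; rewrite leNgt; apply/negP => lt.
have e0 : 0 < c - expR (lam * f s) by rewrite subr_gt0.
have [del del0 hd] := cadlag_exp_right lam s e0.
pose m := Num.min s' (s + del).
have sm : s < m by rewrite lt_min ss'; lra.
have ms : m <= s' by rewrite ge_min lexx.
have md : m <= s + del by rewrite ge_min lexx orbT.
have [v vm vd] : exists2 v, s < v < m & exists n j, v = dyadic R n j \/ v = - dyadic R n j.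
  have [s0|s0] := leP 0 s.
    have [n [j hj]] := dyadic_between s0 sm.
    by exists (dyadic R n j) => //; exists n, j; left.
  pose m' := Num.min m 0.
  have sm' : s < m' by rewrite lt_min sm s0.
  have m'0 : m' <= 0 by rewrite ge_min lexx orbT.
  have m'm : m' <= m by rewrite ge_min lexx.
  have [n [j /andP[h1 h2]]] := @dyadic_between R (- m') (- s) ltac:(lra) ltac:(lra).
  exists (- dyadic R n j); first by apply/andP; split; lra.
  by exists n, j; right.
have /andP[sv vm'] := vm.
have := hd v (ltW sv) ltac:(lra); have := h v ltac:(apply/andP; split; lra) vd.
by rewrite ltr_distl => ? /andP[]; lra.
Qed.

End path.

(** * The infimum of the reflected path *)

Section reflection.
Context (R : realType) (f : R -> R) (lam t A B : R).
Hypothesis lam0 : 0 < lam.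
Hypothesis t0 : 0 <= t.
Hypothesis A0 : 0 <= A.
Hypothesis A_lb : forall s, s <= 0 -> A <= expR (lam * f s).
Hypothesis A_inf : forall c, A < c -> exists2 s, s <= 0 & expR (lam * f s) < c.
Hypothesis B0 : 0 < B.
Hypothesis B_lb : forall s, 0 <= s <= t -> B <= expR (lam * f s).
Hypothesis B_inf : forall c, B < c -> exists2 s, 0 <= s <= t & expR (lam * f s) < c.

Let Q s := ereal_sup [set (f s - f u)%:E | u in [set u | u <= s]].
Let M := ereal_inf [set Q s | s in [set s | 0 <= s <= t]].

(** If the inequality holds, one past time [v] with [f v] low enough serves all [s] in [[0, t]]. If
    it fails, take [s] almost minimizing [f] on [[0, t]]: no earlier point, past or future, lies
    more than [u + e] below [f s]. *)
Lemma running_inf_gtP u : 0 <= u -> (u%:E < M)%E <-> A < expR (- (lam * u)) * B.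
Proof.
move=> u0; split; last first.
  move=> /midf_lt[]; move: (_ / _) => c Ac cB.
  have c0 : 0 < c by rewrite (le_lt_trans A0).
  have [v v0 hv] := A_inf Ac.
  (* A level strictly above [u] that bounds the reflected path from below on all of [[0, t]]; the
     room between [A] and [c] keeps the inequality strict in the infimum. *)
  pose u' := ln (B / c) / lam.
  have lu' : lam * u' = ln (B / c) by rewrite /u' mulrC divfK// gt_eqF.
  have elu' : expR (lam * u') = B / c by rewrite lu' lnK// posrE divr_gt0.
  have uu' : u < u'.
    rewrite -(ltr_pM2l lam0) -ltr_expR elu' ltr_pdivlMr//.
    by move: cB; rewrite -(ltr_pM2l (expR_gt0 (lam * u))) mulrA -expRD subrr expR0 mul1r.
  apply: (@lt_le_trans _ _ u'%:E); first by rewrite lte_fin.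
  apply: le_ereal_inf_tmp => _ [s /= /andP[s0 st] <-].
  apply: (@le_trans _ _ (f s - f v)%:E); last first.
    by apply: ereal_sup_ubound; exists v => //=; exact: le_trans s0.
  rewrite lee_fin lerBrDr -(ler_pM2l lam0) mulrDr -ler_expR expRD elu'.
  apply: (@le_trans _ _ B); last by apply: B_lb; rewrite s0.
  by rewrite -ler_pdivlMl ?divr_gt0// invf_div divfK ?ltW// gt_eqF.
move=> uM; rewrite ltNge; apply/negP => BA.
suff : (M <= u%:E)%E by rewrite leNgt uM.
apply/lee_addgt0Pr => e e0.
have [s st hs] : exists2 s, 0 <= s <= t & expR (lam * f s) < expR (lam * e) * B.
  by apply: B_inf; rewrite ltr_pMl// -[ltLHS]expR0 ltr_expR mulr_gt0.
apply: (@le_trans _ _ (Q s)); first by apply: ereal_inf_lbound; exists s.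
apply: ge_ereal_sup => _ [v /= vs <-].
rewrite -EFinD lee_fin.
(* A past [v] is controlled by [A]; for [v] in [[0, s]] the bound [B] suffices, because [u] is
   nonnegative. *)
have [v0|v0] := leP v 0.
  have h := A_lb v0.
  have h3 : expR (- (lam * u)) * B <= expR (lam * f v) by exact: le_trans h.
  have h4 : expR (lam * f s) < expR (lam * e) * (expR (lam * u) * expR (lam * f v)).
    rewrite (lt_le_trans hs)// ler_pM2l ?expR_gt0//.
    by rewrite -(ler_pM2l (expR_gt0 (- (lam * u)))) mulrA -expRD addNr expR0 mul1r.
  move: h4; rewrite -!expRD ltr_expR -!mulrDr ltr_pM2l//; lra.
have h : B <= expR (lam * f v).
  by apply: B_lb; rewrite ltW//=; move: st => /andP[_]; exact: le_trans.
have h4 : expR (lam * f s) < expR (lam * e) * expR (lam * f v).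
  by rewrite (lt_le_trans hs)// ler_pM2l ?expR_gt0.
move: h4; rewrite -!expRD ltr_expR -!mulrDr ltr_pM2l//; lra.
Qed.

End reflection.

(** * Limits along fine grids *)

Section fine_grid_limit.
Context d (T : measurableType d) (R : realType) (P : probability T R).
Variable Z : nat -> nat -> T -> R.
Hypothesis iidZ : forall n, iid P (Z n).
Hypothesis int_exp : forall n t, 0 <= t ->
  P.-integrable setT (EFin \o (fun w => expR (t * Z n 0 w))).
Variable m : R -> R.
Hypothesis mgf_scale : forall n t, 0 <= t -> mgf P (Z n) t ^+ (2 ^ n) = m t.
Hypothesis small_steps : forall (t : nat) e, 0 < e ->
  (fun n => fine (P [set w | e < step_max ((Z n)^~ w) (t * 2 ^ n)])) @ \oo --> 0.

Lemma mgf_ge0 n t : 0 <= mgf P (Z n) t.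
Proof. by apply: Rintegral_ge0 => w _; exact: expR_ge0. Qed.

(** The constants are chosen in the order [eps], [t], [eta], [N]: [e / 2] pays for raising the level
    by [eps], and [e / 6] for each of the three losses. The horizon [t] does not depend on the
    grid. *)
Lemma discounted_cross_limit theta phi beta a (r : nat -> R) e :
  0 <= theta <= phi -> 0 <= beta <= phi -> m beta < m phi -> 0 <= a ->
  (forall n, 0 <= r n <= 1) -> (forall n, r n * mgf P (Z n) phi = 1) -> 0 < e ->
  exists t N, forall n, (N <= n)%N ->
    expR (- (phi - theta) * a) - e <= \sum_(k < t * 2 ^ n) r n ^+ k.+1 * cross P (Z n) theta a k.
Proof.
move=> tp bp mbp a0 r01 rphi e0.
have /andP[t0 tp'] := tp; have p0 := le_trans t0 tp'.
have /andP[b0 _] := bp.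
have [eps eps0 heps] : exists2 eps, 0 < eps &
    expR (- (phi - theta) * a) - e / 2 <= expR (- (phi - theta) * (a + eps)).
  have : (fun x => expR (- (phi - theta) * (a + x))) x @[x --> 0^'+] --> expR (- (phi - theta) * (a + 0)).
    apply: cvg_at_right_filter.
    apply: continuous_cvg; first exact: continuous_expR.
    by apply: cvgMr; apply: cvgD => //; exact: cvg_cst.
  rewrite addr0 => /cvgrPdist_lt/(_ (e / 2)); rewrite divr_gt0// => /(_ isT) h.
  near (0 : R)^'+ => x; exists x => //.
  have : `|expR (- (phi - theta) * a) - expR (- (phi - theta) * (a + x))| < e / 2.
    by near: x.
  by rewrite ltr_distl => /andP[]; lra.
set c := expR _ in heps *.
have c0 : 0 < c := expR_gt0 _.
pose c' := expR (- (phi - theta) * (a + eps)).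
have c'1 : 0 < c' <= 1.
  by rewrite expR_gt0 /= -(expR0 R) ler_expR; nra.
(* The factor by which the discounted moment of order [beta] decays per unit of time, the same on
   every grid. *)
pose kappa := m beta / m phi.
have mphi0 : 0 < m phi.
  rewrite (le_lt_trans _ mbp)// -(mgf_scale 0 b0) exprn_ge0//; exact: mgf_ge0.
have k01 : 0 <= kappa < 1.
  rewrite /kappa divr_ge0 ?(ltW mphi0)//=; last first.
    by rewrite -(mgf_scale 0 b0) exprn_ge0// mgf_ge0.
  by rewrite ltr_pdivrMr// mul1r.
have kE n t : (r n * mgf P (Z n) beta) ^+ (t * 2 ^ n) = kappa ^+ t.
  rewrite mulnC exprM; congr (_ ^+ _).
  rewrite exprMn mgf_scale// /kappa mulrC; congr (_ * _).
  apply: (mulIf (lt0r_neq0 mphi0)); rewrite mulVf ?gt_eqF// -(mgf_scale n p0).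
  by rewrite -exprMn rphi expr1n.
have pp0 : 0 <= 2 * phi by rewrite mulr_ge0.
have maxE n t : Num.max 1 (mgf P (Z n) (2 * phi)) ^+ (t * 2 ^ n) = Num.max 1 (m (2 * phi)) ^+ t.
  rewrite mulnC exprM; congr (_ ^+ _).
  rewrite -(mgf_scale n pp0).
  have [v1|v1] := leP (mgf P (Z n) (2 * phi)) 1.
    by rewrite expr1n; apply/esym/max_idPl; rewrite exprn_ile1// mgf_ge0.
  by apply/esym/max_idPr; rewrite exprn_ege1// ltW.
have [t ht] : exists t, expR ((phi - beta) * a) * kappa ^+ t < e / 6.
  have h0 : (fun t => expR ((phi - beta) * a) * kappa ^+ t) @ \oo --> expR ((phi - beta) * a) * 0.
    apply: cvgMr; apply: cvg_expr; rewrite ger0_norm; by case/andP: k01.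
  move: h0; rewrite mulr0 => /cvgrPdist_lt/(_ (e / 6)); rewrite divr_gt0// => /(_ isT)[t _ ht].
  exists t; have := ht t (leqnn t); rewrite sub0r normrN ger0_norm//.
  by rewrite mulr_ge0 ?expR_ge0// exprn_ge0//; case/andP: k01.
pose C := Num.max 1 (m (2 * phi)) ^+ t.
have C0 : 0 < C by rewrite exprn_gt0// lt_max ltr01.
(* [C] bounds the undiscounted moment of order [2 * phi] up to time [t], so the second moment term
   is exactly [e / 6]. *)
pose eta := e / 6 / C.
have eta0 : 0 < eta by rewrite /eta divr_gt0// divr_gt0.
have small0 : 0 < e / 6 * (4 * eta) by apply: mulr_gt0; [exact: divr_gt0|exact: mulr_gt0].
have := small_steps t eps0 => /cvgrPdist_lt/(_ _ small0)[N _ hN].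
exists t, N => n Nn; have := hN n Nn; rewrite /= sub0r normrN.
set p := fine _ => hp.
have := @discounted_cross_ge _ _ _ P (Z n) (iidZ n) (int_exp n) theta phi beta a eps eta (r n)
  (t * 2 ^ n) tp bp a0 (ltW eps0) eta0 (r01 n) (rphi n).
apply: le_trans; rewrite kE maxE -/C -/c' -/p.
have -> : eta * C = e / 6 by rewrite /eta divfK// gt_eqF.
have hp' : (4 * eta)^-1 * p <= e / 6.
  have eta40 : 0 < 4 * eta by exact: mulr_gt0.
  by rewrite mulrC ler_pdivrMr//; exact: le_trans (ler_norm _) (ltW hp).
have heps' : c - e / 2 <= c' by [].
move: (expR ((phi - beta) * a) * kappa ^+ t) ht ((4 * eta)^-1 * p) hp' => A hA B hB.
have /andP[c'0 c'1'] := c'1.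
have : c' - c' * (e / 2) <= c' * (1 - A - e / 6 - B) by nra.
apply: le_trans; nra.
Unshelve. all: by end_near. Qed.

(* [2 ^ n * 2 ^ n] steps of mesh [2 ^- n] reach time [2 ^ n]. *)
Lemma prob_sup_limit phi beta a : 0 < beta < phi -> m phi = 1 -> m beta < 1 -> 0 <= a ->
  (fun n => fine (P [set w | a < walk_max ((Z n)^~ w) (2 ^ n * 2 ^ n)])) @ \oo --> expR (- phi * a).
Proof.
move=> /andP[b0 bp] mphi mb a0; have p0 := lt_trans b0 bp.
have mgf1 n : mgf P (Z n) phi = 1.
  by apply: (pexpIrn (_ : 0 < 2 ^ n)%N); rewrite ?nnegrE ?mgf_ge0// ?expn_gt0// mgf_scale ?(ltW p0)// expr1n.
apply/cvgrPdist_le => e e0.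
have p00 := ltW p0; have b00 := ltW b0; have bp0 := ltW bp.
have [] := @discounted_cross_limit 0 phi beta a (fun=> 1) e => //.
- by rewrite lexx.
- by rewrite b00.
- by rewrite mphi.
- by move=> n; rewrite ler01 lexx.
- by move=> n; rewrite mgf1 mulr1.
move=> t [N hN]; exists (maxn N t) => // n /=; rewrite geq_max => /andP[Nn tn].
rewrite (prob_walk_max_gt (iidZ n) (int_exp n))//.
have S1 k : (\sum_(i < k) cross P (Z n) 0 a i) = \sum_(i < k) 1 ^+ i.+1 * cross P (Z n) 0 a i.
  by apply: eq_bigr => i _; rewrite expr1n mul1r.
have up : \sum_(k < 2 ^ n * 2 ^ n) cross P (Z n) 0 a k <= expR (- phi * a).
  rewrite S1; have := @discounted_cross_le _ _ _ P (Z n) (iidZ n) (int_exp n) 0 phi a 1 (2 ^ n * 2 ^ n).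
  by rewrite subr0; apply; rewrite ?lexx ?p00// mgf1 mul1r.
have := hN n Nn; rewrite subr0 => lo.
have mono : \sum_(k < t * 2 ^ n) cross P (Z n) 0 a k <= \sum_(k < 2 ^ n * 2 ^ n) cross P (Z n) 0 a k.
  have tle : (t * 2 ^ n <= 2 ^ n * 2 ^ n)%N.
    by rewrite leq_mul2r orbC (leq_trans tn) ?(ltnW (ltn_expl n _)).
  rewrite -(subnKC tle) big_split_ord /= lerDl; apply: sumr_ge0 => k _; exact: cross_ge0.
rewrite -S1 in lo; rewrite ler_distl; apply/andP; split; lra.
Qed.

(** The weights form a geometric law: this is the expectation of [exp_below] at an independent
    geometric number of steps. *)
Definition discounted_below_series lam (r : nat -> R) n a : \bar R :=
  (\sum_(0 <= k <oo) ((1 - r n) * r n ^+ k * below P (Z n) lam a k)%:E)%E.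

(** Summation by parts expresses the partial sums through crossings. The upper bound on discounted
    crossings gives the lower bound; keeping only the first [k] crossings gives the upper one. The
    remainder vanishes because [below] is at most 1 for the exponent [lam]. *)
Lemma discounted_below_series_bounds lam phi a (r : nat -> R) n :
  0 <= lam <= phi -> m lam = 1 -> 0 <= a -> (forall n, 0 < r n < 1) ->
  (forall n, r n * mgf P (Z n) phi = 1) ->
  ((1 - expR (- (phi - lam) * a))%:E <= discounted_below_series lam r n a)%E /\
  forall k, (discounted_below_series lam r n a <=
    (1 - \sum_(i < k) r n ^+ i.+1 * cross P (Z n) lam a i)%:E)%E.
Proof.
move=> tp mlam a0 r01 rphi; have /andP[l0 lp] := tp.
have /andP[r0 r1] := r01 n.
have mgf1 : mgf P (Z n) lam = 1.
  by apply: (pexpIrn (_ : 0 < 2 ^ n)%N); rewrite ?nnegrE ?mgf_ge0// ?expn_gt0// mgf_scale// expr1n.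
pose u k := ((1 - r n) * r n ^+ k * below P (Z n) lam a k)%:E.
have u0 k : (0 <= u k)%E.
  by rewrite lee_fin mulr_ge0 ?below_ge0// mulr_ge0 ?subr_ge0 ?exprn_ge0// ltW.
have partial k : (\sum_(0 <= i < k) u i =
    (1 - \sum_(i < k) r n ^+ i.+1 * cross P (Z n) lam a i - r n ^+ k * below P (Z n) lam a k)%:E)%E.
  by rewrite big_mkord sumEFin (discounted_below (iidZ n) (int_exp n)).
have b1 k : below P (Z n) lam a k <= 1.
  have := @below_le _ _ _ P (Z n) (iidZ n) (int_exp n) lam lam a k.
  by rewrite lexx l0 subrr mul0r expR0 mul1r mgf1 !expr1n; apply.
split; last first.
  move=> k; apply: lime_le; first by apply: is_cvg_nneseries => i _ _; exact: u0.
  exists k => // i /= ki; rewrite partial lee_fin.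
  apply: (@le_trans _ _ (1 - \sum_(j < i) r n ^+ j.+1 * cross P (Z n) lam a j)).
    by rewrite gerBl mulr_ge0 ?below_ge0// exprn_ge0// ltW.
  rewrite lerD2l lerN2 -(subnKC ki) big_split_ord /= lerDl.
  by apply: sumr_ge0 => j _; rewrite mulr_ge0 ?cross_ge0// exprn_ge0// ltW.
apply/lee_addgt0Pr => e e0.
have : (fun k => r n ^+ k) @ \oo --> (0 : R) by apply: cvg_expr; rewrite gtr0_norm.
move=> /cvgrPdist_lt/(_ e e0)[k _ /(_ k (leqnn k))].
rewrite sub0r normrN ger0_norm ?exprn_ge0 ?(ltW r0)// => rk.
apply: (@le_trans _ _ (\sum_(0 <= i < k) u i + e%:E)%E); last first.
  by apply: leeD2r; exact: nneseries_lim_ge.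
rewrite partial -EFinD lee_fin.
have := @discounted_cross_le _ _ _ P (Z n) (iidZ n) (int_exp n) lam phi a (r n) k tp a0 (ltW r0) (rphi n).
have : r n ^+ k * below P (Z n) lam a k <= r n ^+ k.
  by rewrite -[leRHS]mulr1 ler_wpM2l ?exprn_ge0// ltW.
lra.
Qed.

Lemma discounted_below_series_limit lam phi a (r : nat -> R) :
  0 <= lam <= phi -> m lam = 1 -> 1 < m phi -> 0 <= a -> (forall n, 0 < r n < 1) ->
  (forall n, r n * mgf P (Z n) phi = 1) ->
  (fun n => discounted_below_series lam r n a) @ \oo --> (1 - expR (- (phi - lam) * a))%:E.
Proof.
move=> tp mlam mphi a0 r01 rphi.
have r01' n : 0 <= r n <= 1 by have /andP[/ltW-> /ltW->] := r01 n.
have fin n : discounted_below_series lam r n a \is a fin_num.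
  have [h1 h2] := discounted_below_series_bounds n tp mlam a0 r01 rphi.
  have := h2 0%N; rewrite big_ord0 => h3.
  by rewrite fin_numE; case: (discounted_below_series _ _ _ _) h1 h3.
apply/fine_cvgP; split; first by near=> n; exact: fin.
apply/cvgrPdist_le => e e0.
have mlp : m lam < m phi by rewrite mlam.
(* The exponent [lam] serves both as [theta] and as the auxiliary [beta]. *)
have [t [N hN]] := discounted_cross_limit tp tp mlp a0 r01' rphi e0.
exists N => // n /= Nn; have [h1 h2] := discounted_below_series_bounds n tp mlam a0 r01 rphi.
have := h2 (t * 2 ^ n)%N; have := hN n Nn; move: h1.
rewrite -(fineK (fin n)) !lee_fin /= => h3 h4 h5.
by rewrite ler_distl; apply/andP; split; lra.
Unshelve. all: by end_near. Qed.

End fine_grid_limit.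

Section level_sets.
Context d (T : measurableType d) (R : realType).
Implicit Types (f : T -> R).

Lemma measurable_gt f c : measurable_fun setT f -> measurable [set w | c < f w].
Proof.
move=> mf; have := mf measurableT `]c, +oo[%classic (measurable_itv _).
by rewrite setTI; congr measurable; apply/seteqP; split => w /=; rewrite in_itv /= andbT.
Qed.

Lemma measurable_lt f c : measurable_fun setT f -> measurable [set w | f w < c].
Proof.
move=> mf; have := mf measurableT `]-oo, c[%classic (measurable_itv _).
by rewrite setTI; congr measurable; apply/seteqP; split => w /=; rewrite in_itv.
Qed.

End level_sets.

Section ae_limits.
Context d (T : measurableType d) (R : realType) (P : probability T R).

Lemma dominated_convergence_prob (f_ : nat -> T -> R) (f : T -> R) (c : R) :
  (forall n, measurable_fun setT (f_ n)) -> measurable_fun setT f ->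
  {ae P, forall w, (fun n => f_ n w) @ \oo --> f w} ->
  (forall n w, 0 <= f_ n w <= c) ->
  (fun n => \int[P]_w (f_ n w)%:E)%E @ \oo --> (\int[P]_w (f w)%:E)%E.
Proof.
move=> mf_ mf fcvg fb.
have [] := @dominated_convergence _ T R P setT measurableT (fun n w => (f_ n w)%:E)
  (fun w => (f w)%:E) (cst c%:E) => //.
- by move=> n; exact/measurable_EFinP.
- exact/measurable_EFinP.
- have := fcvg; apply: filterS => w h _.
  by apply/fine_cvgP; split => //; exact: nearW.
- exact: (finite_measure_integrable_cst P c measurableT).
- apply: aeW => w n _; have /andP[f0 fc] := fb n w.
  by rewrite /= lee_fin ger0_norm.
Qed.

Lemma prob_ae_eventually (A : nat -> set T) : (forall n, measurable (A n)) ->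
  {ae P, forall w, exists N, forall n, (N <= n)%N -> ~ A n w} ->
  (fun n => fine (P (A n))) @ \oo --> 0.
Proof.
move=> mA hA.
have : (fun n => \int[P]_w (\1_(A n) w)%:E)%E @ \oo --> (\int[P]_w (cst 0 w)%:E)%E.
  apply: (@dominated_convergence_prob _ _ 1) => //.
  - by move=> n; exact: measurable_indic.
  - have := hA; apply: filterS => w [N hN].
    apply/cvgrPdist_lt => e e0; exists N => // n /= Nn.
    by rewrite indicE memNset ?subr0 ?normr0//; exact: hN.
  - by move=> n w; rewrite indicE; case: (_ \in _); rewrite ?lexx ?ler01.
rewrite integral0.
have -> : (fun n => \int[P]_w (\1_(A n) w)%:E)%E = (fun n => P (A n)).
  by apply/funext => n; rewrite integral_indic// setIT.
by move=> /fine_cvgP[].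
Qed.

End ae_limits.

Lemma mutually_independent_rev d (T : measurableType d) (R : realType)
    (P : probability T R) n (Z : 'I_n -> T -> R) :
  mutually_independent P Z -> mutually_independent P (fun i => Z (rev_ord i)).
Proof.
move=> iZ B mB; rewrite (reindex_inj rev_ord_inj) /=.
under eq_bigr do rewrite rev_ordK.
rewrite -(iZ (fun i => B (rev_ord i)))//; congr (P _); apply/seteqP; split => w h i _ /=.
  by have := h (rev_ord i) Logic.I; rewrite /= rev_ordK.
by have := h (rev_ord i) Logic.I; rewrite /= rev_ordK.
Qed.

(** * Levy processes on dyadic grids *)

Definition fwd (T : Type) (R : realType) (y : R -> T -> R) n i w :=
  y (dyadic R n i.+1) w - y (dyadic R n i) w.
(** Increments met when going back from 0, still oriented forward in time: they have the law of
    [fwd], and their walk is [- y] at negative times. *)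
Definition bwd (T : Type) (R : realType) (y : R -> T -> R) n i w :=
  y (- dyadic R n i) w - y (- dyadic R n i.+1) w.

Section levy_from0.
Context d (T : measurableType d) (R : realType) (P : probability T R).

(** The value at 0 vanishes for every [w], so that the walks built from increments coincide with [y]
    on the grid everywhere and not only almost surely. *)
Record levy_from0 (y : R -> T -> R) : Prop := LevyFrom0 {
  lf_meas : forall t, measurable_fun setT (y t) ;
  lf_0 : forall w, y 0 w = 0 ;
  lf_path : {ae P, forall w, cadlag (y^~ w) /\ no_positive_jumps (y^~ w)} ;
  lf_stat : forall (s t h : R) (B : set R), s <= t -> measurable B ->
    P [set w | B (y (t + h) w - y (s + h) w)] = P [set w | B (y t w - y s w)] ;
  lf_indep : forall (n : nat) (t : nat -> R), nondecreasing_seq t ->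
    mutually_independent P (fun (i : 'I_n) w => y (t i.+1) w - y (t i) w) }.

Variable y : R -> T -> R.
Hypothesis ly : levy_from0 y.

Local Notation fwd := (fwd y).
Local Notation bwd := (bwd y).

Lemma dyadicSr n i : dyadic R n i.+1 = dyadic R n i + 2^-1 ^+ n.
Proof. by rewrite /dyadic -natr1 mulrDl mul1r. Qed.

Lemma dyadic0 n : dyadic R n 0 = 0.
Proof. by rewrite /dyadic mul0r. Qed.

Lemma ler_dyadic n i j : (i <= j)%N -> dyadic R n i <= dyadic R n j.
Proof. by move=> ij; rewrite ler_wpM2r ?ler_nat// ltW// half_exp_gt0. Qed.

Lemma walk_fwd n k w : walk ((fwd n)^~ w) k = y (dyadic R n k) w.
Proof.
elim: k => [|k IH]; first by rewrite walk0 dyadic0 (lf_0 ly).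
by rewrite walkS IH /fwd addrC subrK.
Qed.

Lemma walk_bwd n k w : walk ((bwd n)^~ w) k = - y (- dyadic R n k) w.
Proof.
elim: k => [|k IH]; first by rewrite walk0 dyadic0 oppr0 (lf_0 ly) oppr0.
by rewrite walkS IH /bwd addrA addNr add0r.
Qed.

Lemma measurable_fwd n i : measurable_fun setT (fwd n i).
Proof. by apply: measurable_funB; exact: (lf_meas ly). Qed.

Lemma measurable_bwd n i : measurable_fun setT (bwd n i).
Proof. by apply: measurable_funB; exact: (lf_meas ly). Qed.

Lemma fwd_law n i B : measurable B -> P (fwd n i @^-1` B) = P (y (2^-1 ^+ n) @^-1` B).
Proof.
move=> mB.
have := @lf_stat _ ly 0 (2^-1 ^+ n) (dyadic R n i) B (ltW (half_exp_gt0 R n)) mB.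
rewrite add0r addrC -dyadicSr => h; rewrite -[LHS]/(P [set w | B (fwd n i w)]) h.
by congr (P _); apply/seteqP; split => w /=; rewrite (lf_0 ly) subr0.
Qed.

Lemma bwd_law n i B : measurable B -> P (bwd n i @^-1` B) = P (y (2^-1 ^+ n) @^-1` B).
Proof.
move=> mB.
have := @lf_stat _ ly 0 (2^-1 ^+ n) (- dyadic R n i.+1) B (ltW (half_exp_gt0 R n)) mB.
rewrite add0r dyadicSr opprD addrC subrK.
move=> h; transitivity (P [set w | B (y (- dyadic R n i) w - y (- dyadic R n i - 2^-1 ^+ n) w)]).
  by congr (P _); apply/seteqP; split => w /=; rewrite /bwd dyadicSr opprD.
rewrite h; by congr (P _); apply/seteqP; split => w /=; rewrite (lf_0 ly) subr0.
Qed.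

Lemma fwd_iid n : iid P (fwd n).
Proof.
split; first exact: measurable_fwd.
- by move=> k; apply: (lf_indep ly) => i j; exact: ler_dyadic.
- by move=> i B mB; rewrite !fwd_law.
Qed.

Lemma bwd_iid n : iid P (bwd n).
Proof.
split; first exact: measurable_bwd.
(* Independence of increments is stated for increasing times, so the backward steps are listed from
   the most remote one and then reversed. *)
- move=> k; pose t i := - dyadic R n (k - i).
  have tnd : nondecreasing_seq t by move=> i j ij; rewrite lerN2 ler_dyadic// leq_sub2l.
  have := mutually_independent_rev (@lf_indep _ ly k t tnd).
  congr (mutually_independent P _); apply/funext => i; apply/funext => w.
  by rewrite /bwd /t /= subnSK// !subKn// ltnW.
- by move=> i B mB; rewrite !bwd_law.
Qed.

Lemma fwd_mgf_scale_ereal n t :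
  ((\int[P]_w (expR (t * fwd n 0 w))%:E) ^+ (2 ^ n) = \int[P]_w (expR (t * y 1 w))%:E)%E.
Proof.
rewrite -exp_walk_integral; last exact: fwd_iid.
apply: eq_integral => w _; rewrite walk_fwd.
by have := dyadic_scale R n 1; rewrite mul1n => ->.
Qed.

Lemma fwd_step_max_small (t : nat) e : 0 < e ->
  (fun n => fine (P [set w | e < step_max ((fwd n)^~ w) (t * 2 ^ n)])) @ \oo --> 0.
Proof.
move=> e0; apply: prob_ae_eventually.
  by move=> n; apply: measurable_gt; exact: (measurable_step_max_of (fwd_iid n)).
have := lf_path ly; apply: filterS => w [cw jw].
have [N hN] := small_grid_steps cw jw t e0.
exists N => n Nn /=; move=> /(step_max_gtP _ _ (ltW e0))[i it].
by rewrite ltNge => /negP; apply; exact: hN.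
Qed.


(** On some grid at least as fine as [2^-1 ^+ l] the process exceeds 1 before that time. Taking the
    union over all grids gives one bound valid for each of them. *)
Definition early_high l : set T :=
  \bigcup_(n in [set n | (l <= n)%N]) [set w | 1 < walk_max ((fwd n)^~ w) (2 ^ (n - l))].

Lemma measurable_early_high l : measurable (early_high l).
Proof.
apply: bigcup_measurable => n _; apply: measurable_gt.
exact: (measurable_walk_max_of (fwd_iid n)).
Qed.

Lemma dyadic_sub n l : (l <= n)%N -> dyadic R n (2 ^ (n - l)) = 2^-1 ^+ l.
Proof.
move=> ln; rewrite /dyadic natrX -[in X in _ * X](subnK ln) exprD mulrA -exprMn.
by rewrite divff ?pnatr_eq0// expr1n mul1r.
Qed.

Lemma early_high_small : (fun l => fine (P (early_high l))) @ \oo --> 0.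
Proof.
apply: prob_ae_eventually; first exact: measurable_early_high.
have := lf_path ly; apply: filterS => w [cw _].
have [N hN] := small_sup_at0 cw ltr01 (lf_0 ly w).
exists N => l Nl [n /= ln]; rewrite ltNge => /negP; apply.
apply/walk_max_leP => // j jn; rewrite walk_fwd; apply: hN.
rewrite dyadic_ge0 /= (le_trans (ler_dyadic n jn))// dyadic_sub//.
by rewrite ler_wiXn2l// invf_le1// ler1n.
Qed.

(* Truncating the steps at [1] does not change the walk in the limit of fine
   grids, since the steps become small, and the truncated walk cannot overshoot
   by more than [1]. *)
Lemma exp_moment_finite t : 0 <= t -> (\int[P]_w (expR (t * y 1 w))%:E < +oo)%E.
Proof.
move=> t0.
(* The smallness required by [mgf_bounded_steps] for the level 1 and steps at most 1. *)
have [l hl] : exists l, expR (t * (1 + 1)) * fine (P (early_high l)) <= 2^-1.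
  have e0 : 0 < (2 * expR (t * (1 + 1)))^-1 by rewrite invr_gt0 mulr_gt0 ?expR_gt0.
  have := early_high_small => /cvgrPdist_lt/(_ _ e0)[l _ /(_ l (leqnn l))].
  rewrite sub0r normrN => h; exists l.
  rewrite mulrC -ler_pdivlMr ?expR_gt0// -invfM.
  by apply: le_trans (ler_norm _) (ltW h).
pose Z n i w := Num.min (fwd n i w) 1.
have iidZ n : iid P (Z n).
  apply: (iid_comp (g := fun x => Num.min x 1)); last exact: fwd_iid.
  exact: measurable_minr.
have intZ n s : 0 <= s -> P.-integrable setT (EFin \o (fun w => expR (s * Z n 0%N w))).
  move=> s0; apply: (@integrable_bounded _ _ _ _ _ (expR s)).
    apply: measurableT_comp => //; apply: measurable_funM => //.
    exact: (iid_meas (iidZ n)).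
  by move=> w; rewrite expR_ge0 ler_expR -[leRHS]mulr1 ler_wpM2l// ge_min lexx orbT.
pose C := Num.max 1 (2 * expR (t * 1)).
(* These [2 ^ n] steps of mesh [2 ^- (l + n)] end at the fixed time [2 ^- l]. *)
pose Wn n w := walk ((Z (l + n))^~ w) (2 ^ n).
have mWn n : measurable_fun setT (Wn n) by exact: (measurable_walk_of (iidZ _)).
have bnd n : (\int[P]_w (expR (t * Wn n w))%:E <= C%:E)%E.
  rewrite /Wn -EFin_Rintegral; last exact: (integrable_exp_walk (iidZ _) (intZ _)).
  rewrite lee_fin (exp_walk_mgf (iidZ _) (intZ _))//.
  apply: (mgf_bounded_steps (iidZ _) (intZ _) (e := 1)) => //.
    by move=> i w; rewrite /Z ge_min lexx orbT.
  apply: le_trans hl; rewrite ler_wpM2l ?expR_ge0// fine_le ?fin_num_measure//.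
  - by apply: measurable_gt; exact: (measurable_walk_max_of (iidZ _)).
  - exact: measurable_early_high.
  - apply: le_measure; rewrite ?inE.
    + by apply: measurable_gt; exact: (measurable_walk_max_of (iidZ _)).
    + exact: measurable_early_high.
  move=> w /= h; exists (l + n)%N => /=; first by rewrite leq_addr.
  rewrite addKn (lt_le_trans h)//; apply/walk_max_leP; first exact: walk_max_ge0.
  move=> j jn; apply: le_trans (walk_le_max _ jn).
  by rewrite /walk; apply: ler_sum => i _; rewrite /Z ge_min lexx.
have fat : (\int[P]_w (expR (t * y (2^-1 ^+ l) w))%:E <= C%:E)%E.
  pose g n w := (expR (t * Wn n w))%:E.
  have mg n : measurable_fun setT (g n).
    by apply/measurable_EFinP; apply: measurableT_comp => //; exact: measurable_funM.
  have h1 : {ae P, forall w, True -> ((expR (t * y (2^-1 ^+ l) w))%:E <= limn_einf (g^~ w))%E}.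
    have := lf_path ly; apply: filterS => w [cw jw] _.
    (* On fine grids no step exceeds 1, so the truncation is idle and the sequence is eventually
       constant; Fatou then transfers the uniform bound. *)
    have [N hN] := small_grid_steps cw jw 1 ltr01.
    suff /cvg_limn_einf_sup[-> _] : g^~ w @ \oo --> (expR (t * y (2^-1 ^+ l) w))%:E by [].
    apply: cvg_near_cst; exists N => // n /= Nn.
    rewrite /g /Wn -[in RHS](@dyadic_sub (l + n) l) ?leq_addr// addKn -walk_fwd.
    congr (expR (t * _))%:E; rewrite /walk; apply: eq_bigr => i _.
    apply/min_idPl; apply: hN; first by rewrite (leq_trans Nn)// leq_addl.
    by rewrite mul1n (leq_trans (ltn_ord i))// leq_pexp2l// leq_addl.
  have mlim : measurable_fun setT (fun w => limn_einf (g^~ w)).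
    have -> : (fun w => limn_einf (g^~ w)) = (fun w => - limn_esup (fun n => - g n w))%E by [].
    apply: measurableT_comp => //; apply: measurable_fun_limn_esup => n.
    exact: measurableT_comp.
  apply: (@le_trans _ _ (\int[P]_w limn_einf (g^~ w))%E).
    apply: ae_ge0_le_integral => //.
    - apply/measurable_EFinP; apply: measurableT_comp => //; apply: measurable_funM => //.
      exact: (lf_meas ly).
    - move=> w _; rewrite limn_einf_lim; apply: lime_ge; first exact: is_cvg_einfs.
      by apply: nearW => n; apply: le_ereal_inf_tmp => _ [k _ <-]; rewrite lee_fin expR_ge0.
  apply: le_trans (fatou _ _ _ _) _ => //.
    by move=> n w _; rewrite lee_fin expR_ge0.
  rewrite limn_einf_lim; apply: lime_le; first exact: is_cvg_einfs.
  apply: nearW => n; apply: le_trans (bnd n).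
  by apply: ereal_inf_lbound; exists n => /=.
(* Finiteness at time [2 ^- l] passes to time 1, which is a sum of [2 ^ l] independent copies. *)
have := fwd_mgf_scale_ereal l t => <-.
have -> : (\int[P]_w (expR (t * fwd l 0 w))%:E = \int[P]_w (expR (t * y (2^-1 ^+ l) w))%:E)%E.
  by apply: eq_integral => w _; rewrite /fwd dyadicSr dyadic0 add0r (lf_0 ly) subr0.
have : (\int[P]_w (expR (t * y (2^-1 ^+ l) w))%:E < +oo)%E by rewrite (le_lt_trans fat)// ltry.
have : (0 <= \int[P]_w (expR (t * y (2^-1 ^+ l) w))%:E)%E.
  by apply: integral_ge0 => w _; rewrite lee_fin expR_ge0.
by case: (integral _ _ _) => // r _ _; rewrite -EFin_expe ltry.
Qed.

End levy_from0.

(** * Convex functions *)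

Section convex_roots.
Context (R : realType) (m : R -> R).
Hypothesis chord : forall s t u, 0 <= s -> s < t -> t < u ->
  (u - s) * m t <= (u - t) * m s + (t - s) * m u.
Hypothesis m_ge0 : forall t, 0 <= m t.
Hypothesis m0 : m 0 = 1.
Variable l : R.
Hypothesis l0 : 0 < l.
Hypothesis ml : m l = 1.
Hypothesis ml2 : m (l / 2) < 1.

(** The chord over [[l / 2, l]] has positive slope, and a convex function stays above its extension
    beyond [l]. *)
Lemma convex_gt1 t : l < t -> 1 < m t.
Proof.
have l_gt0 := l0; have ml2_lt1 := ml2.
move=> lt; have := @chord (l / 2) l t ltac:(lra) ltac:(lra) lt; rewrite ml => h.
rewrite -(ltr_pM2l (_ : 0 < l - l / 2)); last by lra.
have h2 : (t - l) * m (l / 2) < (t - l) * 1 by rewrite ltr_pM2l//; lra.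
lra.
Qed.

Lemma convex_le1 t : 0 <= t -> t <= l -> m t <= 1.
Proof.
have l_gt0 := l0; have ml2_lt1 := ml2.
rewrite le_eqVlt => /orP[/eqP<- _|t0]; first by rewrite m0.
rewrite le_eqVlt => /orP[/eqP->|tl]; first by rewrite ml.
have := @chord 0 t l (lexx 0) t0 tl; rewrite m0 ml => h.
rewrite -(ler_pM2l l0); lra.
Qed.

Lemma convex_mono s t : l <= s -> s < t -> m s < m t.
Proof.
have l_gt0 := l0; have ml2_lt1 := ml2.
move=> ls st.
have s1 : 1 <= m s.
  by move: ls; rewrite le_eqVlt => /orP[/eqP<-|/convex_gt1/ltW//]; rewrite ml.
have := @chord (l / 2) s t ltac:(lra) ltac:(lra) st => h.
rewrite -(ltr_pM2l (_ : 0 < s - l / 2)); last by lra.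
have h2 : (t - s) * m (l / 2) < (t - s) * m s by rewrite ltr_pM2l; lra.
lra.
Qed.

(** Compare the slope on [[s, t]] with that on [[s, B + 1]]; this interval has length at least 1, so
    the division by it can be omitted. *)
Lemma convex_lipschitz B s t : l <= s -> s < t -> t <= B ->
  m t - m s <= m (B + 1) * (t - s).
Proof.
have l_gt0 := l0; have ml2_lt1 := ml2.
move=> ls st tB; have mst := convex_mono ls st.
have := @chord s t (B + 1) ltac:(lra) st ltac:(lra) => h.
have h1 : m t - m s <= (B + 1 - s) * (m t - m s).
  by rewrite ler_peMl; lra.
have h2 : 0 <= (t - s) * m s by rewrite mulr_ge0//; lra.
lra.
Qed.

Lemma convex_lipschitz_norm B x t : l <= x <= B -> l <= t <= B ->
  `|m x - m t| <= `|x - t| * m (B + 1).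
Proof.
move=> /andP[lx xB] /andP[lt tB].
have [xt|tx|->] := ltgtP x t; last by rewrite !subrr normr0 mul0r.
- have := convex_lipschitz lx xt tB; have := convex_mono lx xt.
  rewrite [`|m x - _|]distrC [`|x - _|]distrC => mxt.
  by rewrite (gtr0_norm (_ : 0 < m t - m x)) ?subr_gt0// gtr0_norm ?subr_gt0// mulrC.
- have := convex_lipschitz lt tx xB; have := convex_mono lt tx => mxt.
  by rewrite (gtr0_norm (_ : 0 < m x - m t)) ?subr_gt0// gtr0_norm ?subr_gt0// mulrC.
Qed.

Lemma convex_unbounded c : 1 < c -> exists2 B, l < B & c <= m B.
Proof.
have l_gt0 := l0; have ml2_lt1 := ml2.
move=> c1; pose k := (1 - m (l / 2)) / (l / 2).
have k0 : 0 < k by rewrite /k divr_gt0; lra.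
have kl : k * (l / 2) = 1 - m (l / 2) by rewrite /k divfK//; lra.
(* The point where the line through the graph at [l / 2] and [l], of slope [k], reaches the height
   [c]. *)
exists (l + (c - 1) / k); first by rewrite ltrDl divr_gt0; lra.
set B := l + _.
have Bl : (B - l) * k = c - 1 by rewrite /B addrC addKr divfK// gt_eqF.
have lB : l < B by rewrite ltrDl divr_gt0; lra.
have := @chord (l / 2) l B ltac:(lra) ltac:(lra) lB; rewrite ml => h.
rewrite -(ler_pM2l (_ : 0 < l - l / 2)); last by lra.
have e1 : (B - l) * m (l / 2) = (B - l) - (c - 1) * (l / 2).
  by rewrite -Bl -mulrA kl; ring.
lra.
Qed.

Lemma convex_continuous B : l <= B -> {within `[l, B], continuous m}.
Proof.
have l_gt0 := l0; have ml2_lt1 := ml2.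
move=> lB; apply/subspace_continuousP => x /=; rewrite in_itv /= => /andP[lx xB].
apply/cvgrPdist_lt => e e0; rewrite near_withinE.
have K0 : 0 < m (B + 1) by rewrite (lt_trans ltr01)// convex_gt1//; lra.
apply/nbhs_ballP; exists (e / m (B + 1)) => /=; first by rewrite divr_gt0.
move=> t; rewrite /ball /= ltr_pdivlMr// => xt; rewrite in_itv /= => /andP[lt tB].
by apply: le_lt_trans xt; apply: convex_lipschitz_norm; apply/andP; split.
Qed.

Lemma sup_root1 : sup [set t | 0 <= t /\ m t = 1] = l.
Proof.
have l_gt0 := l0; have ml2_lt1 := ml2.
apply/eqP; rewrite eq_le; apply/andP; split.
  apply: ge_sup; first by exists l; split => //; exact: ltW.
  move=> t [t0 mt]; rewrite leNgt; apply/negP => /convex_gt1.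
  by rewrite mt ltxx.
apply: ub_le_sup; last by split => //; exact: ltW.
exists l => t [t0 mt]; rewrite leNgt; apply/negP => /convex_gt1.
by rewrite mt ltxx.
Qed.

(** The root exists by the intermediate value theorem. It is unique, since [m] is at most 1 on
    [[0, l]] and strictly increasing afterwards, so the supremum is that of a singleton. *)
Lemma sup_root c : 1 < c -> let p := sup [set t | 0 <= t /\ m t = c] in
  l < p /\ m p = c.
Proof.
have l_gt0 := l0; have ml2_lt1 := ml2.
move=> c1; have [B lB mB] := convex_unbounded c1.
have [|p + mp] := @IVT R m l B c (ltW lB) (convex_continuous (ltW lB)).
  by rewrite ml ge_min le_max mB (ltW c1) orbT.
rewrite in_itv /= => /andP[lp pB].
have {}lp : l < p.
  by rewrite lt_neqAle lp andbT; apply/negP => /eqP lp'; move: c1; rewrite -mp -lp' ml ltxx.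
have uniq t : 0 <= t -> m t = c -> t = p.
  move=> t0 mt; have lt : l < t.
    by rewrite ltNge; apply/negP => /(convex_le1 t0); rewrite mt leNgt c1.
  have [tp|pt|//] := ltgtP t p.
  - by have := convex_mono (ltW lt) tp; rewrite mt mp ltxx.
  - by have := convex_mono (ltW lp) pt; rewrite mt mp ltxx.
have -> : [set t | 0 <= t /\ m t = c] = [set p].
  apply/seteqP; split => t /= => [[t0 /uniq]|->]; first exact.
  by split => //; rewrite ltW// (lt_trans l0).
by rewrite sup1.
Qed.

End convex_roots.

(** * Exponential laws *)

Section exponential.
Context (R : realType) (x : R) (x0 : 0 < x).

Local Notation mu := (@lebesgue_measure R).
Local Notation expp :=
  (exponential_distribution_exponential_prob__canonical__probability_measure_Probability x0).

Let idR (u : measurableTypeR R) : R := u.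

Let mid : measurable_fun [set: measurableTypeR R] idR.
Proof. by move=> _ B mB; rewrite setTI. Qed.

(* [exponential_prob] is a measure on [measurableTypeR R], whose display is not
   that of [R]. *)
Let id' : {mfun measurableTypeR R >-> R} := @mfun_Sub _ _ _ _ _ (mem_set mid).

Definition expo : probability R R := @distribution _ _ _ R R expp id'.

Lemma expoE B : expo B = exponential_prob x B.
Proof. by []. Qed.

Lemma expo_dominated : expp `<< mu.
Proof.
apply/null_content_dominatesP => A mA muA0; rewrite /= /exponential_prob.
apply: null_set_integral => //.
by apply/measurable_funTS/measurable_EFinP; exact: measurable_exponential_pdf.
Qed.

(** The density is almost everywhere the Radon-Nikodym derivative of the law, which permits the
    change of measure. *)
Lemma integral_expo (f : R -> R) : measurable_fun setT f -> (forall u, 0 <= f u <= 1) ->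
  (\int[expo]_u (f u)%:E = \int[mu]_u (f u * exponential_pdf x u)%:E)%E.
Proof.
move=> mf f01.
rewrite [LHS]ge0_integral_distribution//; last 2 first.
- exact/measurable_EFinP.
- by move=> u; rewrite lee_fin; case/andP: (f01 u).
have mf' : measurable_fun [set: measurableTypeR R] (fun u => (f u)%:E) by exact/measurable_EFinP.
have mpdf : measurable_fun [set: measurableTypeR R] (fun u => (exponential_pdf x u)%:E).
  by apply/measurable_EFinP; exact: measurable_exponential_pdf.
transitivity (\int[expp]_u (f u)%:E)%E; first by [].
under [RHS]eq_integral do rewrite EFinM.
rewrite -(Radon_Nikodym_change_of_variables expo_dominated)//=; last first.
  apply: (@le_integrable _ _ _ _ _ measurableT _ (cst 1%E)) => //.
    by move=> u _ /=; rewrite normr1 lee_fin; have /andP[f0 f1] := f01 u; rewrite ger0_norm.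
  exact: (finite_measure_integrable_cst expp 1 measurableT).
apply: ae_eq_integral => //.
- apply: emeasurable_funM => //; apply: (measurable_int mu).
  apply: Radon_Nikodym_integrable; exact: expo_dominated.
- exact: emeasurable_funM.
- apply: ae_eqe_mul2l => /=.
  rewrite Radon_NikodymE//=; first exact: expo_dominated.
  move=> abmu; case: cid => /= h [h1 h2 h3].
  by apply: integral_ae_eq => //= E E01 mE; rewrite -h3.
Qed.

Lemma expo_lt0 : expo [set u | u < 0] = 0%E.
Proof.
rewrite expoE /exponential_prob integral0_eq// => u /= u0.
by rewrite lt0_exponential_pdf.
Qed.

Lemma expo_itv a : 0 <= a -> expo [set u | 0 <= u < a] = (1 - expR (- (x * a)))%:E.
Proof.
rewrite le_eqVlt => /orP[/eqP<-|a0].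
  rewrite mulr0 oppr0 expR0 subrr (_ : [set u | _] = set0) ?measure0//.
  by apply/seteqP; split => // u /= /andP[u0]; rewrite ltNge u0.
have <- : `[0, a[%classic = [set u | 0 <= u < a].
  by apply/seteqP; split => u /=; rewrite in_itv.
rewrite expoE /exponential_prob integral_itv_bndo_bndc//.
  have := exponential_prob_itv0c x a0; rewrite /exponential_prob => ->.
  by rewrite mulNr EFinB.
by apply/measurable_funTS/measurable_EFinP; exact: measurable_exponential_pdf.
Qed.

Lemma expo_ge a : 0 <= a -> expo [set u | a <= u] = (expR (- (x * a)))%:E.
Proof.
move=> a0; have mlt c : measurable [set u : R | u < c].
  have -> : [set u : R | u < c] = `]-oo, c[%classic by apply/seteqP; split => u /=; rewrite in_itv.
  exact: measurable_itv.
have -> : [set u | a <= u] = ~` [set u | u < a].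
  by apply/seteqP; split => u /=; rewrite leNgt => /negP.
rewrite probability_setC//.
have -> : [set u | u < a] = [set u | u < 0] `|` [set u | 0 <= u < a].
  apply/seteqP; split => u /=; last by move=> [u0|/andP[]//]; exact: lt_le_trans a0.
  by move=> ua; have [u0|u0] := ltP u 0; [left|right].
rewrite measureU//; last 2 first.
- have -> : [set u | 0 <= u < a] = `[0, a[%classic by apply/seteqP; split => u /=; rewrite in_itv.
  exact: measurable_itv.
- by apply/seteqP; split => // u /= [u0 /andP[]]; rewrite leNgt u0.
by rewrite [X in (_ - (X + _))%E]expo_lt0 add0e [X in (_ - X)%E]expo_itv// -EFinB opprB addrC subrK.
Qed.

(** Multiplied by [expR (- (s * u))], the density of parameter [x] becomes [x / (x + s)] times the
    density of parameter [x + s]. *)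
Lemma expo_laplace s : 0 <= s ->
  (\int[expo]_u (if 0 <= u then expR (- (s * u)) else 0)%:E = (x / (x + s))%:E)%E.
Proof.
move=> s0; have xs0 : 0 < x + s by rewrite ltr_wpDr.
rewrite integral_expo; last 2 first.
- apply: measurable_fun_ifT => //; first exact: measurable_fun_ler.
  apply: measurableT_comp => //; apply: measurableT_comp => //; exact: measurable_funM.
- move=> u; case: ifP => [u0|_]; rewrite ?lexx ?ler01//.
  by rewrite expR_ge0 /= -expR0 ler_expR oppr_le0 mulr_ge0.
transitivity (\int[mu]_u ((x / (x + s))%:E * (exponential_pdf (x + s) u)%:E))%E.
  apply: eq_integral => u _; rewrite -EFinM; congr EFin.
  have [u0|u0] := leP 0 u; last by rewrite !lt0_exponential_pdf// !mulr0.
  rewrite !exponential_pdfE// mulrCA -expRD [RHS]mulrA divfK ?gt_eqF//.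
  by congr (_ * expR _); ring.
rewrite ge0_integralZl//.
- by rewrite integral_exponential_pdf// mule1.
- by apply/measurable_EFinP; exact: measurable_exponential_pdf.
- by move=> u _; rewrite lee_fin exponential_pdf_ge0// ltW.
- by rewrite lee_fin divr_ge0// ltW.
Qed.

End exponential.

(** * The Laplace transform at time 1 *)

Section inf_range.
Context (R : realType) (u : nat -> R).
Hypothesis u0 : forall n, 0 <= u n.

Lemma inf_range_le n : inf (range u) <= u n.
Proof. by apply: ge_inf; [exists 0 => _ [k _ <-]|exists n]. Qed.

Lemma inf_range_ge b : (forall n, b <= u n) -> b <= inf (range u).
Proof.
by move=> bu; apply: lb_le_inf => [|_ [n _ <-]//]; exists (u 0), 0.
Qed.

Lemma inf_range_ltP c : inf (range u) < c <-> exists n, u n < c.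
Proof.
split; last by move=> [n]; apply: le_lt_trans; exact: inf_range_le.
have ne : range u !=set0 by exists (u 0), 0.
by move=> /(inf_lt ne)[_ [n _ <-] uc]; exists n.
Qed.

Lemma cvg_inf_range : {homo u : n m / (n <= m)%N >-> m <= n} -> u @ \oo --> inf (range u).
Proof.
by move=> nu; apply: nonincreasing_cvgn => //; exists 0 => _ [k _ <-].
Qed.

End inf_range.

Lemma measurable_inf_range d (T : measurableType d) (R : realType) (u : nat -> T -> R) :
  (forall n w, 0 <= u n w) -> (forall n, measurable_fun setT (u n)) ->
  measurable_fun setT (fun w => inf (range (u^~ w))).
Proof.
move=> u0 mu.
have -> : (fun w => inf (range (u^~ w))) = (fun w => infs (u^~ w) 0).
  apply/funext => w; rewrite /infs /sdrop; congr inf.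
  by apply/seteqP; split => _ [n _ <-]; exists n.
apply: measurable_fun_infs => //.
by move=> w _; exists 0 => _ [k _ <-].
Qed.

Section mexp.
Context d (T : measurableType d) (R : realType) (P : probability T R).
Variable y : R -> T -> R.
Hypothesis ly : levy_from0 P y.

Definition mexp t := \int[P]_w expR (t * y 1 w).

Lemma measurable_expy t : measurable_fun setT (fun w => expR (t * y 1 w)).
Proof.
apply: measurableT_comp => //; apply: measurable_funM => //; exact: (lf_meas ly).
Qed.

Lemma integrable_expy t : 0 <= t -> P.-integrable setT (EFin \o (fun w => expR (t * y 1 w))).
Proof.
move=> t0; apply: ge0_integrable_lty; [exact: measurable_expy|by move=> w; exact: expR_ge0|].
exact: exp_moment_finite.
Qed.

(** A power of this integral is the moment at time 1, which is finite, and a positive power of [+oo]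
    would be [+oo]. *)
Lemma fwd_integrable_exp n t : 0 <= t ->
  P.-integrable setT (EFin \o (fun w => expR (t * fwd y n 0%N w))).
Proof.
move=> t0; apply: ge0_integrable_lty.
- apply: measurableT_comp => //; apply: measurable_funM => //; exact: (measurable_fwd ly).
- by move=> w; exact: expR_ge0.
have := exp_moment_finite ly t0; rewrite -(fwd_mgf_scale_ereal ly n).
have : (0 <= \int[P]_w (expR (t * fwd y n 0 w))%:E)%E.
  by apply: integral_ge0 => w _; rewrite lee_fin expR_ge0.
case: (integral _ _ _) => // [r _ _|_]; first exact: ltry.
have pow k : (+oo ^+ k.+1 = +oo :> \bar R)%E.
  by elim: k => [|k IH]; rewrite ?expe1// expeS IH mulyy.
by rewrite -(prednK (_ : 0 < 2 ^ n)%N) ?expn_gt0// pow.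
Qed.

Lemma fwd_mgf_scale n t : 0 <= t -> mgf P (fwd y n) t ^+ (2 ^ n) = mexp t.
Proof.
move=> t0; apply: EFin_inj; rewrite EFin_expe !EFin_Rintegral.
- exact: (fwd_mgf_scale_ereal ly).
- exact: integrable_expy.
- exact: fwd_integrable_exp.
Qed.

Lemma mexp_ge0 t : 0 <= mexp t.
Proof. by apply: Rintegral_ge0 => w _; exact: expR_ge0. Qed.

Lemma mexp0 : mexp 0 = 1.
Proof.
rewrite /mexp; under eq_Rintegral do rewrite mul0r expR0.
by rewrite Rintegral_cst//= probability_setT mul1r.
Qed.

(** The tangent inequalities at [t], taken at [s] and [u], are added with weights that cancel the
    linear terms. *)
Lemma expR_chord (s t u v : R) : s <= t -> t <= u ->
  (u - s) * expR (t * v) <= (u - t) * expR (s * v) + (t - s) * expR (u * v).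
Proof.
move=> st tu.
have tangent a : expR (t * v) * (1 + (a - t) * v) <= expR (a * v).
  have -> : a * v = t * v + (a - t) * v by ring.
  by rewrite expRD ler_wpM2l ?expR_ge0// expR_ge1Dx.
have h1 := tangent s; have h2 := tangent u; nra.
Qed.

Lemma mexp_chord s t u : 0 <= s -> s < t -> t < u ->
  (u - s) * mexp t <= (u - t) * mexp s + (t - s) * mexp u.
Proof.
move=> s0 st tu; have t0 : 0 <= t by lra. have u0 : 0 <= u by lra.
have i1 := integrable_expy s0; have i2 := integrable_expy t0; have i3 := integrable_expy u0.
rewrite /mexp -!RintegralZl// -RintegralD//; last 2 first.
- exact: (integrableZl measurableT (u - t) i1).
- exact: (integrableZl measurableT (t - s) i3).
apply: le_Rintegral => //.
- exact: (integrableZl measurableT (u - s) i2).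
- exact: (integrableD measurableT (integrableZl measurableT (u - t) i1)
    (integrableZl measurableT (t - s) i3)).
- by move=> w _; apply: expR_chord; exact: ltW.
Qed.

Hypothesis nondeg : ~ {ae P, forall w, y 1 w = 0}.

(* Equality in [0 <= E (e^(ly/2) - 1)^2 = 2 - 2 E e^(ly/2)] forces [y 1 = 0]. *)
Lemma mexp_half l : 0 < l -> mexp l = 1 -> mexp (l / 2) < 1.
Proof.
move=> l0 ml; rewrite ltNge; apply/negP => h; apply: nondeg.
have l20 : 0 <= l / 2 by lra.
have i1 := integrable_expy (ltW l0); have i2 := integrable_expy l20.
pose g w := (expR (l / 2 * y 1 w) - 1) ^+ 2.
have gE w : g w = expR (l * y 1 w) - 2 * expR (l / 2 * y 1 w) + 1.
  have -> : l * y 1 w = l / 2 * y 1 w + l / 2 * y 1 w by field.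
  by rewrite expRD /g; ring.
have ic : P.-integrable setT (EFin \o cst (1 : R)) by exact: finite_measure_integrable_cst.
have i3 := integrableZl measurableT 2 i2.
have i13 := integrableB measurableT i1 i3.
have ig : P.-integrable setT (EFin \o g).
  have -> : g = (fun w => expR (l * y 1 w) - 2 * expR (l / 2 * y 1 w) + 1) by apply/funext.
  exact: (integrableD measurableT i13 ic).
have g0 : \int[P]_w g w = 0.
  apply/eqP; rewrite eq_le; apply/andP; split; last by apply: Rintegral_ge0 => w _; exact: sqr_ge0.
  under eq_Rintegral do rewrite gE.
  rewrite RintegralD// RintegralB// RintegralZl// Rintegral_cst//= probability_setT.
  rewrite -/(mexp l) -/(mexp (l / 2)) ml mulr1; lra.
have : (\int[P]_w `|(g w)%:E| = 0)%E.
  under eq_integral do rewrite gee0_abs ?lee_fin ?sqr_ge0//.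
  by rewrite -EFin_Rintegral// g0.
have mg : measurable_fun setT (EFin \o g) by case/integrableP: ig.
move=> /(ae_eq_integral_abs P measurableT mg); apply: filterS => w /(_ Logic.I) [] /eqP.
rewrite sqrf_eq0 subr_eq0 -expR0 => /eqP/expR_inj/eqP.
by rewrite mulf_eq0 gt_eqF ?divr_gt0//= => /eqP.
Qed.

End mexp.

(** * Infima over the past and over the future *)

Section past_future_functionals.
Context (T : Type) (R : realType) (y : R -> T -> R) (lam : R).

(** The minimum of [expR (lam * y)] over the grid of mesh [2 ^- n] in [[- 2 ^ n, 0]]: both mesh and
    range improve with [n], so [past_inf] ranges over all nonpositive dyadic times. *)
Definition past_min n w := expR (- (lam * walk_max ((bwd y n)^~ w) (2 ^ n * 2 ^ n))).
Definition past_inf w := inf (range (past_min^~ w)).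
Definition fut_min n k w := expR (- (lam * walk_max (fun i => - fwd y n i w) k)).
(** Only dyadic times up to [t] count. For [t] not dyadic a downward jump at [t] itself can be
    missed. *)
Definition fut_inf (t : R) w := inf (range (fun n => fut_min n (Num.truncn (t * 2 ^+ n)) w)).

Lemma past_min_ge0 n w : 0 <= past_min n w. Proof. exact: expR_ge0. Qed.
Lemma fut_min_ge0 n k w : 0 <= fut_min n k w. Proof. exact: expR_ge0. Qed.

Lemma past_inf_ge0 w : 0 <= past_inf w.
Proof. by apply: inf_range_ge => n; exact: past_min_ge0. Qed.

Lemma fut_inf_ge0 t w : 0 <= fut_inf t w.
Proof. by apply: inf_range_ge => n; exact: fut_min_ge0. Qed.

End past_future_functionals.

Section past_future_measurable.
Context d (T : measurableType d) (R : realType) (y : R -> T -> R) (lam : R).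
Hypothesis my : forall t, measurable_fun setT (y t).

Lemma measurable_past_min n : measurable_fun setT (past_min y lam n).
Proof.
apply: measurableT_comp => //; apply: measurableT_comp => //.
apply: measurable_funM => //; apply: measurable_walk_max_fun => i _.
by apply: measurable_funB; exact: my.
Qed.

Lemma measurable_fut_min n k : measurable_fun setT (fut_min y lam n k).
Proof.
apply: measurableT_comp => //; apply: measurableT_comp => //.
apply: measurable_funM => //.
apply: (measurable_walk_max_fun (Z := fun i w => - fwd y n i w)) => i _.
apply: measurableT_comp => //; by apply: measurable_funB; exact: my.
Qed.

Lemma measurable_past_inf : measurable_fun setT (past_inf y lam).
Proof.
by apply: measurable_inf_range => n; [exact: past_min_ge0|exact: measurable_past_min].
Qed.

Lemma measurable_fut_inf t : measurable_fun setT (fut_inf y lam t).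
Proof.
apply: (measurable_inf_range (u := fun n => fut_min y lam n (Num.truncn (t * 2 ^+ n)))) => n.
  exact: fut_min_ge0.
exact: measurable_fut_min.
Qed.

End past_future_measurable.

Section past_future.
Context d (T : measurableType d) (R : realType) (P : probability T R).
Variable y : R -> T -> R.
Hypothesis ly : levy_from0 P y.
Variable lam : R.
Hypothesis lam0 : 0 < lam.

Local Notation past_min := (past_min y lam).
Local Notation past_inf := (past_inf y lam).
Local Notation fut_min := (fut_min y lam).
Local Notation fut_inf := (fut_inf y lam).

Lemma fut_min_le1 n k w : fut_min n k w <= 1.
Proof. by rewrite -expR0 ler_expR oppr_le0 mulr_ge0 ?(ltW lam0)// walk_max_ge0. Qed.

Lemma fut_inf_le1 t w : fut_inf t w <= 1.
Proof.
apply: (@le_trans _ _ (fut_min 0 (Num.truncn (t * 2 ^+ 0)) w)); last exact: fut_min_le1.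
by apply: (inf_range_le (u := fun n => fut_min n (Num.truncn (t * 2 ^+ n)) w)) => n; exact: fut_min_ge0.
Qed.

Lemma past_min_le n j w : (j <= 2 ^ n * 2 ^ n)%N -> past_min n w <= expR (lam * y (- dyadic R n j) w).
Proof.
move=> jn; rewrite ler_expR -mulrN ler_wpM2l ?(ltW lam0)// lerNl -(walk_bwd ly).
exact: walk_le_max.
Qed.

Lemma past_min_attained n w : exists2 j, (j <= 2 ^ n * 2 ^ n)%N &
  past_min n w = expR (lam * y (- dyadic R n j) w).
Proof.
have [j jn e] := walk_max_attained ((bwd y n)^~ w) (2 ^ n * 2 ^ n).
by exists j => //; rewrite /past_min e (walk_bwd ly) mulrN opprK.
Qed.

Lemma walk_opp (z : nat -> R) k : walk (fun i => - z i) k = - walk z k.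
Proof. by rewrite /walk sumrN. Qed.

Lemma fut_min_le n j k w : (j <= k)%N -> fut_min n k w <= expR (lam * y (dyadic R n j) w).
Proof.
move=> jk; rewrite ler_expR -mulrN ler_wpM2l ?(ltW lam0)// lerNl -(walk_fwd ly) -walk_opp.
exact: walk_le_max.
Qed.

Lemma fut_min_attained n k w : exists2 j, (j <= k)%N &
  fut_min n k w = expR (lam * y (dyadic R n j) w).
Proof.
have [j jn e] := walk_max_attained (fun i => - fwd y n i w) k.
by exists j => //; rewrite /fut_min e walk_opp (walk_fwd ly) mulrN opprK.
Qed.

Lemma past_min_nonincreasing w : {homo past_min^~ w : n m / (n <= m)%N >-> m <= n}.
Proof.
apply/nonincreasing_seqP => n.
have [j jn ->] := past_min_attained n w.
rewrite -(dyadicS R n j); apply: past_min_le.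
apply: (@leq_trans (2 * (2 ^ n * 2 ^ n))); first by rewrite leq_mul2l jn.
by rewrite !expnS mulnACA -mulnA leq_mul2l leq_pmull.
Qed.

Lemma truncn_scale_double (t : R) n : 0 <= t ->
  (2 * Num.truncn (t * 2 ^+ n : R) <= Num.truncn (t * 2 ^+ n.+1))%N.
Proof.
move=> t0.
have h0 m : 0 <= t * 2 ^+ m by rewrite mulr_ge0// exprn_ge0.
rewrite truncn_ge_nat// natrM exprS mulrCA ler_wpM2l//.
by have /truncn_itv/andP[] := h0 n.
Qed.

Lemma fut_min_nonincreasing (t : R) w : 0 <= t ->
  {homo (fun n => fut_min n (Num.truncn (t * 2 ^+ n)) w) : n m / (n <= m)%N >-> m <= n}.
Proof.
move=> t0; apply/nonincreasing_seqP => n.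
have [j jn ->] := fut_min_attained n (Num.truncn (t * 2 ^+ n)) w.
rewrite -(dyadicS R n j); apply: fut_min_le.
by rewrite (leq_trans _ (truncn_scale_double n t0))// leq_mul2l jn.
Qed.

Lemma fut_inf_le t n j w : dyadic R n j <= t -> fut_inf t w <= expR (lam * y (dyadic R n j) w).
Proof.
move=> jt.
apply: (@le_trans _ _ (fut_min n (Num.truncn (t * 2 ^+ n)) w)).
  by apply: (inf_range_le (u := fun n => fut_min n (Num.truncn (t * 2 ^+ n)) w)) => m; exact: fut_min_ge0.
apply: fut_min_le; have t0 := le_trans (dyadic_ge0 R n j) jt.
rewrite truncn_ge_nat ?mulr_ge0 ?exprn_ge0//.
by rewrite -ler_pdivrMr ?exprn_gt0// -exprVn.
Qed.

Lemma fut_inf_mono s t w : 0 <= s -> s <= t -> fut_inf t w <= fut_inf s w.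
Proof.
move=> s0 st; apply: inf_range_ge => n.
have [j jn ->] := fut_min_attained n (Num.truncn (s * 2 ^+ n)) w.
apply: fut_inf_le; apply: le_trans st.
rewrite /dyadic exprVn ler_pdivrMr ?exprn_gt0//.
have /truncn_itv/andP[h _] : 0 <= s * 2 ^+ n by rewrite mulr_ge0// exprn_ge0.
by apply: le_trans h; rewrite ler_nat.
Qed.

Lemma past_inf_le n j w : past_inf w <= expR (lam * y (- dyadic R n j) w).
Proof.
(* The grid of index [n + j] contains the point and reaches back far enough, because [j < 2 ^ j]. *)
apply: (@le_trans _ _ (past_min (n + j) w)).
  by apply: inf_range_le => m; exact: past_min_ge0.
have -> : dyadic R n j = dyadic R (n + j) (j * 2 ^ j).
  by rewrite /dyadic natrM natrX exprD mulrACA [_ * (2^-1 ^+ j)]mulrC mulrA -mulrA;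
    rewrite -exprMn mulVf ?expr1n ?mulr1// pnatr_eq0.
have h : (2 ^ j <= 2 ^ (n + j))%N by rewrite leq_pexp2l// leq_addl.
apply: past_min_le; apply: leq_mul => //.
by apply: leq_trans h; rewrite ltnW// ltn_expl.
Qed.

Definition good_path w := cadlag (y^~ w) /\ no_positive_jumps (y^~ w).

(** The pathwise criterion at a dyadic time, with [past_inf] and [fut_inf] in the roles of [A] and
    [B]. Right continuity extends their bounds from dyadic to real times, except at the right end
    point, which is itself dyadic. *)
Lemma running_inf_gt w n k (u : R) : good_path w -> 0 <= u :> R ->
  (u%:E < ereal_inf [set ereal_sup [set (y s w - y v w)%R%:E | v in [set v | (v <= s)%R]]
      | s in [set s | (0 <= s <= dyadic R n k)%R]])%E <->
  past_inf w < expR (- (lam * u)) * fut_inf (dyadic R n k) w.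
Proof.
move=> [cw jw] u0; set t := dyadic R n k.
have t0 : 0 <= t := dyadic_ge0 R n k.
have Bn0 m : 0 <= fut_min m (Num.truncn (t * 2 ^+ m)) w := fut_min_ge0 y lam m _ w.
apply: (running_inf_gtP (f := y^~ w)) => //.
- exact: past_inf_ge0.
- move=> s; rewrite le_eqVlt => /orP[/eqP->|s0].
    by have := past_inf_le 0 0 w; rewrite dyadic0 oppr0.
  apply: (exp_ge_dense cw s0) => v /andP[sv v0] [m [j [vE|->]]]; last exact: past_inf_le.
  by move: v0; rewrite vE ltNge dyadic_ge0.
- move=> c /(inf_range_ltP (fun m => past_min_ge0 y lam m w))[m].
  have [j jm ->] := past_min_attained m w => h.
  by exists (- dyadic R m j) => //; rewrite oppr_le0 dyadic_ge0.
(* Boundedness below on the compact interval keeps the future infimum away from 0. *)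
- have [c hc] := cadlag_bounded_below cw 0 t.
  apply: (@lt_le_trans _ _ (expR (lam * c))); first exact: expR_gt0.
  apply: inf_range_ge => m.
  have [j jm ->] := fut_min_attained m (Num.truncn (t * 2 ^+ m)) w.
  rewrite ler_expR ler_wpM2l ?(ltW lam0)// hc// dyadic_ge0 /=.
  rewrite /dyadic exprVn ler_pdivrMr ?exprn_gt0//.
  have /truncn_itv/andP[h _] : 0 <= t * 2 ^+ m by rewrite mulr_ge0// exprn_ge0.
  by apply: le_trans h; rewrite ler_nat.
- move=> s /andP[s0]; rewrite le_eqVlt => /orP[/eqP->|st]; first exact: fut_inf_le.
  apply: (exp_ge_dense cw st) => v /andP[sv vt] [m [j [vE|vE]]].
    by rewrite vE; apply: fut_inf_le; rewrite -vE ltW.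
  by have := dyadic_ge0 R m j; have := le_lt_trans s0 sv; rewrite vE; lra.
- move=> c /(inf_range_ltP Bn0)[m].
  have [j jm ->] := fut_min_attained m (Num.truncn (t * 2 ^+ m)) w => h.
  exists (dyadic R m j) => //; rewrite dyadic_ge0 /=.
  rewrite /dyadic exprVn ler_pdivrMr ?exprn_gt0//.
  have /truncn_itv/andP[h' _] : 0 <= t * 2 ^+ m by rewrite mulr_ge0// exprn_ge0.
  by apply: le_trans h'; rewrite ler_nat.
Qed.

End past_future.

Section indep_rays.
Context d (T : measurableType d) (R : realType) (P : probability T R).

Lemma rays_law_unique (m1 m2 : {measure set T -> \bar R}) (f : T -> R) :
  measurable_fun setT f -> (m1 setT < +oo)%E ->
  (forall c, m1 [set w | f w < c] = m2 [set w | f w < c]) ->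
  forall B, measurable B -> m1 (f @^-1` B) = m2 (f @^-1` B).
Proof.
move=> mf m1T m12 B mB.
have mI (c : R) : measurable (f @^-1` [set` `]-oo, c[]).
  by rewrite -[X in measurable X]setTI; exact: mf.
pose f' : {mfun T >-> R} := mfun_Sub (mem_set mf).
change (pushforward m1 f' B = pushforward m2 f' B).
apply: (@measure_unique _ R R (@RGenInftyO.G R) (fun n => [set` `]-oo, n%:R[])) => //.
- exact: RGenInftyO.measurableE.
- move=> _ _ [c1 ->] [c2 ->]; exists (Num.min c1 c2).
  apply/seteqP; split => u /=; rewrite !in_itv /= lt_min; first by move=> [-> ->].
  by move=> /andP.
- by move=> n; exists n%:R.
- apply/seteqP; split => // u _; exists (Num.truncn `|u|).+1 => //=.
  rewrite in_itv /= (le_lt_trans (ler_norm u))//.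
  by have /truncn_itv/andP[] := normr_ge0 u.
- move=> _ [c ->]; rewrite /= /pushforward.
  have -> : f @^-1` [set` `]-oo, c[] = [set w | f w < c].
    by apply/seteqP; split => w /=; rewrite in_itv.
  exact: m12.
- move=> n; change (m1 (f @^-1` [set` `]-oo, n%:R[]) < +oo)%E.
  apply: le_lt_trans m1T; apply: le_measure; rewrite ?inE//.
Qed.

(** Rays are the natural test sets here: an infimum is less than [c] if and only if some grid
    minimum is, which is an increasing union of events. *)
Lemma indep2_rays (f g : T -> R) : measurable_fun setT f -> measurable_fun setT g ->
  (forall c c', P ([set w | f w < c] `&` [set w | g w < c']) =
    (P [set w | (f w < c)%R] * P [set w | (g w < c')%R])%E) ->
  indep2 P f g.
Proof.
move=> mf mg fg A B mA mB.
have mfA : measurable (f @^-1` A) by rewrite -[X in measurable X]setTI; exact: mf.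
have mgB : measurable (g @^-1` B) by rewrite -[X in measurable X]setTI; exact: mg.
pose sc (E : set T) : {nonneg R} := NngNum (fine_ge0 (measure_ge0 P E)).
have scE E F : measurable E -> mscale (sc E) P F = (P F * P E)%E.
  move=> mE; rewrite /mscale /= fineK 1?muleC//; exact: fin_num_measure.
rewrite -(scE _ _ mgB).
change (mrestr P mgB (f @^-1` A) = mscale (sc (g @^-1` B)) P (f @^-1` A)).
apply: rays_law_unique => //.
  by rewrite /= /mrestr setTI ltey_eq fin_num_measure.
move=> c; have mc := measurable_lt c mf.
rewrite [RHS](scE _ _ mgB) /= /mrestr setIC muleC -(scE _ _ mc).
change (mrestr P mc (g @^-1` B) = mscale (sc [set w | f w < c]) P (g @^-1` B)).
apply: rays_law_unique => //.
  by rewrite /= /mrestr setTI ltey_eq fin_num_measure.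
by move=> c'; rewrite [RHS](scE _ _ mc) /= /mrestr setIC [RHS]muleC; exact: fg.
Qed.

End indep_rays.

Lemma walk_max_ext (R : realType) (z z' : nat -> R) k :
  (forall i, (i < k)%N -> z i = z' i) -> walk_max z k = walk_max z' k.
Proof.
move=> zz'; elim: k zz' => //= k IH zz'; rewrite IH; last by move=> i ik; apply: zz'; exact: ltnW.
by congr (Num.max _ _); rewrite /walk; apply: eq_bigr => i _; exact: zz'.
Qed.

(** * Law of the past infimum and independence of the future *)

Section past_law.
Context d (T : measurableType d) (R : realType) (P : probability T R).
Variable y : R -> T -> R.
Hypothesis ly : levy_from0 P y.
Variable lam : R.
Hypothesis lam0 : 0 < lam.
Hypothesis mlam : mexp P y lam = 1.
Hypothesis mlam2 : mexp P y (lam / 2) < 1.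

Lemma past_min_lt n a : [set w | past_min y lam n w < expR (- (lam * a))] =
  [set w | a < walk_max ((bwd y n)^~ w) (2 ^ n * 2 ^ n)].
Proof.
by apply/seteqP; split => w /=; rewrite /past_min ltr_expR ltrN2 ltr_pM2l.
Qed.

(** Both walks have independent steps with the same law. *)
Lemma prob_bwd_fwd n k a : P [set w | a < walk_max ((bwd y n)^~ w) k] =
  P [set w | a < walk_max ((fwd y n)^~ w) k].
Proof.
have [mb ib lb] := bwd_iid ly n; have [mf iF lf] := fwd_iid ly n.
apply: (@law_unique _ T R P (bwd y n) (fwd y n) k [set i | (i < k)%N] mb mf (ib k) (iF k)
  _ _ [set z | a < walk_max z k]) => //.
  by move=> i B _ mB; rewrite (bwd_law ly)// (fwd_law ly).
by apply: measurable_gt; exact: measurable_walk_max.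
Qed.

Lemma past_inf_lt c : [set w | past_inf y lam w < c] = \bigcup_n [set w | past_min y lam n w < c].
Proof.
apply/seteqP; split => w /=.
  by move=> /(inf_range_ltP (fun m => past_min_ge0 y lam m w))[n h]; exists n.
by move=> [n _ h]; apply/(inf_range_ltP (fun m => past_min_ge0 y lam m w)); exists n.
Qed.

Lemma past_min_lt_nd c : nondecreasing_seq (fun n => [set w | past_min y lam n w < c]).
Proof.
move=> n m nm; apply/subsetPset => w /=; apply: le_lt_trans.
exact: (past_min_nonincreasing ly lam0).
Qed.

(** Write [c] as [expR (- (lam * a))]. The grid events state that the backward walk passes [a]; they
    increase to the event in question, and their probabilities tend to [c]. *)
Lemma prob_past_inf_lt c : 0 <= c <= 1 -> P [set w | past_inf y lam w < c] = c%:E.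
Proof.
move=> /andP[]; rewrite le_eqVlt => /orP[/eqP<- _|c0 c1].
  rewrite (_ : [set w | _] = set0) ?measure0//.
  by apply/seteqP; split => // w /=; rewrite ltNge past_inf_ge0.
pose a := - ln c / lam.
have a0 : 0 <= a by rewrite divr_ge0 ?(ltW lam0)// oppr_ge0 ln_le0.
have cE : c = expR (- (lam * a)) by rewrite /a mulrC divfK ?gt_eqF// opprK lnK.
have mA n : measurable [set w | past_min y lam n w < c].
  by apply: measurable_lt; exact: (measurable_past_min _ (lf_meas ly)).
have h1 : P [set w | past_min y lam n w < c] @[n --> \oo] --> P [set w | past_inf y lam w < c].
  rewrite past_inf_lt; apply: nondecreasing_cvg_mu => //; last exact: past_min_lt_nd.
  exact: bigcupT_measurable.
have h2 : P [set w | past_min y lam n w < c] @[n --> \oo] --> c%:E.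
  (* Here [lam] is the exponent of moment 1 and [lam / 2] the auxiliary exponent of smaller
     moment. *)
  have hb : 0 < lam / 2 < lam by have l0 := lam0; apply/andP; split; lra.
  have := prob_sup_limit (fwd_iid ly) (fwd_integrable_exp ly) (fwd_mgf_scale ly)
    (fwd_step_max_small ly) hb mlam mlam2 a0.
  rewrite mulNr -cE => h.
  apply/fine_cvgP; split; first by apply: nearW => n; exact: fin_num_measure.
  apply: cvg_trans h; apply: near_eq_cvg; apply: nearW => n /=.
  by rewrite -prob_bwd_fwd cE past_min_lt.
exact: (cvg_unique _ h1 h2).
Qed.

(** On each grid the two minima are functions of disjoint blocks of increments; the product rule
    survives the passage to increasing unions. *)
Lemma indep_past_fut t : 0 <= t -> indep2 P (past_inf y lam) (fut_inf y lam t).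
Proof.
move=> t0; apply: indep2_rays.
- exact: (measurable_past_inf _ (lf_meas ly)).
- exact: (measurable_fut_inf _ (lf_meas ly)).
move=> c c'.
pose tn n := Num.truncn (t * 2 ^+ n).
pose A n := [set w | past_min y lam n w < c].
pose B n := [set w | fut_min y lam n (tn n) w < c'].
have mA n : measurable (A n) by apply: measurable_lt; exact: (measurable_past_min _ (lf_meas ly)).
have mB n : measurable (B n) by apply: measurable_lt; exact: (measurable_fut_min _ (lf_meas ly)).
have AB n : P (A n `&` B n) = (P (A n) * P (B n))%E.
  pose K := (2 ^ n * 2 ^ n)%N; pose k := tn n.
  (* One increasing sequence of times starting at [- 2 ^ n], with time 0 at the index [K]; this
     index separates the two blocks. *)
  pose s i : R := (i%:R - K%:R) * 2^-1 ^+ n.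
  pose U i w := y (s i.+1) w - y (s i) w.
  have snd : nondecreasing_seq s.
    by move=> i j ij; rewrite ler_wpM2r ?(ltW (half_exp_gt0 R n))// lerB// ler_nat.
  have sK i : s (K + i)%N = dyadic R n i.
    by rewrite /s /dyadic natrD addrAC subrr add0r.
  have sKB i : (i <= K)%N -> s (K - i)%N = - dyadic R n i.
    by move=> iK; rewrite /s /dyadic natrB// addrAC subrr add0r mulNr.
  have mU i : measurable_fun setT (U i) by apply: measurable_funB; exact: (lf_meas ly).
  pose FA z := expR (- (lam * walk_max (fun i => z (K - i.+1)%N) K)).
  pose FB z := expR (- (lam * walk_max (fun i => - z (K + i)%N) k)).
  have eA : A n = [set w | FA (U^~ w) < c].
    apply/seteqP; split => w; rewrite /A /= /FA /past_min;
      rewrite (@walk_max_ext _ (fun i => bwd y n i w) (fun i => U (K - i.+1)%N w))//;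
      by move=> i iK; rewrite /U /bwd subnSK// !sKB// ltnW.
  have eB : B n = [set w | FB (U^~ w) < c'].
    apply/seteqP; split => w; rewrite /B /= /FB /fut_min;
      rewrite (@walk_max_ext _ (fun i => - fwd y n i w) (fun i => - U (K + i)%N w))//;
      by move=> i ik; rewrite /U /fwd -addnS !sK.
  rewrite eA eB.
  apply: (@indep_blocks _ T R P U (K + k) [set i | (i < K)%N] [set i | (K <= i < K + k)%N] mU
     (lf_indep ly snd) _ _ _ [set z | FA z < c] [set z | FB z < c']).
  - by move=> i /= iK; rewrite ltn_addr.
  - by move=> i /= /andP[].
  - by move=> i /= iK /andP[]; rewrite leqNgt iK.
  - apply: measurable_lt; apply: measurableT_comp => //; apply: measurableT_comp => //.
    apply: measurable_funM => //.
    apply: (@measurable_walk_max_fun R _ (coordType R [set i | (i < K)%N])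
       (fun i z => z (K - i.+1)%N)) => i iK.
    by apply: measurable_coord => /=; rewrite ltn_subrL /=; exact: leq_ltn_trans iK.
  - apply: measurable_lt; apply: measurableT_comp => //; apply: measurableT_comp => //.
    apply: measurable_funM => //.
    apply: (@measurable_walk_max_fun R _ (coordType R [set i | (K <= i < K + k)%N])
       (fun i z => - z (K + i)%N)) => i ik.
    apply: measurableT_comp => //.
    by apply: measurable_coord => /=; rewrite leq_addr ltn_add2l.
have Bnd : nondecreasing_seq B.
  move=> n m nm; apply/subsetPset => w /=; apply: le_lt_trans.
  exact: (fut_min_nonincreasing ly lam0).
have And := past_min_lt_nd c.
have eB : [set w | fut_inf y lam t w < c'] = \bigcup_n B n.
  have f0 w m : 0 <= fut_min y lam m (tn m) w by exact: fut_min_ge0.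
  apply/seteqP; split => w /=.
    by move=> /(inf_range_ltP (f0 w))[n h]; exists n.
  by move=> [n _ h]; apply/(inf_range_ltP (f0 w)); exists n.
rewrite past_inf_lt eB.
have cA : P (A n) @[n --> \oo] --> P (\bigcup_n A n).
  apply: nondecreasing_cvg_mu => //; exact: bigcupT_measurable.
have cB : P (B n) @[n --> \oo] --> P (\bigcup_n B n).
  apply: nondecreasing_cvg_mu => //; exact: bigcupT_measurable.
have cAB : P (A n `&` B n) @[n --> \oo] --> P (\bigcup_n A n `&` \bigcup_n B n).
  have -> : \bigcup_n A n `&` \bigcup_n B n = \bigcup_n (A n `&` B n).
    apply/seteqP; split => w.
      move=> [[n _ h] [m _ h']]; exists (maxn n m) => //; split.
        by move/subsetPset: (And n (maxn n m) (leq_maxl _ _)); exact.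
      by move/subsetPset: (Bnd m (maxn n m) (leq_maxr _ _)); exact.
    by move=> [n _ [h h']]; split; exists n.
  apply: nondecreasing_cvg_mu.
  - by move=> n; exact: measurableI.
  - by apply: bigcupT_measurable => n; exact: measurableI.
  - move=> n m nm; apply/subsetPset => w [h h']; split.
      by move/subsetPset: (And n m nm); exact.
    by move/subsetPset: (Bnd n m nm); exact.
have cAB' : (P (A n) * P (B n))%E @[n --> \oo] --> P (\bigcup_n A n `&` \bigcup_n B n).
  by apply: cvg_trans cAB; apply: near_eq_cvg; apply: nearW => n; rewrite AB.
apply: (cvg_unique _ cAB') => //; apply: cvgeM => //.
by apply: mule_def_fin; apply: fin_num_measure; exact: bigcupT_measurable.
Qed.

End past_law.

(** * Time reversal of a walk *)

Section reversal.
Context (R : realType).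
Implicit Types (z : nat -> R).

Lemma walk_rev z k j : (j <= k)%N ->
  walk (fun i => - z (k - i.+1)%N) j = walk z (k - j) - walk z k.
Proof.
elim: j => [|j IH] jk; first by rewrite walk0 subn0 subrr.
rewrite walkS (IH (ltnW jk)) -(subnSK jk) walkS; ring.
Qed.

(** The reversed and negated walk at [j] is [W_(k - j) - W_k], and its maximum is the maximum of the
    walk minus its end value. *)
Lemma walk_max_rev z k :
  walk_max (fun i => - z (k - i.+1)%N) k = walk_max z k - walk z k.
Proof.
apply/eqP; rewrite eq_le; apply/andP; split.
  have [j jk ->] := walk_max_attained (fun i => - z (k - i.+1)%N) k.
  by rewrite walk_rev// lerB// walk_le_max// leq_subr.
have [j jk ->] := walk_max_attained z k.
rewrite -{1}(subKn jk) -walk_rev; last exact: leq_subr.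
by apply: walk_le_max; exact: leq_subr.
Qed.

End reversal.

Lemma measurable_expRN (R : realType) (lam : R) :
  measurable_fun setT (fun u : R => expR (- (lam * u))).
Proof.
have -> : (fun u : R => expR (- (lam * u))) = (fun u => expR ((- lam) * u)).
  by apply/funext => u; rewrite mulNr.
by apply: measurableT_comp => //; exact: measurable_funM.
Qed.

(** * The criterion at an exponential level *)

Definition below_level (T : Type) (R : realType) (A B : T -> R) (lam : R) (p : T * R) : R :=
  if (0 <= p.2) && (A p.1 < expR (- (lam * p.2)) * B p.1) then 1 else 0.

Lemma measurable_below_level d (T : measurableType d) (R : realType) (A B : T -> R) lam :
  measurable_fun setT A -> measurable_fun setT B ->
  measurable_fun setT (below_level A B lam).
Proof.
move=> mA mB; apply: measurable_fun_ifT => //; apply: measurable_and.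
  exact: measurable_fun_ler.
apply: measurable_fun_ltr; first exact: measurableT_comp.
apply: measurable_funM; last exact: measurableT_comp.
apply: measurableT_comp => //; apply: measurableT_comp => //.
by apply: measurable_funM => //; exact: measurable_snd.
Qed.

(** Along a path on which the criterion holds, this is the probability that an exponential level of
    parameter [x] lies below the running infimum [M], that is, [1 - e^(- x M)]. *)
Definition below_prob (T : Type) (R : realType) (A B : T -> R) (lam x : R) w : R :=
  fine (exponential_prob x [set u | 0 <= u /\ A w < expR (- (lam * u)) * B w]).

Section below_prob.
Context d (T : measurableType d) (R : realType) (A B : T -> R) (lam x : R).
Hypothesis x0 : 0 < x.
Hypothesis mA : measurable_fun setT A.
Hypothesis mB : measurable_fun setT B.

Lemma measurable_below_set w : measurable [set u | 0 <= u /\ A w < expR (- (lam * u)) * B w].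
Proof.
have := measurable_below_level lam mA mB => mh.
have mhw : measurable_fun setT (fun u => below_level A B lam (w, u)).
  exact: (measurableT_comp mh (measurable_fun_pair _ _)).
have := measurable_gt 0 mhw; congr measurable; apply/seteqP; split => u; rewrite /= /below_level /=.
  by case: ifP => [/andP[]//|]; rewrite ltxx.
by move=> [-> ->]; rewrite ltr01.
Qed.

Lemma below_probE w : (below_prob A B lam x w)%:E =
  (\int[expo x0]_u (below_level A B lam (w, u))%:E)%E.
Proof.
rewrite /below_prob -(expoE x0) fineK ?fin_num_measure//; last exact: measurable_below_set.
rewrite /below_level /=.
have mb : measurable_fun setT (fun u : R => (0 <= u) && (A w < expR (- (lam * u)) * B w)).
  apply: measurable_and; first exact: measurable_fun_ler.
  apply: measurable_fun_ltr => //; apply: measurable_funM => //.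
  exact: measurable_expRN.
rewrite integral_prob//; congr (expo x0 _).
by apply/seteqP; split => u /= => [[-> ->]|/andP[]].
Qed.

Lemma below_prob_ge0 w : 0 <= below_prob A B lam x w.
Proof. by rewrite /below_prob -(expoE x0) fine_ge0. Qed.

Lemma below_prob_le1 w : below_prob A B lam x w <= 1.
Proof.
rewrite -lee_fin /below_prob -(expoE x0) fineK ?fin_num_measure//; last exact: measurable_below_set.
exact: probability_le1 (measurable_below_set w).
Qed.

Lemma measurable_below_prob : measurable_fun setT (below_prob A B lam x).
Proof.
apply/measurable_EFinP.
have -> : EFin \o below_prob A B lam x =
    (fun w => \int[expo x0]_u (below_level A B lam (w, u))%:E)%E.
  by apply/funext => w; rewrite -below_probE.
apply: (measurable_fun_fubini_tonelli_F (m2 := expo x0) (EFin \o below_level A B lam)).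
- by apply/measurable_EFinP; exact: measurable_below_level.
- by move=> p; rewrite /= lee_fin /below_level; case: ifP.
Qed.

End below_prob.

(** * Expectations at a fixed time *)

Section clock_free.
Context d (T : measurableType d) (R : realType) (P : probability T R).
Variable y : R -> T -> R.
Hypothesis ly : levy_from0 P y.
Variable lam : R.
Hypothesis lam0 : 0 < lam.
Hypothesis mlam : mexp P y lam = 1.
Hypothesis mlam2 : mexp P y (lam / 2) < 1.

Local Notation past := (past_inf y lam).
Local Notation fut := (fut_inf y lam).

Let mpast := measurable_past_inf lam (lf_meas ly).
Let mfut := measurable_fut_inf lam (lf_meas ly).

(** Integrate first over the past: by independence it stays uniform given the future, and the
    threshold [expR (- (lam * u)) * fut t w] lies in [[0, 1]]. *)
Lemma prob_past_lt_fut u t : 0 <= u -> 0 <= t ->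
  P [set w | past w < expR (- (lam * u)) * fut t w] =
  ((expR (- (lam * u)))%:E * \int[P]_w (fut t w)%:E)%E.
Proof.
move=> u0 t0.
have e1 : expR (- (lam * u)) <= 1 by rewrite -expR0 ler_expR oppr_le0 mulr_ge0// ltW.
have mb : measurable_fun setT (fun w => past w < expR (- (lam * u)) * fut t w).
  by apply: measurable_fun_ltr => //; exact: measurable_funM.
rewrite -(integral_prob P mb).
rewrite (@indep2_integral _ T R P _ _ R R (fut t) past
  (fun p => (if p.2 < expR (- (lam * u)) * p.1 then 1 else 0)%:E))//; last 3 first.
- by move=> C D mC mD; rewrite setIC muleC; exact: (indep_past_fut ly lam0 t0).
- apply/measurable_EFinP; apply: measurable_fun_ifT => //.
  by apply: measurable_fun_ltr => //; exact: measurable_funM.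
- by move=> p; case: ifP.
rewrite -ge0_integralZl//; last 2 first.
- exact/measurable_EFinP.
- by move=> w _; rewrite lee_fin fut_inf_ge0.
apply: eq_integral => w _ /=.
have mb' : measurable_fun setT (fun w' => past w' < expR (- (lam * u)) * fut t w).
  exact: measurable_fun_ltr.
rewrite (integral_prob P mb') (prob_past_inf_lt ly lam0 mlam mlam2) ?EFinM//.
rewrite mulr_ge0 ?expR_ge0 ?fut_inf_ge0//=.
by rewrite mulr_ile1 ?expR_ge0 ?fut_inf_ge0// (fut_inf_le1 y lam0).
Qed.

Lemma integral_below_prob x t : 0 < x -> 0 <= t ->
  (\int[P]_w (below_prob past (fut t) lam x w)%:E = (x / (x + lam))%:E * \int[P]_w (fut t w)%:E)%E.
Proof.
move=> x0 t0.
under eq_integral do rewrite (below_probE lam x0 mpast (mfut t)).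
have mh := measurable_below_level lam mpast (mfut t).
rewrite (@fubini_tonelli _ _ T R R P (expo x0) (EFin \o below_level past (fut t) lam))//=; last 2 first.
- exact/measurable_EFinP.
- by move=> p; rewrite /= lee_fin /below_level; case: ifP.
rewrite -(expo_laplace x0 (ltW lam0)) -ge0_integralZr//; last 3 first.
- apply/measurable_EFinP; apply: measurable_fun_ifT => //; first exact: measurable_fun_ler.
  exact: measurable_expRN.
- by move=> u _; case: ifP => // _; rewrite lee_fin expR_ge0.
- by apply: integral_ge0 => w _; rewrite lee_fin fut_inf_ge0.
apply: eq_integral => u _; rewrite /below_level /=.
case: ifP => u0 /=; last by rewrite integral0 mul0e.
rewrite -prob_past_lt_fut// integral_prob//.
by apply: measurable_fun_ltr => //; exact: measurable_funM.
Qed.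

Lemma integral_fut_min n k :
  (\int[P]_w (fut_min y lam n k w)%:E = \int[expo lam0]_a (below P (fwd y n) lam a k)%:E)%E.
Proof.
have [mf iF lf] := fwd_iid ly n.
pose F (z : coordType R [set i | (i < k)%N]) : \bar R :=
  (expR (- (lam * walk_max (fun i => - z i) k)))%:E.
have mF : measurable_fun setT F.
  apply/measurable_EFinP; apply: measurableT_comp => //; apply: measurableT_comp => //.
  apply: measurable_funM => //.
  apply: (@measurable_walk_max_fun R _ (coordType R [set i | (i < k)%N]) (fun i z => - z i)) => i ik.
  by apply: measurableT_comp => //; exact: measurable_coord.
(* Independent steps with a common law may be read in reverse order. *)
have := @law_unique_integral _ T R P (fwd y n) (fun i => fwd y n (k - i.+1)%N) k
  [set i | (i < k)%N] F mf (fun i => mf _) (iF k) (mutually_independent_rev (iF k)) _ _ mF _.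
rewrite /path_of => -> //; last 2 first.
- by move=> i B _ mB; rewrite !(fwd_law ly).
- by move=> z; rewrite lee_fin expR_ge0.
rewrite /F.
pose Z w i := fwd y n i w.
pose g (p : T * R) : R := exp_below lam p.2 k (Z p.1).
have mg : measurable_fun setT g.
  apply: measurable_fun_ifT => //.
  - apply: measurable_fun_ler => //.
    apply: (@measurableT_comp _ _ _ _ _ _ (fun w => walk_max (Z w) k)) => //.
    exact: measurable_walk_max_fun.
  - apply: measurableT_comp => //; apply: measurable_funM => //.
    apply: (@measurableT_comp _ _ _ _ _ _ (fun w => walk (Z w) k)) => //.
    exact: measurable_walk_fun.
transitivity (\int[P]_w \int[expo lam0]_a (g (w, a))%:E)%E.
  apply: eq_integral => w _.
  rewrite (@walk_max_rev _ (Z w)) mulrBr opprB expRD EFinM.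
  (* [e^(- lam S_k)] is the probability that an exponential level of parameter [lam] is at least
     [S_k]. *)
  rewrite -(expo_ge lam0 (walk_max_ge0 (Z w) k)) muleC.
  have mb : measurable_fun setT (fun a : R => walk_max (Z w) k <= a) by exact: measurable_fun_ler.
  rewrite -(integral_prob _ mb) -ge0_integralZr//; last 2 first.
  - by apply/measurable_EFinP; exact: measurable_fun_ifT.
  - by move=> a _; case: ifP.
  apply: eq_integral => a _; rewrite /g /exp_below /=.
  by case: ifP => _; rewrite ?mul1e ?mul0e.
rewrite (@fubini_tonelli _ _ T R R P (expo lam0) (EFin \o g))//=; last 2 first.
- exact/measurable_EFinP.
- by move=> p; rewrite /= lee_fin exp_below_ge0.
apply: eq_integral => a _.
rewrite /below EFin_Rintegral//.
exact: (integrable_exp_below (fwd_iid ly n) (fwd_integrable_exp ly n) a k (ltW lam0)).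
Qed.

End clock_free.

(** * The exponential clock *)

Section integral_nonmeasurable.
Context d (T : measurableType d) (R : realType) (P : probability T R).
Local Open Scope ereal_scope.
Implicit Types (f g : T -> \bar R).

Import HBNNSimple.

(* The integral of a nonnegative function is the supremum of the integrals of
   the simple functions below it, so it is monotone even when one of the two
   functions is not measurable. *)
Lemma ae_le_integral_measurable_r f g : (forall w, 0 <= f w) -> (forall w, 0 <= g w) ->
  measurable_fun setT g -> {ae P, forall w, f w <= g w} ->
  \int[P]_w f w <= \int[P]_w g w.
Proof.
move=> f0 g0 mg fg; rewrite ge0_integralTE//.
apply: ge_ereal_sup => _ [h /= hf <-].
rewrite -integralT_nnsfun; apply: ae_ge0_le_integral => //.
- by move=> w _; rewrite lee_fin; exact: fun_ge0.
- exact/measurable_EFinP.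
- by have := fg; apply: filterS => w fgw _; exact: le_trans fgw.
Qed.

(** The smaller function is set to 0 on a measurable null set outside which the inequality holds.
    Its integral is unchanged, and every simple function below it is then below [g] everywhere. *)
Lemma ae_le_integral_measurable_l f g : (forall w, 0 <= f w) -> (forall w, 0 <= g w) ->
  measurable_fun setT f -> {ae P, forall w, f w <= g w} ->
  \int[P]_w f w <= \int[P]_w g w.
Proof.
move=> f0 g0 mf [N [mN PN fgN]].
have fg w : ~ N w -> f w <= g w by apply: contra_notP => nfg; apply: fgN.
have -> : \int[P]_w f w = \int[P]_w (f \_ (~` N)) w.
  apply: ge0_ae_eq_integral => //.
  - apply/(measurable_restrictT f (measurableC mN)).
    exact: measurable_funTS.
  - by move=> w _; apply: erestrict_ge0.
  - exists N; split => // w /= h; apply: contrapT => Nw; apply: h => _.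
    by rewrite patchE mem_set.
rewrite ge0_integralTE//; last by move=> w; apply: erestrict_ge0.
rewrite [leRHS]ge0_integralTE//.
apply: ge_ereal_sup => _ [h /= hf <-]; apply: ereal_sup_ubound; exists h => //= w.
apply: le_trans (hf w) _; rewrite patchE; case: ifPn => // /set_mem; exact: fg.
Qed.

End integral_nonmeasurable.

Lemma nneseries_single (R : realType) (K : nat) (x : nat -> \bar R) : (forall k, 0 <= x k)%E ->
  (\sum_(0 <= k <oo) (if K == k then x k else 0) = x K)%E.
Proof.
move=> x0.
rewrite (nneseries_split 0 K.+1); last by move=> k _; case: ifP.
rewrite add0n big_nat_recr//= eqxx big_nat big1 ?add0e; last first.
  by move=> i iK; rewrite gtn_eqF.
rewrite eseries0 ?adde0// => i Ki _.
by rewrite ltn_eqF.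
Qed.

(** The number of complete mesh steps before [e]. Negative values give 0, so [e] lies between the
    two adjacent grid times only where it is nonnegative. *)
Definition tick (T : Type) (R : realType) (e : T -> R) n w := Num.truncn (e w * 2 ^+ n).

Section tick.
Context d (T : measurableType d) (R : realType) (e : T -> R).
Hypothesis me : measurable_fun setT e.
Local Notation tick := (tick e).

Lemma tick_gt n k w : (k < tick n w)%N = (dyadic R n k.+1 <= e w).
Proof. by rewrite truncn_gt_nat /dyadic exprVn ler_pdivrMr// exprn_gt0. Qed.

Lemma measurable_tick_ge n k : measurable [set w | (k <= tick n w)%N].
Proof.
case: k => [|k]; first by rewrite (_ : [set w | _] = setT)//; apply/seteqP.
rewrite (_ : [set w | _] = e @^-1` `[dyadic R n k.+1, +oo[%classic); last first.
  by apply/seteqP; split => w /=; rewrite tick_gt in_itv /= andbT.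
by rewrite -[X in measurable X]setTI; exact: me.
Qed.

Lemma measurable_tick_eq n k : measurable_fun setT (fun w => tick n w == k).
Proof.
apply: (measurable_fun_bool true).
rewrite setTI (_ : _ @^-1` _ =
  [set w | (k <= tick n w)%N] `\` [set w | (k.+1 <= tick n w)%N]); last first.
  apply/seteqP; split => w /=.
    by move=> /eqP->; rewrite leqnn ltnn.
  by move=> [h /negP]; rewrite -leqNgt => h'; rewrite eqn_leq h h'.
by apply: measurableD; exact: measurable_tick_ge.
Qed.

End tick.

Lemma measurable_truncn_eq (R : realType) n k :
  measurable_fun setT (fun u : R => Num.truncn (u * 2 ^+ n) == k).
Proof. exact: (@measurable_tick_eq _ R R idfun (@measurable_id _ _ setT)). Qed.

Section clock.
Context d (T : measurableType d) (R : realType) (P : probability T R).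
Variable e : T -> R.
Variable q : R.
Hypothesis q0 : 0 < q.
Hypothesis me : measurable_fun setT e.
Hypothesis elaw : forall B : set R, measurable B -> P (e @^-1` B) = exponential_prob q B.

Local Notation tick := (tick e).
Local Notation measurable_tick_ge := (measurable_tick_ge me).
Local Notation measurable_tick_eq := (measurable_tick_eq me).

(** The probability that the clock survives one mesh step, which is the discount factor [r] of the
    overview. *)
Definition tick_ratio n : R := expR (- (q * 2^-1 ^+ n)).

Lemma tick_ratio_gt0_lt1 n : 0 < tick_ratio n < 1.
Proof.
by rewrite expR_gt0 /= -expR0 ltr_expR oppr_lt0 mulr_gt0// half_exp_gt0.
Qed.

Lemma prob_tick_ge n k : P [set w | (k <= tick n w)%N] = (tick_ratio n ^+ k)%:E.
Proof.
case: k => [|k].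
  by rewrite expr0 (_ : [set w | _] = setT) ?probability_setT//; apply/seteqP.
rewrite (_ : [set w | _] = e @^-1` [set u | dyadic R n k.+1 <= u]); last first.
  by apply/seteqP; split => w /=; rewrite tick_gt.
rewrite elaw -?(expoE q0); last first.
  rewrite (_ : [set u | _] = `[dyadic R n k.+1, +oo[%classic); first exact: measurable_itv.
  by apply/seteqP; split => u /=; rewrite in_itv /= andbT.
rewrite expo_ge ?dyadic_ge0// /tick_ratio -expRM_natl; congr (expR _)%:E.
by rewrite /dyadic; ring.
Qed.

Lemma prob_tick n k : P [set w | tick n w == k] = ((1 - tick_ratio n) * tick_ratio n ^+ k)%:E.
Proof.
have -> : [set w | tick n w == k] = [set w | (k <= tick n w)%N] `\` [set w | (k.+1 <= tick n w)%N].
  apply/seteqP; split => w /=.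
    by move=> /eqP->; rewrite leqnn ltnn.
  by move=> [h /negP]; rewrite -leqNgt => h'; rewrite eqn_leq h h'.
rewrite measureD; last 3 first.
- exact: measurable_tick_ge.
- exact: measurable_tick_ge.
- by rewrite ltey_eq fin_num_measure//; exact: measurable_tick_ge.
rewrite setIidr; last by move=> w /=; exact: ltnW.
rewrite [X in (X - _)%E]prob_tick_ge [X in (_ - X)%E]prob_tick_ge -EFinB exprS.
by congr EFin; ring.
Qed.

Variable g : nat -> T -> R.
Hypothesis mg : forall k, measurable_fun setT (g k).

Lemma measurable_clock n : measurable_fun setT (fun w => g (tick n w) w).
Proof.
move=> _ B mB; rewrite setTI.
have -> : (fun w => g (tick n w) w) @^-1` B =
    \bigcup_k ([set w | tick n w == k] `&` g k @^-1` B).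
  apply/seteqP; split => w /=; first by move=> h; exists (tick n w) => //=.
  by move=> [k _ [/= /eqP<-]].
apply: bigcupT_measurable => k; apply: measurableI.
  by rewrite -[X in measurable X]setTI; exact: (measurable_tick_eq n k measurableT (Y := [set true])).
by rewrite -[X in measurable X]setTI; exact: mg.
Qed.

Hypothesis g0 : forall k w, 0 <= g k w.
Hypothesis ge_indep : forall k, indep2 P (g k) e.

(** Split according to the value of the tick. The event that it equals [k] depends on [e] only, so
    each summand factors, and the weights are geometric. *)
Lemma integral_clock n :
  (\int[P]_w (g (tick n w) w)%:E =
   \sum_(0 <= k <oo) ((1 - tick_ratio n) * tick_ratio n ^+ k)%:E * \int[P]_w (g k w)%:E)%E.
Proof.
pose b k w : R := if tick n w == k then 1 else 0.
have mb k : measurable_fun setT (b k) by apply: measurable_fun_ifT => //; exact: measurable_tick_eq.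
have b0 k w : 0 <= b k w by rewrite /b; case: ifP.
transitivity (\int[P]_w \sum_(0 <= k <oo) (g k w * b k w)%:E)%E.
  apply: eq_integral => w _.
  rewrite -(@nneseries_single R (tick n w) (fun k => (g k w)%:E)); last first.
    by move=> k; rewrite lee_fin.
  by apply: eq_eseriesr => k _; rewrite /b; case: ifP => _; rewrite ?mulr1 ?mulr0.
rewrite integral_nneseries//; last 2 first.
- by move=> k; apply/measurable_EFinP; exact: measurable_funM.
- by move=> k w _; rewrite lee_fin mulr_ge0.
apply: eq_eseriesr => k _.
rewrite indep2_prod//; last first.
  move=> C D mC mD.
  pose b' (u : R) : R := if Num.truncn (u * 2 ^+ n) == k then 1 else 0.
  have mb' : measurable_fun setT b'.
    by apply: measurable_fun_ifT => //; exact: measurable_truncn_eq.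
  rewrite -[b k @^-1` D]/(e @^-1` (b' @^-1` D)).
  apply: ge_indep => //; by rewrite -[X in measurable X]setTI; exact: mb'.
rewrite muleC; congr (_ * _)%E.
by rewrite /b integral_prob ?prob_tick//; exact: measurable_tick_eq.
Qed.

End clock.

(** * The process at an independent exponential time *)

Section exponential_clock.
Context d (T : measurableType d) (R : realType) (P : probability T R).
Variable y : R -> T -> R.
Hypothesis ly : levy_from0 P y.
Variables lam phi q : R.
Hypothesis lam0 : 0 < lam.
Hypothesis q0 : 0 < q.
Hypothesis lam_phi : lam < phi.
Hypothesis mlam : mexp P y lam = 1.
Hypothesis mlam2 : mexp P y (lam / 2) < 1.
Hypothesis mphi : mexp P y phi = expR q.
Variable e : T -> R.
Hypothesis me : measurable_fun setT e.
Hypothesis elaw : forall B : set R, measurable B -> P (e @^-1` B) = exponential_prob q B.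
Variable G : set (set T).
Hypothesis yG : forall t, measurable_fun setT (y t : g_sigma_algebraType G -> R).
Hypothesis eG : forall (A : set T) (B : set R), <<s G >> A -> measurable B ->
  P (A `&` e @^-1` B) = (P A * P (e @^-1` B))%E.

Local Notation past := (past_inf y lam).
Local Notation fut := (fut_inf y lam).
Local Notation tick := (tick e).
Local Notation rho := (tick_ratio q).

Let mpast := measurable_past_inf lam (lf_meas ly).
Let mfut := measurable_fut_inf lam (lf_meas ly).
Let mfmin := measurable_fut_min lam (lf_meas ly).

Lemma process_indep (g : T -> R) :
  measurable_fun setT (g : g_sigma_algebraType G -> R) -> indep2 P g e.
Proof.
move=> mg A B mA mB; apply: eG => //.
by have := mg measurableT _ mA; rewrite setTI.
Qed.

Lemma ae_clock_ge0 : {ae P, forall w, 0 <= e w}.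
Proof.
have mneg : measurable [set u : R | u < 0].
  rewrite (_ : [set u | _] = `]-oo, 0[%classic); first exact: measurable_itv.
  by apply/seteqP; split => u /=; rewrite in_itv.
exists (e @^-1` [set u | u < 0]); split.
- by rewrite -[X in measurable X]setTI; exact: me.
- by rewrite elaw// -(expoE q0) expo_lt0.
- by move=> w /= /negP; rewrite -ltNge.
Qed.

(** Both the moment and the reciprocal of the ratio have [expR q] as their power of order
    [2 ^ n]. *)
Lemma ratio_mgf n : rho n * mgf P (fwd y n) phi = 1.
Proof.
have phi0 : 0 <= phi by rewrite ltW// (lt_trans lam0).
have -> : mgf P (fwd y n) phi = expR (q * 2^-1 ^+ n).
  apply: (pexpIrn (_ : 0 < 2 ^ n)%N); rewrite ?nnegrE ?mgf_ge0 ?expR_ge0 ?expn_gt0//.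
  rewrite (fwd_mgf_scale ly)// mphi -expRM_natl natrX mulrCA -exprMn divff//.
  by rewrite expr1n mulr1.
by rewrite -expRD addNr expR0.
Qed.

Lemma measurable_below n k : measurable_fun setT (fun a => below P (fwd y n) lam a k).
Proof.
have mf := iid_meas (fwd_iid ly n).
pose Z w i := fwd y n i w.
pose g (p : T * R) : R := exp_below lam p.2 k (Z p.1).
have mg : measurable_fun setT g.
  apply: measurable_fun_ifT => //.
  - apply: measurable_fun_ler => //.
    apply: (@measurableT_comp _ _ _ _ _ _ (fun w => walk_max (Z w) k)) => //.
    exact: measurable_walk_max_fun.
  - apply: measurableT_comp => //; apply: measurable_funM => //.
    apply: (@measurableT_comp _ _ _ _ _ _ (fun w => walk (Z w) k)) => //.
    exact: measurable_walk_fun.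
apply/measurable_EFinP.
have -> : EFin \o (fun a => below P (fwd y n) lam a k) = (fun a => \int[P]_w (g (w, a))%:E)%E.
  apply/funext => a; rewrite /= /below EFin_Rintegral//.
  exact: (integrable_exp_below (fwd_iid ly n) (fwd_integrable_exp ly n) a k (ltW lam0)).
apply: (measurable_fun_fubini_tonelli_G (m1 := P) (EFin \o g)).
- exact/measurable_EFinP.
- by move=> p; rewrite /= lee_fin exp_below_ge0.
Qed.

Lemma integral_grid_clock n :
  (\int[P]_w (fut_min y lam n (tick n w) w)%:E =
   \int[expo lam0]_a discounted_below_series P (fwd y) lam rho n a)%E.
Proof.
have /andP[r0 r1] := tick_ratio_gt0_lt1 q0 n.
have p0 k : 0 <= (1 - rho n) * rho n ^+ k.
  by rewrite mulr_ge0 ?subr_ge0 ?exprn_ge0// ltW.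
rewrite (integral_clock q0 me elaw (mfmin n)); last 2 first.
- by move=> k w; exact: fut_min_ge0.
- by move=> k; apply: process_indep; exact: measurable_fut_min.
rewrite /discounted_below_series integral_nneseries//; last 2 first.
- move=> k; apply/measurable_EFinP; apply: measurable_funM => //; exact: measurable_below.
- by move=> k a _; rewrite lee_fin mulr_ge0// below_ge0.
apply: eq_eseriesr => k _.
rewrite (integral_fut_min ly lam0) -ge0_integralZl//.
- by apply/measurable_EFinP; exact: measurable_below.
- by move=> a _; rewrite lee_fin below_ge0.
- by rewrite lee_fin.
Qed.

Lemma discounted_below_series_lt0 n a : a < 0 ->
  discounted_below_series P (fwd y) lam rho n a = 0%E.
Proof.
move=> a0; rewrite /discounted_below_series eseries0// => k _ _.
suff -> : below P (fwd y n) lam a k = 0 by rewrite mulr0.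
rewrite /below; under eq_Rintegral.
  move=> w _; rewrite /exp_below ifF; last first.
    by apply/negbTE; rewrite -ltNge (lt_le_trans a0)// walk_max_ge0.
  over.
by rewrite Rintegral_cst// mul0r.
Qed.

(** The grid expectations are evaluated in the limit twice: directly they tend to the left side, and
    as integrals over the level they tend to the integral of [1 - expR (- ((phi - lam) * a))]
    against the exponential law. *)
Lemma integral_fut_clock : (\int[P]_w (fut (e w) w)%:E = (1 - lam / phi)%:E)%E.
Proof.
have phi0 : 0 < phi by exact: lt_trans lam_phi.
have h1 : (fun n => \int[P]_w (fut_min y lam n (tick n w) w)%:E)%E @ \oo -->
    (\int[P]_w (fut (e w) w)%:E)%E.
  apply: (@dominated_convergence_prob _ _ _ _ _ _ 1).
  - by move=> n; apply: (measurable_clock me) => k; exact: mfmin.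
  (* By definition [fut (e w) w] is the infimum over [n] of the grid minima at the ticks, so it is
     measurable. *)
  - apply: (measurable_inf_range (u := fun n w => fut_min y lam n (tick n w) w)).
      by move=> n w; exact: fut_min_ge0.
    by move=> n; apply: (measurable_clock me) => k; exact: mfmin.
  - have := ae_clock_ge0; apply: filterS => w ew0.
    apply: (cvg_inf_range (u := fun n => fut_min y lam n (tick n w) w)).
      by move=> n; exact: fut_min_ge0.
    exact: (fut_min_nonincreasing ly lam0).
  - by move=> n w; rewrite fut_min_ge0 fut_min_le1.
pose f (a : R) : R := if 0 <= a then 1 - expR (- ((phi - lam) * a)) else 0.
have f01 a : 0 <= f a <= 1.
  rewrite /f; case: ifP => a0; last by rewrite lexx ler01.
  rewrite subr_ge0 gerBl expR_ge0 andbT -expR0 ler_expR oppr_le0 mulr_ge0// subr_ge0 ltW//.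
have mf : measurable_fun setT f.
  apply: measurable_fun_ifT => //; first exact: measurable_fun_ler.
  by apply: measurable_funB => //; exact: measurable_expRN.
have lamle : 0 <= lam <= phi by rewrite !ltW.
have mphi1 : 1 < mexp P y phi by rewrite mphi -expR0 ltr_expR.
have bnd n a : (0 <= discounted_below_series P (fwd y) lam rho n a <= 1)%E.
  have [a0|a0] := leP 0 a; last by rewrite discounted_below_series_lt0// lexx lee01.
  have [h2 h3] := discounted_below_series_bounds (fwd_iid ly) (fwd_integrable_exp ly)
    (fwd_mgf_scale ly) n lamle mlam a0 (tick_ratio_gt0_lt1 q0) ratio_mgf.
  apply/andP; split.
    apply: le_trans h2; rewrite lee_fin subr_ge0 -expR0 ler_expR mulNr oppr_le0 mulr_ge0//.
    by rewrite subr_ge0 ltW.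
  by have := h3 0%N; rewrite big_ord0 subr0.
have h2 : (fun n => \int[expo lam0]_a discounted_below_series P (fwd y) lam rho n a)%E @ \oo -->
    (\int[expo lam0]_a (f a)%:E)%E.
  have [] := @dominated_convergence _ R R (expo lam0) setT measurableT
    (fun n a => discounted_below_series P (fwd y) lam rho n a) (fun a => (f a)%:E) (cst 1%E) => //.
  - move=> n; apply: ge0_emeasurable_sum.
      move=> k a _ _; rewrite lee_fin mulr_ge0 ?below_ge0//.
      have /andP[r0 r1] := tick_ratio_gt0_lt1 q0 n.
      by rewrite mulr_ge0 ?subr_ge0 ?exprn_ge0// ltW.
    by move=> k _; apply/measurable_EFinP; apply: measurable_funM => //; exact: measurable_below.
  - exact/measurable_EFinP.
  - apply: aeW => a _; rewrite /f; case: ifP => a0.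
      rewrite -mulNr.
      exact: (discounted_below_series_limit (fwd_iid ly) (fwd_integrable_exp ly)
        (fwd_mgf_scale ly) (fwd_step_max_small ly) lamle mlam mphi1 a0 (tick_ratio_gt0_lt1 q0) ratio_mgf).
    have -> : (fun n => discounted_below_series P (fwd y) lam rho n a) = cst 0%E.
      by apply/funext => n; rewrite discounted_below_series_lt0// ltNge a0.
    exact: cvg_cst.
  - exact: (finite_measure_integrable_cst (expo lam0) 1 measurableT).
  - by apply: aeW => a n _; have /andP[b0 b1] := bnd n a; rewrite gee0_abs.
have h3 : (\int[expo lam0]_a (f a)%:E = (1 - lam / phi)%:E)%E.
  have pl0 : 0 <= phi - lam by rewrite subr_ge0 ltW.
  have := expo_laplace lam0 (lexx 0); rewrite addr0 divff ?gt_eqF// => i1.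
  have := expo_laplace lam0 pl0; rewrite (addrC lam) subrK => i2.
  have mexp' : measurable_fun setT (fun u : R => if 0 <= u then expR (- ((phi - lam) * u)) else 0).
    apply: measurable_fun_ifT => //; first exact: measurable_fun_ler.
    exact: measurable_expRN.
  (* The integral of [f] is found from its complement, whose integral is the Laplace transform at
     [phi - lam], equal to [lam / phi]. *)
  have : (\int[expo lam0]_a (f a)%:E +
      \int[expo lam0]_u (if 0 <= u then expR (- ((phi - lam) * u)) else 0)%R%:E = 1)%E.
    rewrite -i1 -ge0_integralD//; last 4 first.
    - by move=> a _; rewrite lee_fin; case/andP: (f01 a).
    - exact/measurable_EFinP.
    - by move=> a _; case: ifP => // _; rewrite lee_fin expR_ge0.
    - exact/measurable_EFinP.
    apply: eq_integral => a _; rewrite -EFinD /f; case: ifP => a0; last by rewrite addr0.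
    by rewrite subrK mul0r oppr0 expR0.
  by rewrite i2 => h; rewrite EFinB -h addeK.
rewrite -h3; apply: (cvg_unique _ _ h2) => //.
by apply: cvg_trans h1; apply: near_eq_cvg; apply: nearW => n; rewrite integral_grid_clock.
Qed.

Lemma fut_inf0 w : fut 0 w = 1.
Proof.
apply/eqP; rewrite eq_le (fut_inf_le1 y lam0)/=; apply: inf_range_ge => n.
by rewrite mul0r truncn0 /fut_min /= mulr0 oppr0 expR0.
Qed.

Variable x : R.
Hypothesis x0 : 0 < x.

Local Notation bprob := (fun t => below_prob past (fut t) lam x).

Lemma integral_fut_tick n (s : nat -> nat) :
  (\int[P]_w (fut (dyadic R n (s (tick n w))) w)%:E =
   \sum_(0 <= k <oo) ((1 - rho n) * rho n ^+ k)%:E *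
     \int[P]_w (fut (dyadic R n (s k)) w)%:E)%E.
Proof.
apply: (integral_clock q0 me elaw (g := fun k => fut (dyadic R n (s k)))) => //.
- by move=> k w; exact: fut_inf_ge0.
- by move=> k; apply: process_indep; exact: measurable_fut_inf.
Qed.

Lemma measurable_fut_tick n (s : nat -> nat) :
  measurable_fun setT (fun w => fut (dyadic R n (s (tick n w))) w).
Proof.
by apply: (measurable_clock me (g := fun k => fut (dyadic R n (s k)))) => k.
Qed.

Lemma measurable_below_tick n (s : nat -> nat) :
  measurable_fun setT (fun w => bprob (dyadic R n (s (tick n w))) w).
Proof.
apply: (measurable_clock me (g := fun k => bprob (dyadic R n (s k)))) => k.
by apply: measurable_below_prob.
Qed.

Lemma tick_weight_ge0 n k : 0 <= (1 - rho n) * rho n ^+ k.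
Proof.
have /andP[r0 r1] := tick_ratio_gt0_lt1 q0 n.
by rewrite mulr_ge0 ?subr_ge0 ?exprn_ge0// ltW.
Qed.

Lemma integral_below_tick n (s : nat -> nat) :
  (\int[P]_w (bprob (dyadic R n (s (tick n w))) w)%:E =
   (x / (x + lam))%:E * \int[P]_w (fut (dyadic R n (s (tick n w))) w)%:E)%E.
Proof.
rewrite (integral_clock q0 me elaw (g := fun k => bprob (dyadic R n (s k)))); last 3 first.
- by move=> k; exact: measurable_below_prob.
- by move=> k w; exact: below_prob_ge0.
- move=> k; apply: process_indep; apply: measurable_below_prob => //.
    exact: measurable_past_inf.
  exact: measurable_fut_inf.
rewrite integral_fut_tick -nneseriesZl; last first.
  move=> k _; rewrite mule_ge0 ?lee_fin ?tick_weight_ge0//.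
  by apply: integral_ge0 => w _; rewrite lee_fin fut_inf_ge0.
apply: eq_eseriesr => k _.
by rewrite (integral_below_prob ly lam0 mlam mlam2)// ?dyadic_ge0// muleCA.
Qed.

(* Memorylessness of the geometric law of [tick e n]. *)
Lemma fut_tick_shift n :
  (\int[P]_w (fut (dyadic R n (tick n w)) w)%:E = (1 - rho n)%:E +
   (rho n)%:E * \int[P]_w (fut (dyadic R n (tick n w).+1) w)%:E)%E.
Proof.
have pos (s : nat -> nat) k : (0 <= ((1 - rho n) * rho n ^+ k)%:E *
    \int[P]_w (fut (dyadic R n (s k)) w)%:E)%E.
  rewrite mule_ge0 ?lee_fin ?tick_weight_ge0//.
  by apply: integral_ge0 => w _; rewrite lee_fin fut_inf_ge0.
rewrite (integral_fut_tick n id) (integral_fut_tick n succn).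
rewrite [LHS](nneseries_recl (P := xpredT) (fun k _ => pos id k) isT).
congr (_ + _)%E.
  rewrite dyadic0; under eq_integral do rewrite fut_inf0.
  by rewrite integral_cst//= probability_setT !mule1 expr0 mulr1.
rewrite -nneseriesZl; last by move=> k _; exact: (pos succn).
rewrite -(@nneseries_addn _ _ 1 (pos id)).
apply: eq_eseriesr => k _; rewrite addn1 muleA -EFinM; congr (_%:E * _)%E.
by rewrite exprS; ring.
Qed.

Lemma tick_itv n w : 0 <= e w ->
  dyadic R n (tick n w) <= e w <= dyadic R n (tick n w).+1.
Proof.
move=> e0; rewrite /dyadic exprVn ler_pdivrMr ?exprn_gt0// ler_pdivlMr ?exprn_gt0//.
have /truncn_itv/andP[-> /ltW->//] : 0 <= e w * 2 ^+ n by rewrite mulr_ge0// exprn_ge0.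
Qed.

Lemma fut_tick_le n : (\int[P]_w (fut (dyadic R n (tick n w).+1) w)%:E <= (1 - lam / phi)%:E)%E.
Proof.
rewrite -integral_fut_clock; apply: ae_le_integral_measurable_l.
- by move=> w; rewrite lee_fin fut_inf_ge0.
- by move=> w; rewrite lee_fin fut_inf_ge0.
- by apply/measurable_EFinP; exact: (measurable_fut_tick n succn).
- have := ae_clock_ge0; apply: filterS => w e0; rewrite lee_fin.
  by apply: (fut_inf_mono ly lam0) => //; case/andP: (tick_itv n e0).
Qed.

Lemma fut_tick_ge n : ((1 - lam / phi)%:E <= \int[P]_w (fut (dyadic R n (tick n w)) w)%:E)%E.
Proof.
rewrite -integral_fut_clock; apply: ae_le_integral_measurable_r.
- by move=> w; rewrite lee_fin fut_inf_ge0.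
- by move=> w; rewrite lee_fin fut_inf_ge0.
- by apply/measurable_EFinP; exact: (measurable_fut_tick n id).
- have := ae_clock_ge0; apply: filterS => w e0; rewrite lee_fin.
  by apply: (fut_inf_mono ly lam0); rewrite ?dyadic_ge0//; case/andP: (tick_itv n e0).
Qed.

Local Notation M := (running_inf (reflected y)).

Lemma running_inf_ge0 t w : (0 <= M t w)%E.
Proof.
apply: le_ereal_inf_tmp => _ [s _ <-]; apply: ereal_sup_ubound; exists s => //=.
by rewrite subrr.
Qed.

Lemma running_inf_mono s t w : s <= t -> (M t w <= M s w)%E.
Proof.
move=> st; apply: le_ereal_inf => _ [u /= /andP[u0 us] <-]; exists u => //=.
by rewrite u0 (le_trans us).
Qed.

(** [e^(- x m)] is the probability that an exponential variable is at least [m], also for infinite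
    [m]. *)
Lemma expeR_expo (m : \bar R) : (0 <= m)%E ->
  expeR (- (x%:E * m)) = (1 - expo x0 [set u : R | (0 <= u)%R /\ (u%:E < m)%E])%E.
Proof.
case: m => [m|_|//]; last first.
  rewrite gt0_muley ?lte_fin//=.
  have -> : [set u : R | 0 <= u /\ (u%:E < +oo)%E] = [set u | 0 <= u].
    by apply/seteqP; split => u /= => [[//]|u0]; rewrite ltry.
  by rewrite expo_ge// mulr0 oppr0 expR0 subee.
rewrite lee_fin => m0.
have -> : [set u : R | 0 <= u /\ (u%:E < m%:E)%E] = [set u | 0 <= u < m].
  by apply/seteqP; split => u /= => [[u0 um]|/andP[u0 um]]; [apply/andP|].
by rewrite expo_itv// -EFinB /=; congr EFin; ring.
Qed.

Lemma expeR_running_inf n k w : good_path y w ->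
  expeR (- (x%:E * M (dyadic R n k) w)) = (1 - bprob (dyadic R n k) w)%:E.
Proof.
move=> gw; rewrite expeR_expo ?running_inf_ge0// EFinB; congr (1 - _)%E.
rewrite /below_prob -(expoE x0) fineK ?fin_num_measure//; last exact: measurable_below_set.
congr (expo x0 _); apply/seteqP; split => u /= [u0 h]; split => //.
  exact/(running_inf_gt ly lam0 n k gw u0).
exact/(running_inf_gt ly lam0 n k gw u0).
Qed.

Lemma integral_below_tick_compl n (s : nat -> nat) :
  (\int[P]_w (1 - bprob (dyadic R n (s (tick n w))) w)%R%:E =
   1 - (x / (x + lam))%:E * \int[P]_w (fut (dyadic R n (s (tick n w))) w)%:E)%E.
Proof.
rewrite -integral_below_tick.
have i1 : P.-integrable setT (EFin \o (fun w => bprob (dyadic R n (s (tick n w))) w)).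
  apply: (@integrable_bounded _ _ _ _ _ 1); first exact: measurable_below_tick.
  by move=> w; apply/andP; split; [exact: below_prob_ge0|exact: below_prob_le1].
under eq_integral do rewrite EFinB.
rewrite integralB//; last exact: finite_measure_integrable_cst.
by rewrite integral_cst//= probability_setT mule1.
Qed.

(** The running infimum decreases in time, so moving [e] to the next grid time increases the
    transform. Only the grid side of the comparison is known to be measurable. *)
Lemma exp_running_inf_tick_le n :
  (\int[P]_w expeR (- (x%:E * M (e w) w)) <=
   1 - (x / (x + lam))%:E * \int[P]_w (fut (dyadic R n (tick n w).+1) w)%:E)%E.
Proof.
rewrite -(integral_below_tick_compl n succn); apply: ae_le_integral_measurable_r.
- by move=> w; exact: expeR_ge0.
- by move=> w; rewrite lee_fin subr_ge0; exact: below_prob_le1.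
- apply/measurable_EFinP; apply: measurable_funB; first exact: measurable_cst.
  exact: (measurable_below_tick n succn).
- have := ae_clock_ge0; have := lf_path ly; apply: filterS2 => w gw e0.
  rewrite -expeR_running_inf// lee_expeR leeN2 lee_pmul2l ?lte_fin//.
  by apply: running_inf_mono; case/andP: (tick_itv n e0).
Qed.

Lemma exp_running_inf_tick_ge n :
  (1 - (x / (x + lam))%:E * \int[P]_w (fut (dyadic R n (tick n w)) w)%:E <=
   \int[P]_w expeR (- (x%:E * M (e w) w)))%E.
Proof.
rewrite -(integral_below_tick_compl n id); apply: ae_le_integral_measurable_l.
- by move=> w; rewrite lee_fin subr_ge0; exact: below_prob_le1.
- by move=> w; exact: expeR_ge0.
- apply/measurable_EFinP; apply: measurable_funB; first exact: measurable_cst.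
  exact: (measurable_below_tick n id).
- have := ae_clock_ge0; have := lf_path ly; apply: filterS2 => w gw e0.
  rewrite -expeR_running_inf// lee_expeR leeN2 lee_pmul2l ?lte_fin//.
  by apply: running_inf_mono; case/andP: (tick_itv n e0).
Qed.

(** Let [a] be the mean of the future infimum at the next grid time and [L = 1 - lam / phi]. Then
    [a <= L <= 1 - r + r * a], and both the upper and the lower bound on the transform miss the
    target by at most [1 - r]. *)
Lemma exp_running_inf_near n : exists2 t : R,
  (\int[P]_w expeR (- (x%:E * M (e w) w)) = t%:E)%E &
  `|t - (1 - x / (x + lam) * (1 - lam / phi))| <= q * 2^-1 ^+ n.
Proof.
have /andP[r0 r1] := tick_ratio_gt0_lt1 q0 n.
have rq : 1 - rho n <= q * 2^-1 ^+ n.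
  by have := expR_ge1Dx (- (q * 2^-1 ^+ n)); rewrite -/(rho n); lra.
have h1 := fut_tick_le n; have h2 := fut_tick_ge n.
have h3 := exp_running_inf_tick_le n; have h4 := exp_running_inf_tick_ge n.
rewrite fut_tick_shift in h2 h4.
have : (0 <= \int[P]_w (fut (dyadic R n (tick n w).+1) w)%:E)%E.
  by apply: integral_ge0 => w _; rewrite lee_fin fut_inf_ge0.
move: h1 h2 h3 h4; case: (\int[P]_w (fut _ w)%:E)%E => // a.
case: (\int[P]_w expeR _)%E => // t; rewrite -?EFinM -?EFinD -?EFinM -?EFinB !lee_fin.
have phi0 : 0 < phi := lt_trans lam0 lam_phi.
have L1 : 1 - lam / phi <= 1 by rewrite gerBl divr_ge0// ltW.
have xl0 : 0 < x + lam by rewrite addr_gt0.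
have c0 : 0 <= x / (x + lam) by rewrite divr_ge0// ltW.
have c1 : x / (x + lam) <= 1 by rewrite ler_pdivrMr// mul1r lerDl ltW.
move: L1 c0 c1; set L := 1 - lam / phi; set c := x / (x + lam); set r := rho n in r0 r1 rq *.
move=> L1 c0 c1 aL La tle tge a0; exists t => //; apply: le_trans rq.
have cL : c * (L - a) <= 1 - r.
  apply: (@le_trans _ _ (1 * (L - a))); first by rewrite ler_wpM2r// subr_ge0.
  nra.
have cL' : c * (1 - r + r * a - L) <= 1 - r.
  apply: (@le_trans _ _ (1 * (1 - r + r * a - L))); first by rewrite ler_wpM2r// subr_ge0.
  nra.
by rewrite ler_norml; apply/andP; split; nra.
Qed.

(** The integral does not depend on [n], and its distance to the target is below every
    [q * 2^-1 ^+ n]. *)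
Lemma exp_running_inf_clock :
  (\int[P]_w expeR (- (x%:E * M (e w) w)) = (lam / (x + lam) * ((phi + x) / phi))%:E)%E.
Proof.
have phi0 : 0 < phi := lt_trans lam0 lam_phi.
have xl0 : 0 < x + lam by rewrite addr_gt0.
have [t tE _] := exp_running_inf_near 0; rewrite tE; congr EFin.
have -> : lam / (x + lam) * ((phi + x) / phi) = 1 - x / (x + lam) * (1 - lam / phi).
  by field; rewrite !gt_eqF.
have near n : `|t - (1 - x / (x + lam) * (1 - lam / phi))| <= q * 2^-1 ^+ n.
  by have [s sE] := exp_running_inf_near n; move: sE; rewrite tE => -[->].
apply/eqP; rewrite -subr_eq0 -normr_eq0 eq_le normr_ge0 andbT.
have cv : (fun n => q * 2^-1 ^+ n) @ \oo --> (0 : R).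
  by apply: cvg_geometric; rewrite gtr0_norm ?invr_gt0// invf_lt1// ltr1n.
rewrite -(cvg_lim _ cv)//; apply: limr_ge; first by apply/cvg_ex; exists 0.
exact: nearW.
Qed.

End exponential_clock.

(** * The main theorem *)

Section centering.
Context (R : realType) (f : R -> R) (c : R).
Hypothesis cf : cadlag f.

Lemma cvg_left_shift t : (f s - c - s) @[s --> t^'-] --> lim (f s @[s --> t^'-]) - c - t.
Proof.
apply: cvgB; last exact: cvg_within_filter.
by apply: cvgB; [exact: (cf t).2|exact: cvg_cst].
Qed.

Lemma cadlag_shift : cadlag (fun s => f s - c - s).
Proof.
move=> t; split; last by apply/cvg_ex; eexists; exact: cvg_left_shift.
apply: cvgB; last exact: cvg_within_filter.
by apply: cvgB; [exact: (cf t).1|exact: cvg_cst].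
Qed.

Lemma no_positive_jumps_shift : no_positive_jumps f -> no_positive_jumps (fun s => f s - c - s).
Proof. by move=> jf t; rewrite (cvg_lim _ (@cvg_left_shift t))// !lerB. Qed.

End centering.

Section centered_process.
Context d (T : measurableType d) (R : realType) (P : probability T R).
Variable X : R -> {RV P >-> R}.
Hypothesis lX : spectrally_negative_levy X.

(** [X 0] vanishes only almost surely. Subtracting it leaves the increments, hence the reflected
    process, unchanged for every [w]. *)
Definition centered t w := X t w - X 0 w - t.

Lemma measurable_sub_preim (B : set R) (c : R) : measurable B -> measurable [set u | B (u - c)].
Proof.
move=> mB; have : measurable_fun setT (fun u : R => u - c) by exact: measurable_funB.
by move=> /(_ measurableT _ mB); rewrite setTI.
Qed.

Lemma centered_levy : levy_from0 P centered.
Proof.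
split.
- move=> t; apply: measurable_funB => //; exact: measurable_funB.
- by move=> w; rewrite /centered subrr subr0.
- have := spneg_jumps lX; have := levy_cadlag (spneg_levy lX); apply: filterS2 => w cw jw.
  by split; [exact: cadlag_shift|exact: no_positive_jumps_shift].
- move=> s t h B st mB.
  (* Increments of the centered process are those of [X] shifted by the constant [t - s], so the set
     [B] is shifted instead. *)
  have := levy_stationary (spneg_levy lX) h st (measurable_sub_preim (t - s) mB).
  have e h' : [set w | B (centered (t + h') w - centered (s + h') w)] =
      [set w | B (X (t + h') w - X (s + h') w - (t - s))].
    by apply/funext => w /=; congr B; rewrite /centered; ring.
  by have e0 := e 0; rewrite !addr0 in e0; rewrite e e0.
- move=> n t nt.
  have -> : (fun (i : 'I_n) w => centered (t i.+1) w - centered (t i) w) =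
      (fun i w => X (t i.+1) w - X (t i) w - (t i.+1 - t i)).
    by apply/funext => i; apply/funext => w; rewrite /centered; ring.
  move=> B mB.
  exact: (levy_independent (spneg_levy lX) nt
    (fun i => measurable_sub_preim (t i.+1 - t i) (mB i))).
Qed.

Lemma ae_centered t : {ae P, forall w, centered t w = X t w - t}.
Proof.
have := levy_start (spneg_levy lX); apply: filterS => w X0.
by rewrite /centered X0 subr0.
Qed.

Lemma laplace_exponent_centered t c : 0 <= t ->
  laplace_exponent P (minus_drift (fun t w => X t w)) t = c%:E <-> mexp P centered t = expR c.
Proof.
move=> t0; have ly := centered_levy.
rewrite /laplace_exponent unlock.
have -> : (\int[P]_w (expR (t * minus_drift (fun t w => X t w) 1 w))%:E = (mexp P centered t)%:E)%E.
  rewrite EFin_Rintegral; last exact: (integrable_expy ly t0).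
  apply: ge0_ae_eq_integral.
  - exact: measurableT.
  - apply/measurable_EFinP; apply: measurableT_comp => //; apply: measurable_funM => //.
    exact: measurable_funB.
  - by apply/measurable_EFinP; exact: (measurable_expy ly).
  - by move=> w _; rewrite lee_fin expR_ge0.
  - by move=> w _; rewrite lee_fin expR_ge0.
  - by have := ae_centered 1; apply: filterS => w -> _.
rewrite /=; split=> [|->].
  by case: ifP => // /negbT; rewrite -ltNge => m0 [<-]; rewrite lnK.
by rewrite leNgt expR_gt0 /= expRK.
Qed.

(** Otherwise [X 1] would be 1 almost surely, with mean 1. This excludes the case in which the
    exponential moment is constantly 1. *)
Lemma centered_nondeg : ('E_P[X 1%R] = 0)%E -> ~ {ae P, forall w, centered 1 w = 0}.
Proof.
rewrite unlock => EX h.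
suff : (\int[P]_w (X 1 w)%:E = 1)%E by rewrite EX => /eqP; rewrite eq_sym onee_eq0.
transitivity (\int[P]_w (1 : \bar R))%E; last by rewrite integral_cst//= probability_setT mule1.
apply: ae_eq_integral => //; first exact/measurable_EFinP.
have := ae_centered 1; have := h; apply: filterS2 => w -> /eqP.
by rewrite eq_sym subr_eq0 => /eqP->.
Qed.

Lemma measurable_centered t : let G := [set A | exists t (B : set R), measurable B /\ A = X t @^-1` B] in
  measurable_fun setT (centered t : g_sigma_algebraType G -> R).
Proof.
move=> G.
have mX s : measurable_fun setT (X s : g_sigma_algebraType G -> R).
  by move=> _ B mB; rewrite setTI; apply: sub_gen_smallest; exists s, B.
by apply: measurable_funB => //; exact: measurable_funB.
Qed.

Lemma reflected_centered : reflected (minus_drift (fun t w => X t w)) = reflected centered.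
Proof.
apply/funext => t; apply/funext => w; congr ereal_sup; apply: eq_imagel => s _.
by rewrite /minus_drift /centered; congr EFin; ring.
Qed.

End centered_process.

Theorem theorem1 (d : measure_display) (T : measurableType d) (R : realType)
    (P : probability T R) (X : R -> {RV P >-> R}) :
  spectrally_negative_levy X ->
  ('E_P[X 1%R] = 0)%E ->
  let Y := minus_drift (fun t w => X t w) in
  let Phi := laplace_inverse (laplace_exponent P Y) in
  let M := running_inf (reflected Y) in
  0 < Phi 0 ->
  forall (x q : R) (e : {RV P >-> R}),
    0 < x -> 0 < q ->
    (forall B : set R, measurable B -> distribution P e B = exponential_prob q B) ->
    independent_of_process P (fun t w => X t w) e ->
    (\int[P]_w expeR (- (x%:E * M (e w) w)))%E =
    ((Phi 0 / (x + Phi 0)) * ((Phi q + x) / Phi q))%:E.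
Proof.
move=> lX EX Y Phi M Phi0 x q e x0 q0 elaw eX.
have ly := centered_levy lX.
have PhiE c : Phi c = sup [set t | 0 <= t /\ mexp P (centered X) t = expR c].
  rewrite /Phi /laplace_inverse; congr sup; apply/seteqP; split => t /= [t0].
    by move=> /(laplace_exponent_centered lX c t0).
  by move=> /(laplace_exponent_centered lX c t0).
(* Without a positive root the set defining [Phi 0] is empty, where [sup] is 0 by default, or
   contains 0 only; both contradict [0 < Phi 0]. *)
have [l [l0 ml]] : exists l, 0 < l /\ mexp P (centered X) l = 1.
  apply: contrapT => nl; move: Phi0; rewrite PhiE ltNge => /negP; apply.
  have [->|/set0P ne] := eqVneq [set t | 0 <= t /\ mexp P (centered X) t = expR 0] set0.
    by rewrite sup0.
  apply: ge_sup => // t [t0 mt]; rewrite leNgt; apply/negP => tgt0; apply: nl.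
  by exists t; rewrite mt expR0.
have mhalf := mexp_half ly (centered_nondeg lX EX) l0 ml.
have chord := mexp_chord ly.
have Phi0E : Phi 0 = l by rewrite PhiE expR0; exact: (sup_root1 chord l0 ml mhalf).
have q1 : 1 < expR q by rewrite -expR0 ltr_expR.
have [lphi mphi] := sup_root chord (mexp_ge0 P (centered X)) (mexp0 P (centered X)) l0 ml mhalf q1.
rewrite Phi0E /M /Y reflected_centered PhiE.
by apply: (exp_running_inf_clock ly l0 q0 lphi ml mhalf mphi _ _ (@measurable_centered _ _ _ _ X) eX x0).
Qed.
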